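(* Let $1\le k<n$, let $R\in SYT_k$ be a standard Young tableau whose shape has exactly two columns, and let $R'\in SYT_k$ be another tableau having the same shape as $R$. Let $S,T\in SYT_n^{R}$ and suppose that $S\leq_{weak}T$ is a covering relation in $SYT_n^{R}$. Then $\mathcal{V}_{[R,R']}(S)\leq_{weak}\mathcal{V}_{[R,R']}(T)$ is also a covering relation in $SYT_n^{R'}$.
   Context: $SYT_n$ is the set of standard Young tableaux with $n$ cells (English convention, rows and columns increasing). For a permutation $w\in \mathfrak{S}_n$ (written in one-line notation $w_1\ldots w_n$), $I(w)\in SYT_n$ is its Robinson–Schensted (row) insertion tableau, and for $T\in SYT_n$, $\mathcal{Y}_T=\{w\in \mathfrak{S}_n: I(w)=T\}$ is its Knuth class. The right weak Bruhat order on $\mathfrak{S}_n$ is the transitive (and reflexive) closure of: $u\leq_{weak} w$ if $w=u\cdot s_i$ with $\mathrm{length}(w)=\mathrm{length}(u)+1$, where $s_i=(i,i+1)$; that is, $w$ is obtained from $u=u_1\ldots u_n$ by swapping the letters $u_i<u_{i+1}$ in adjacent positions. The weak order $\leq_{weak}$ on $SYT_n$ is the partial order obtained as the transitive closure of the relation: $S\leq_{weak}T$ if there exist $\sigma\in\mathcal{Y}_S$, $\tau\in\mathcal{Y}_T$ with $\sigma\leq_{weak}\tau$. For $1\le k<n$ and $R\in SYT_k$, $SYT_n^{R}$ is the set of $T\in SYT_n$ whose subtableau $T_{[1,k]}$ consisting of the entries $1,\ldots,k$ equals $R$, ordered by $\leq_{weak}$. For $R,R'\in SYT_k$ of the same shape,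 the inner tableau translation map $\mathcal{V}_{[R,R']}:SYT_n^{R}\to SYT_n^{R'}$ sends $T$ to the tableau obtained by replacing the inner tableau $R$ of $T$ with $R'$ (leaving the other entries in place). A covering relation $S\leq_{weak} T$ in a set of tableaux means that $S\leq_{weak} T$, $S\neq T$, and there is no tableau $Q\ne S,T$ in that set with $S\leq_{weak}Q\leq_{weak}T$. *)

(* Defs.v *)
From Stdlib Require Import Relation_Operators.
From mathcomp Require Import all_boot fingroup perm.

Set Implicit Arguments.
Unset Strict Implicit.
Unset Printing Implicit Defensive.

(* A filling of a left-justified diagram, as the list of its rows from top to
   bottom (English convention). *)
Definition tableau := seq (seq nat).

Definition entry (T : tableau) (i j : nat) : nat := nth 0 (nth [::] T i) j.

(* Rows are nonempty of weakly decreasing length, rows and columns strictly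
   increase, and the entries are 1, ..., n, each exactly once. *)
Definition is_syt (n : nat) (T : tableau) : Prop :=
  [/\ [::] \notin T,
      sorted geq (shape T),
      all (sorted ltn) T,
      (forall i j, j < size (nth [::] T i.+1) -> entry T i j < entry T i.+1 j)
    & perm_eq (flatten T) (iota 1 n)].

Definition ncols (T : tableau) : nat := \max_(r <- T) size r.

(* Row insertion: [find] locates the leftmost (hence smallest) entry of the
   first row exceeding [x]; if there is none, [find] returns the length of the
   row and [set_nth] appends [x]. *)
Fixpoint row_insert (x : nat) (T : tableau) : tableau :=
  if T is r :: T' then
    let i := find (fun y => x < y) r in
    set_nth 0 r i x :: (if i < size r then row_insert (nth 0 r i) T' else T')
  else [:: [:: x]].

(* 'S_n permutes {0, ..., n-1}; letters are shifted to 1, ..., n. *)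
Definition one_line (n : nat) (w : 'S_n) : seq nat :=
  [seq (val (w i)).+1 | i <- enum 'I_n].

Definition insertion_tableau (n : nat) (w : 'S_n) : tableau :=
  foldl (fun T x => row_insert x T) [::] (one_line w).

Definition knuth_class (n : nat) (T : tableau) (w : 'S_n) : Prop :=
  insertion_tableau w = T.

Definition perm_length (n : nat) (w : 'S_n) : nat :=
  #|[set p : 'I_n * 'I_n | (p.1 < p.2) && (w p.2 < w p.1)]|.

(* In MathComp [(s * u) x = u (s x)], so [tperm i j * u] is u . s_i for
   right-to-left composition: it exchanges the letters in positions i and
   j = i+1. *)
Definition weak_step (n : nat) (u w : 'S_n) : bool :=
  [exists i : 'I_n, exists j : 'I_n,
    [&& val j == i.+1, w == (tperm i j * u)%g
      & perm_length w == (perm_length u).+1]].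

Definition perm_weak_le (n : nat) (u w : 'S_n) : bool :=
  connect (@weak_step n) u w.

(* No separate reflexive closure is needed: Knuth classes of standard tableaux
   are nonempty.  Related tableaux are insertion tableaux of elements of 'S_n,
   so this relation only involves standard tableaux with n cells. *)
Definition syt_weak_le (n : nat) : tableau -> tableau -> Prop :=
  clos_trans tableau (fun S T =>
    exists s t : 'S_n,
      [/\ knuth_class S s, knuth_class T t & perm_weak_le s t]).

(* The cells with entries 1, ..., k; rows left empty are deleted. *)
Definition inner_tableau (k : nat) (T : tableau) : tableau :=
  [seq r <- [seq [seq x <- r | x <= k] | r <- T] | r != [::]].

Definition syt_with_inner (n k : nat) (R T : tableau) : Prop :=
  is_syt n T /\ inner_tableau k T = R.

Definition inner_translation (R R' T : tableau) : tableau :=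
  mkseq (fun i => nth [::] R' i ++
                  drop (size (nth [::] R i)) (nth [::] T i)) (size T).

Definition weak_covering (n : nat) (A : tableau -> Prop) (S T : tableau) : Prop :=
  [/\ A S, A T, syt_weak_le n S T, S <> T
    & ~ exists Q, [/\ A Q, Q <> S, Q <> T, syt_weak_le n S Q
                    & syt_weak_le n Q T]].

(* Main.v *)
(* For values c, c+1, c+2, a dual Knuth move reverses the subword formed by them
   in a word where c+1 is not read between the other two.  It commutes with Knuth
   equivalence, and on tableaux it changes only the inner part; so it suffices to
   show that these moves, applied at inner values, are monotone for the weak order
   and connect the inner tableaux of a given two-column shape.

   Between two tableaux of the same class every intermediate one is again in the
   class: the longest decreasing subword on the letters at most j grows along the
   weak order, and these numbers determine a two-column tableau.  So it is enough
   to treat a single ascent swap.  The move commutes with it unless the swapped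
   letters are c and c+2.  If c+1 is read first, the words become
   (c+2) L c (c+1) and c L (c+2) (c+1); as an inner word has no increasing subword
   of length 3, all letters of L exceed c+2, and Knuth moves bring the two words
   to an ascent swap.  If c+1 is read last, they become (c+1)(c+2) L c and
   (c+1) c L (c+2), where L may contain smaller letters.  For inner tableaux whose
   entries below c fill the columns 1..a and a+1..a+b, those letters are matched
   like brackets with later ones and can be moved out of L.  The moves of the first
   kind and these special moves of the second kind already connect all two-column
   tableaux of a given shape. *)
From Stdlib Require Import Relation_Operators.
Require Import Defs.
From mathcomp Require Import all_boot fingroup perm.
From mathcomp Require Import zify.

Set Implicit Arguments.
Unset Strict Implicit.
Unset Printing Implicit Defensive.

(** The translations from [R] to [R'] and from [R'] to [R] are both shown to be monotone; being
    mutually inverse, they are isomorphisms of ordered sets, which preserve coverings. So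
    monotonicity is needed in both directions, and this is the obstacle: reversing a triple whose
    middle value is read first gives one whose middle value is read last, so the easy moves do not
    have easy inverses. They lead from the tableau whose columns are filled one after the other to
    every tableau of its shape, but in general not back. The way back uses moves at a triple that
    follows an initial block with [b <= a]; a decreasing subword of length [a.+2] then guarantees
    enough later letters to match the small ones standing in the way. A recurring device is
    uniformity: both words of a swap must be normalised alike, so the normal forms below have a
    prefix and a suffix that do not depend on the small letters being moved. *)

Inductive knuth : seq nat -> seq nat -> Prop :=
| knuth_refl s : knuth s s
| knuth_sym s t : knuth s t -> knuth t s
| knuth_trans s t w : knuth s t -> knuth t w -> knuth s w
| knuth_bac u v x y z : x < y < z ->
    knuth (u ++ [:: y; x; z] ++ v) (u ++ [:: y; z; x] ++ v)
| knuth_acb u v x y z : x < y < z ->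
    knuth (u ++ [:: x; z; y] ++ v) (u ++ [:: z; x; y] ++ v).

Lemma knuth_ctx u v s t : knuth s t -> knuth (u ++ s ++ v) (u ++ t ++ v).
Proof.
elim=> {s t} [s|s t _ IH|s t w _ IH1 _ IH2|u' v' x y z h|u' v' x y z h].
- exact: knuth_refl.
- exact: knuth_sym.
- exact: knuth_trans IH1 IH2.
- by have := knuth_bac (u ++ u') (v' ++ v) h; rewrite -!catA.
- by have := knuth_acb (u ++ u') (v' ++ v) h; rewrite -!catA.
Qed.

Lemma knuth_cons x s t : knuth s t -> knuth (x :: s) (x :: t).
Proof. by move/(knuth_ctx [:: x] [::]); rewrite !cats0. Qed.

Lemma knuth_catl u s t : knuth s t -> knuth (u ++ s) (u ++ t).
Proof. by move/(knuth_ctx u [::]); rewrite !cats0. Qed.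

Lemma knuth_catr v s t : knuth s t -> knuth (s ++ v) (t ++ v).
Proof. exact: (knuth_ctx [::] v). Qed.

Lemma knuth_bac3 v x y z : x < y -> y < z ->
  knuth [:: y, x, z & v] [:: y, z, x & v].
Proof. by move=> h1 h2; apply: (knuth_bac [::]); rewrite h1. Qed.

Lemma knuth_acb3 v x y z : x < y -> y < z ->
  knuth [:: x, z, y & v] [:: z, x, y & v].
Proof. by move=> h1 h2; apply: (knuth_acb [::]); rewrite h1. Qed.

(** Chains of Knuth moves are written with this rule: one factor is replaced, and the chain goes on
    from the new word. *)
Lemma knuth_at u v m m' s t : knuth m m' -> s = u ++ m ++ v ->
  knuth (u ++ m' ++ v) t -> knuth s t.
Proof. by move=> h -> h2; apply: knuth_trans h2; apply: knuth_ctx. Qed.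

Lemma knuth_perm s t : knuth s t -> perm_eq s t.
Proof.
elim=> {s t} [s|s t _ IH|s t w _ IH1 _ IH2|u v x y z _|u v x y z _] //.
- by rewrite perm_sym.
- exact: perm_trans IH1 IH2.
- by rewrite perm_cat2l perm_cat2r; apply/seq.permP=> p /=; lia.
- by rewrite perm_cat2l perm_cat2r; apply/seq.permP=> p /=; lia.
Qed.

Lemma knuth_uniq s t : knuth s t -> uniq s = uniq t.
Proof. by move/knuth_perm/perm_uniq. Qed.

(** If the exchanged letters [x] and [z] both survive, convexity keeps their witness [y] and the
    same move applies; otherwise the move becomes trivial. *)
Lemma knuth_filter (p : pred nat) s t :
    (forall x y z, x < y < z -> p x -> p z -> p y) ->
  knuth s t -> knuth (filter p s) (filter p t).
Proof.
move=> cvx; elim=> {s t} [s|s t _ IH|s t w _ IH1 _ IH2|u v x y z h|u v x y z h].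
- exact: knuth_refl.
- exact: knuth_sym.
- exact: knuth_trans IH1 IH2.
- rewrite !filter_cat; apply: knuth_ctx => /=; have := cvx _ _ _ h.
  case: (p x); case: (p z) => hp; try exact: knuth_refl.
  by rewrite hp //; case/andP: h => h1 h2; exact: knuth_bac3.
- rewrite !filter_cat; apply: knuth_ctx => /=; have := cvx _ _ _ h.
  case: (p x); case: (p z) => hp; try exact: knuth_refl.
  by rewrite hp //; case/andP: h => h1 h2; exact: knuth_acb3.
Qed.

(** * Row insertion *)

Definition reading (T : tableau) : seq nat := flatten (rev T).

Definition insert_word (w : seq nat) (T : tableau) : tableau :=
  foldl (fun T x => row_insert x T) T w.

Lemma reading_cons r T : reading (r :: T) = reading T ++ r.
Proof. by rewrite /reading rev_cons -cats1 flatten_cat /= cats0. Qed.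

(** The bumped letter is returned as a word of length at most one, so that the outputs of successive
    insertions concatenate to the word entering the next row. *)
Fixpoint row_bump (x : nat) (r : seq nat) : seq nat * seq nat :=
  if r is y :: r' then
    if x < y then (x :: r', [:: y])
    else let b := row_bump x r' in (y :: b.1, b.2)
  else ([:: x], [::]).

Fixpoint row_bumps (w r : seq nat) : seq nat * seq nat :=
  if w is x :: w' then
    let b := row_bump x r in
    let c := row_bumps w' b.1 in (c.1, b.2 ++ c.2)
  else (r, [::]).

Lemma row_insert_cons x r T :
  row_insert x (r :: T) =
  (row_bump x r).1 :: insert_word (row_bump x r).2 T.
Proof.
suff E : row_bump x r = (set_nth 0 r (find (fun y => x < y) r) x,
    take 1 (drop (find (fun y => x < y) r) r)).
  rewrite E /=; set i := find _ _; congr cons.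
  case: (ltnP i (size r)) => h; first by rewrite (drop_nth 0 h) /= take0.
  by rewrite drop_oversize.
elim: r => [//|y r IH] /=; case: ifP => _; first by rewrite /= take0.
by rewrite IH.
Qed.

Lemma insert_word_cat w1 w2 T :
  insert_word (w1 ++ w2) T = insert_word w2 (insert_word w1 T).
Proof. exact: foldl_cat. Qed.

(** The whole word can pass through the first row before the bumped letters enter the rest. This
    reduces Knuth invariance to a statement about a single row. *)
Lemma insert_word_cons w r T :
  insert_word w (r :: T) = (row_bumps w r).1 :: insert_word (row_bumps w r).2 T.
Proof.
elim: w r T => [//|x w IH] r T.
rewrite -[LHS]/(insert_word w (row_insert x (r :: T))) row_insert_cons IH.
by rewrite [row_bumps (x :: w) r]/= insert_word_cat.
Qed.

Lemma insert_word_nil x w :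
  insert_word (x :: w) [::] =
  (row_bumps (x :: w) [::]).1 :: insert_word (row_bumps (x :: w) [::]).2 [::].
Proof. by rewrite -insert_word_cons. Qed.

Lemma row_bumps_cat w1 w2 r : row_bumps (w1 ++ w2) r =
  let b := row_bumps w1 r in let c := row_bumps w2 b.1 in (c.1, b.2 ++ c.2).
Proof.
by elim: w1 r => [|x w1 IH] r /=; [case: row_bumps | rewrite IH /= catA].
Qed.

Lemma row_bump_lt x h r : x < h -> row_bump x (h :: r) = (x :: r, [:: h]).
Proof. by rewrite /= => ->. Qed.

Lemma row_bump_gt x h r : h < x ->
  row_bump x (h :: r) = (h :: (row_bump x r).1, (row_bump x r).2).
Proof. by move=> hx /=; rewrite ltnNge (ltnW hx). Qed.

Lemma row_bump_skip x lo r : all (ltn^~ x) lo ->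
  row_bump x (lo ++ r) = (lo ++ (row_bump x r).1, (row_bump x r).2).
Proof.
elim: lo => [|h lo IH]; first by rewrite /=; case: row_bump.
by case/andP=> hx /IH E; rewrite cat_cons row_bump_gt // E.
Qed.

Lemma row_bump_cat x lo hi : all (ltn^~ x) lo -> all (ltn x) hi ->
  row_bump x (lo ++ hi) = (lo ++ x :: behead hi, take 1 hi).
Proof.
move=> h1; rewrite row_bump_skip //.
by case: hi => [//|h hi] /andP[h2 _]; rewrite row_bump_lt //= take0.
Qed.

Lemma sorted_split x r : sorted ltn r -> x \notin r ->
  exists lo hi, [/\ r = lo ++ hi, all (ltn^~ x) lo & all (ltn x) hi].
Proof.
elim: r => [|y r IH] /=; first by exists [::], [::].
rewrite inE negb_or => hp /andP[hxy hx].
case: (ltnP x y) => h.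
  exists [::], (y :: r); split=> //=; rewrite h /=.
  by apply: sub_all (order_path_min ltn_trans hp) => z /=; apply: ltn_trans.
have [lo [hi [-> h1 h2]]] := IH (path_sorted hp) hx.
by exists (y :: lo), hi; split=> //=; rewrite h1; lia.
Qed.

Lemma sorted_cat_lt x lo hi : sorted ltn lo -> sorted ltn hi ->
  all (ltn^~ x) lo -> all (ltn x) hi -> sorted ltn (lo ++ x :: hi).
Proof.
move=> h1 h2 h3 h4; rewrite (sorted_pairwise ltn_trans) pairwise_cat.
rewrite -(sorted_pairwise ltn_trans) h1 /= -(sorted_pairwise ltn_trans) h2 h4 /= !andbT.
apply/allrelP => y z /(allP h3) /= hy; rewrite inE => /orP[/eqP->//|/(allP h4) /= hz].
exact: ltn_trans hy hz.
Qed.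

Lemma row_bump_sorted x r : sorted ltn r -> x \notin r ->
  sorted ltn (row_bump x r).1 /\
  perm_eq ((row_bump x r).1 ++ (row_bump x r).2) (x :: r).
Proof.
move=> hs hx; have [lo [hi [E h1 h2]]] := sorted_split hs hx.
rewrite E in hs *; rewrite row_bump_cat //=; split.
  apply: sorted_cat_lt => //; first by move/cat_sorted2: hs => [].
    by move/cat_sorted2: hs => [_]; case: hi {h2 E} => //= a l /path_sorted.
  by case: hi h2 {E hs} => //= a l /andP[].
case: hi {h2 E hs} => [|h hi] /=.
  by rewrite !cats0 -cat1s perm_catC.
rewrite take0; apply/seq.permP => p; rewrite /= !count_cat /=; lia.
Qed.

Lemma row_bumps_sorted w r : sorted ltn r -> uniq (r ++ w) ->
  sorted ltn (row_bumps w r).1 /\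
  perm_eq ((row_bumps w r).1 ++ (row_bumps w r).2) (r ++ w).
Proof.
elim: w r => [|x w IH] r hs hu /=; first by [].
have hx : x \notin r.
  by move: hu; rewrite cat_uniq => /and3P[_ /hasPn/(_ x)]; rewrite inE eqxx => /(_ isT).
have [h1 h2] := row_bump_sorted hs hx.
set b := row_bump x r in h1 h2 *.
have hp : perm_eq (r ++ x :: w) ((b.1 ++ b.2) ++ w).
  apply: (@perm_trans _ ((x :: r) ++ w)).
    by apply/seq.permP=> p; rewrite /= !count_cat /=; lia.
  by rewrite perm_cat2r perm_sym.
have hu' : uniq (b.1 ++ w).
  move: hu; rewrite (perm_uniq hp) -catA uniq_catCA => ?.
  have := subseq_uniq (suffix_subseq b.2 (b.1 ++ w)); exact.
have [h3 h4] := IH _ h1 hu'; split=> //.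
apply: (@perm_trans _ ((b.1 ++ b.2) ++ w)); last by rewrite perm_sym.
apply/seq.permP => p; move/seq.permP/(_ p): h4; rewrite !count_cat; lia.
Qed.

Lemma row_bump_nil x : row_bump x [::] = ([:: x], [::]).
Proof. by []. Qed.

Ltac lt_closure := repeat match goal with
  | H1 : is_true (?a < ?b), H2 : is_true (?b < ?c) |- _ =>
    assert_fails (assert (is_true (a < c)) by assumption);
    have ? := ltn_trans H1 H2
  end.

Ltac bump := repeat (cbn [fst snd]; first
  [ rewrite row_bump_nil
  | rewrite -> row_bump_skip by assumption
  | rewrite -> row_bump_lt by assumption
  | rewrite -> row_bump_gt by assumption ]); cbn [fst snd].

(** The letters [x < y < z] cut the row into blocks [A], [B], [C], [D]. Only letters at the left
    ends of [B], [C], [D] can be bumped, which leaves a finite check; the two bumped words turn out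
    equal or related by one Knuth move. *)
Lemma row_bumps_tri m m' r x y z : x < y < z ->
    (m, m') = ([:: y; x; z], [:: y; z; x]) \/
    (m, m') = ([:: x; z; y], [:: z; x; y]) ->
    sorted ltn r -> uniq (r ++ m) ->
  (row_bumps m r).1 = (row_bumps m' r).1 /\
  (knuth (row_bumps m r).2 (row_bumps m' r).2).
Proof.
move=> /andP[hxy hyz] hm hs hu.
have /and3P[hx hy hz] : [&& x \notin r, y \notin r & z \notin r].
  move: hu; rewrite cat_uniq => /and3P[_ /hasPn h _].
  by rewrite !h //; case: hm => -[-> _]; rewrite !inE eqxx ?orbT.
have [A [r1 [E1 A1 r1x]]] := sorted_split hs hx.
have hs1 : sorted ltn r1 by move: hs; rewrite E1 => /cat_sorted2[].
have hy1 : y \notin r1 by apply: contra hy; rewrite E1 mem_cat => ->; rewrite orbT.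
have hz1 : z \notin r1 by apply: contra hz; rewrite E1 mem_cat => ->; rewrite orbT.
have [B [r2 [E2 B1 r2y]]] := sorted_split hs1 hy1.
have hs2 : sorted ltn r2 by move: hs1; rewrite E2 => /cat_sorted2[].
have hz2 : z \notin r2 by apply: contra hz1; rewrite E2 mem_cat => ->; rewrite orbT.
have [C [D [E3 C1 D1]]] := sorted_split hs2 hz2.
have hD : sorted ltn D by move: hs2; rewrite E3 => /cat_sorted2[].
have hsB : sorted ltn B by move: hs1; rewrite E2 => /cat_sorted2[].
have hsC : sorted ltn C by move: hs2; rewrite E3 => /cat_sorted2[].
have Bx : all (ltn x) B by move: r1x; rewrite E2 all_cat => /andP[].
have Cy : all (ltn y) C by move: r2y; rewrite E3 all_cat => /andP[].
have wk a b s : a < b -> all (ltn^~ a) s -> all (ltn^~ b) s.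
  by move=> hab; apply: sub_all => u /= hu1; exact: ltn_trans hu1 hab.
have Ay := wk _ _ _ hxy A1; have Az := wk _ _ _ hyz Ay.
have Bz := wk _ _ _ hyz B1.
have dD : if D is [:: d, d' & _] then d < d' else true.
  by case: D hD {E3 D1} => [|d [|d' D]] //= /andP[].
have fC : if C is [:: c, c' & _] then c < c' else true.
  by case: C hsC {E3 C1 Cy} => [|d [|d' C]] //= /andP[].
subst r r1 r2; clear hs hu hx hy hz hs1 hy1 hz1 hs2 hz2 hD hsB hsC r1x r2y wk.
(* At most the head of [B] and the first two letters of [C] and of [D] are touched, hence 18 shapes
   of the row for each of the two moves. *)
case: B B1 Bx Bz => [|b B] /=; [move=> _ _ _|move=> /andP[? ?] /andP[? ?] /andP[? ?]];
case: C C1 Cy fC => [|c [|c' C]] /=;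
  [move=> _ _ _|move=> /andP[? ?] /andP[? ?] _
  |move=> /and3P[? ? ?] /and3P[? ? ?] ?|move=> _ _ _|move=> /andP[? ?] /andP[? ?] _
  |move=> /and3P[? ? ?] /and3P[? ? ?] ?];
case: D D1 dD => [|d [|d' D]] /=;
  [move=> _ _|move=> /andP[? _] _|move=> /and3P[? ? ?] ?
  |move=> _ _|move=> /andP[? _] _|move=> /and3P[? ? ?] ?
  |move=> _ _|move=> /andP[? _] _|move=> /and3P[? ? ?] ?
  |move=> _ _|move=> /andP[? _] _|move=> /and3P[? ? ?] ?
  |move=> _ _|move=> /andP[? _] _|move=> /and3P[? ? ?] ?
  |move=> _ _|move=> /andP[? _] _|move=> /and3P[? ? ?] ?];
lt_closure; case: hm => -[-> ->]; cbn [row_bumps]; bump; (split; [by []|]);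
cbn [cat];
first [ exact: knuth_refl | apply: knuth_bac3; assumption
  | apply: knuth_acb3; assumption
  | apply: knuth_sym; apply: knuth_bac3; assumption
  | apply: knuth_sym; apply: knuth_acb3; assumption ].
Qed.

Lemma row_bump_perm x r :
  perm_eq ((row_bump x r).1 ++ (row_bump x r).2) (x :: r).
Proof.
elim: r => [//|h r IH] /=; case: ifP => _ /=.
  by apply/seq.permP => p; rewrite /= count_cat /=; lia.
by apply/seq.permP => p; move/seq.permP/(_ p): IH => /= ->; lia.
Qed.

Lemma row_bumps_knuth s t r : knuth s t -> sorted ltn r -> uniq (r ++ s) ->
  (row_bumps s r).1 = (row_bumps t r).1 /\
  knuth (row_bumps s r).2 (row_bumps t r).2.
Proof.
have tri u v m m' x y z : x < y < z ->
    (m, m') = ([:: y; x; z], [:: y; z; x]) \/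
    (m, m') = ([:: x; z; y], [:: z; x; y]) ->
    sorted ltn r -> uniq (r ++ u ++ m ++ v) ->
    (row_bumps (u ++ m ++ v) r).1 = (row_bumps (u ++ m' ++ v) r).1 /\
    knuth (row_bumps (u ++ m ++ v) r).2 (row_bumps (u ++ m' ++ v) r).2.
  move=> hxyz hm hr hu; rewrite !(row_bumps_cat u) /= !row_bumps_cat /=.
  have hu1 : uniq (r ++ u) by move: hu; rewrite catA cat_uniq => /andP[].
  have [hr1 hp] := row_bumps_sorted hr hu1.
  set b := row_bumps u r in hr1 hp *.
  have hu2 : uniq (b.1 ++ m).
    have : uniq (b.1 ++ b.2 ++ m ++ v).
      by rewrite catA (perm_uniq (s2 := (r ++ u) ++ m ++ v)) -?catA //
        !catA !perm_cat2r.
    apply: subseq_uniq; rewrite cat_subseq //.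
    by apply: subseq_trans (suffix_subseq _ _); exact: prefix_subseq.
  have [-> hk] := row_bumps_tri hxyz hm hr1 hu2.
  by split=> //; apply: knuth_ctx.
move=> h hr; elim: h => {s t} [s|s t h IH|s t w h IH1 _ IH2|u v x y z h|u v x y z h] hu.
- by split=> //; exact: knuth_refl.
- have hu' : uniq (r ++ s).
    by rewrite (perm_uniq (s2 := r ++ t)) // perm_cat2l knuth_perm.
  by have [-> hk] := IH hu'; split=> //; exact: knuth_sym.
- have hu' : uniq (r ++ t).
    by rewrite (perm_uniq (s2 := r ++ s)) // perm_cat2l perm_sym knuth_perm.
  have [-> hk1] := IH1 hu; have [-> hk2] := IH2 hu'.
  by split=> //; exact: knuth_trans hk1 hk2.
- by apply: (tri u v _ _ _ _ _ h) => //; left.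
- by apply: (tri u v _ _ _ _ _ h) => //; right.
Qed.

Lemma row_bump_size x r : size r <= size (row_bump x r).1 /\
  0 < size (row_bump x r).1.
Proof. by elim: r => [//|h r IH] /=; case: ifP => _ //=; lia. Qed.

Lemma row_bumps_size w r : size r <= size (row_bumps w r).1.
Proof.
elim: w r => [//|x w IH] r /=.
by apply: leq_trans (IH _); case: (row_bump_size x r).
Qed.

Notation tabl w := (insert_word w [::]).

(** The first rows agree and the bumped words are again Knuth equivalent. They are shorter, because
    the first row keeps at least one letter, so induction on the length applies. *)
Theorem knuth_tabl s t : knuth s t -> uniq s -> tabl s = tabl t.
Proof.
have [n] := ubnP (size s); elim: n s t => // n IH s t hn h hu.
have hsz := perm_size (knuth_perm h).
have [] := row_bumps_knuth (r := [::]) h isT hu.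
have [_ hp] := row_bumps_sorted (r := [::]) isT hu.
have hp' := perm_uniq hp.
case: s t h hu hn hsz hp hp' => [|x s] [|y t] // h hu hn hsz hp hp'.
rewrite !insert_word_nil => -> hk; congr cons; apply: IH hk _.
  rewrite -(ltn_add2l (size (row_bumps (x :: s) [::]).1)) -size_cat (perm_size hp).
  have h0 : 0 < size (row_bumps (x :: s) [::]).1 := row_bumps_size s [:: x].
  by apply: leq_trans hn _; rewrite -add1n leq_add2r.
by move: hp'; rewrite hu cat_uniq => /and3P[].
Qed.

Fixpoint dom (r r2 : seq nat) : bool :=
  match r, r2 with
  | _, [::] => true
  | x :: r', y :: r2' => (x < y) && dom r' r2'
  | [::], _ :: _ => false
  end.

(** The set of entries is left free, so that the predicate passes to the lower rows and to inner
    tableaux. *)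
Definition tab (T : tableau) : bool :=
  [&& [::] \notin T, all (sorted ltn) T & sorted dom T].

Lemma dom0 r : dom r [::]. Proof. by case: r. Qed.

Lemma dom_bump_le x r r2 : dom r r2 -> dom (row_bump x r).1 r2.
Proof.
elim: r r2 => [|h r IH] [|k r2]; rewrite ?dom0 //=.
case/andP=> hk hd; case: ifP => hx /=; first by rewrite hd (ltn_trans hx hk).
by rewrite hk IH.
Qed.

Lemma row_bump_gt_out x r y : y \in (row_bump x r).2 -> x < y.
Proof.
by elim: r => [//|h r IH] /=; case: ifP => hx //=; rewrite inE => /eqP->.
Qed.

(** The entry below the old cell of [y] exceeds [y], so [y] lands weakly to the left of its old
    column, under an entry that is at most [x], hence smaller than [y]. *)
Lemma dom_bump x r y r2 : x \notin r -> y \notin r2 -> (row_bump x r).2 = [:: y] ->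
  dom r r2 -> dom (row_bump x r).1 (row_bump y r2).1.
Proof.
elim: r r2 => [//|h r IH] r2 /=; rewrite inE negb_or => /andP[hxh hxr] hy.
case: ifP => hx /=.
  case: r2 hy => [|k r2] hy [<-] /=; first by rewrite hx dom0.
  by case/andP=> hk hd; rewrite hk /= hx.
have hhx : h < x by rewrite ltn_neqAle eq_sym hxh leqNgt hx.
move=> E; have xy : x < y by apply: (@row_bump_gt_out x r); rewrite E mem_head.
have hhy := ltn_trans hhx xy.
case: r2 hy => [|k r2] /=; first by rewrite hhy dom0.
rewrite inE negb_or => /andP[_ hy] /andP[hk hd]; case: ifP => hyk /=.
  by rewrite hhy dom_bump_le.
by rewrite hk IH.
Qed.

Lemma row_insert_perm x T : perm_eq (flatten (row_insert x T)) (x :: flatten T).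
Proof.
elim: T x => [//|r T IH] x; rewrite row_insert_cons /=.
have := row_bump_perm x r.
have : size (row_bump x r).2 <= 1.
  by elim: r => [//|h r IHr] /=; case: ifP.
case: (row_bump x r) => r' [|y [|? ?]] //= _ hp.
  by rewrite cats0 in hp; rewrite -cat_cons perm_cat2r.
apply: (@perm_trans _ (r' ++ y :: flatten T)); first by rewrite perm_cat2l.
by rewrite -cat1s catA -cat_cons perm_cat2r.
Qed.

Lemma insert_word_perm w T : perm_eq (flatten (insert_word w T)) (w ++ flatten T).
Proof.
elim: w T => [//|x w IH] T.
rewrite -[insert_word _ _]/(insert_word w (row_insert x T)).
apply: perm_trans (IH _) _.
rewrite -[(x :: w) ++ _]/([:: x] ++ w ++ flatten T) perm_sym perm_catCA perm_cat2l.
by rewrite perm_sym row_insert_perm.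
Qed.

Lemma row_insert_tab x T : tab T -> uniq (x :: flatten T) -> tab (row_insert x T).
Proof.
have ind r U : tab (r :: U) = [&& r != [::], sorted ltn r, tab U &
    (if U is r2 :: _ then dom r r2 else true)].
  rewrite /tab inE negb_or eq_sym /=; case: U => [|r2 U] /=; last rewrite !inE.
    by rewrite !andbT; case: (r == _) => //=; rewrite andbT.
  by case: (r != _); case: (sorted ltn r); case: (dom r r2); rewrite /= ?andbF ?andbT.
elim: T x => [//|r T IH] x; rewrite ind row_insert_cons => /and4P[_ hr hT hd].
rewrite [flatten _]/= cons_uniq mem_cat negb_or cat_uniq.
move=> /andP[/andP[hxr hxT]] /and3P[hur hn huT].
have [hs hp] := row_bump_sorted hr hxr.
have [_ h0] := row_bump_size x r.
rewrite ind -size_eq0 -lt0n h0 hs /=.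
case E : (row_bump x r).2 => [|y o].
  by rewrite /= hT; case: T hd {IH hT hxT hn huT} => //= r2 T; exact: dom_bump_le.
have Eo : o = [::].
  have : size (row_bump x r).2 <= 1.
    by elim: r {hr hxr hd hs h0 hp hur hn E} => [//|h r IHr] /=; case: ifP.
  by rewrite E; case: o {E}.
subst o; rewrite -[insert_word _ _]/(row_insert y T).
have hyr : y \in r.
  have : y \in x :: r by rewrite -(perm_mem hp) E mem_cat mem_head orbT.
  rewrite inE => /orP[/eqP Ey|//].
  by have := @row_bump_gt_out x r y; rewrite E mem_head Ey ltnn => /(_ isT).
have hyT : y \notin flatten T.
  by apply/negP => hyT; case/negP: hn; apply/hasP; exists y.
rewrite IH //=; last by rewrite hyT.
case: T hd {IH hT hxT hn huT} hyT => [|r2 T] hd hyT.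
  exact: (@dom_bump x r y [::] hxr isT E (dom0 r)).
rewrite row_insert_cons; apply: dom_bump => //.
by apply: contra hyT => h; rewrite /= mem_cat h.
Qed.

Lemma insert_word_tab w T : tab T -> uniq (w ++ flatten T) -> tab (insert_word w T).
Proof.
elim: w T => [//|x w IH] T hT hu.
rewrite -[insert_word _ _]/(insert_word w (row_insert x T)); apply: IH.
  by apply: row_insert_tab => //; move: hu;
    rewrite -[(x :: w) ++ _]/([:: x] ++ w ++ flatten T) uniq_catCA cat_uniq => /and3P[].
rewrite (perm_uniq (s2 := w ++ x :: flatten T)) ?perm_cat2l ?row_insert_perm //.
by rewrite -[x :: flatten T]cat1s uniq_catCA.
Qed.

Lemma tabl_tab w : uniq w -> tab (tabl w).
Proof. by move=> hu; apply: insert_word_tab => //; rewrite cats0. Qed.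

Lemma tabl_perm w : perm_eq (flatten (tabl w)) w.
Proof. by have := insert_word_perm w [::]; rewrite cats0. Qed.

Lemma reading_perm T : perm_eq (reading T) (flatten T).
Proof. by apply: perm_flatten; rewrite perm_rev. Qed.

(** The letter [x] moves left one place at a time; the witness of each exchange is the letter to the
    left of the exchanged pair. *)
Lemma knuth_slide h x r : sorted ltn (h :: r) -> x < h ->
  knuth (h :: r ++ [:: x]) (h :: x :: r).
Proof.
elim: r h => [|k r IH] h /=; first by move=> *; exact: knuth_refl.
case/andP=> hk hr hx.
apply: knuth_trans (knuth_cons h (IH k hr (ltn_trans hx hk))) _.
by apply: knuth_sym; apply: knuth_bac3.
Qed.

Lemma knuth_row_bump x r : sorted ltn r -> x \notin r ->
  knuth (r ++ [:: x]) ((row_bump x r).2 ++ (row_bump x r).1).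
Proof.
move=> hs hx; have [lo [hi [E h1 h2]]] := sorted_split hs hx.
rewrite E in hs *; rewrite row_bump_cat //= {E hx r}.
case: hi hs h2 => [|h hi] hs h2 /=; first by rewrite cats0; exact: knuth_refl.
rewrite take0 -catA /=; case/andP: h2 => hxh _.
apply: (@knuth_trans _ (lo ++ [:: h, x & hi])).
  by apply/knuth_catl/knuth_slide => //; case/cat_sorted2: hs.
(* The letter [x] now stands right after the bumped [h]. It remains to move [h] left through [lo],
   where the witness is the letter to the right of the exchanged pair. *)
have hlo : sorted ltn (lo ++ [:: x]).
  by apply: sorted_cat_lt => //; case/cat_sorted2: hs.
elim: lo hlo {hs h1} => [|l lo IH]; first by move=> _; exact: knuth_refl.
move=> hp; have := knuth_cons l (IH (path_sorted hp)).
move/knuth_trans; apply=> /=.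
case: lo hp {IH} => [|k lo] /= /andP[hlk hp]; apply: knuth_acb3 => //.
have: path ltn k (lo ++ [:: x]) by [].
by rewrite cats1 => /(order_path_min ltn_trans); rewrite all_rcons => /andP[/= + _] => /ltn_trans; apply.
Qed.

Lemma knuth_row_insert x T : all (sorted ltn) T -> uniq (x :: flatten T) ->
  knuth (reading T ++ [:: x]) (reading (row_insert x T)).
Proof.
elim: T x => [|r T IH] x; first by move=> _ _; exact: knuth_refl.
move=> /andP[hr hT]; rewrite [flatten _]/= cons_uniq mem_cat negb_or cat_uniq.
move=> /andP[/andP[hxr hxT]] /and3P[hur hn huT].
rewrite row_insert_cons !reading_cons -catA.
apply: knuth_trans (knuth_catl _ (knuth_row_bump hr hxr)) _; rewrite catA.
apply: knuth_catr.
have [_ hp] := row_bump_sorted hr hxr.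
case E : (row_bump x r).2 => [|y o]; first by rewrite cats0; exact: knuth_refl.
have Eo : o = [::].
  have : size (row_bump x r).2 <= 1.
    by elim: r {hr hxr hp hur hn E} => [//|h r IHr] /=; case: ifP.
  by rewrite E; case: o {E}.
subst o; apply: IH => //=; rewrite huT andbT.
have hyr : y \in r.
  have : y \in x :: r by rewrite -(perm_mem hp) E mem_cat mem_head orbT.
  rewrite inE => /orP[/eqP Ey|//].
  by have := @row_bump_gt_out x r y; rewrite E mem_head Ey ltnn => /(_ isT).
by apply/negP => hyT; case/negP: hn; apply/hasP; exists y.
Qed.

(** Each insertion is a chain of Knuth moves on the reading word. Together with [knuth_tabl] this
    identifies Knuth classes with the fibres of [tabl]. *)
Theorem knuth_reading w : uniq w -> knuth w (reading (tabl w)).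
Proof.
elim/last_ind: w => [|w x IH] hu; first exact: knuth_refl.
have [hxw huw] : x \notin w /\ uniq w by move: hu; rewrite rcons_uniq => /andP[].
rewrite -cats1 insert_word_cat /=.
apply: knuth_trans (knuth_catr _ (IH huw)) _.
apply: knuth_row_insert; first by case/and3P: (tabl_tab huw).
by rewrite cons_uniq (perm_mem (tabl_perm w)) hxw (perm_uniq (tabl_perm w)).
Qed.

Lemma row_bumps_skip x w r : all (ltn x) w ->
  row_bumps w (x :: r) = (x :: (row_bumps w r).1, (row_bumps w r).2).
Proof.
elim: w r => [//|y w IH] r /= /andP[hxy hw].
by rewrite ltnNge (ltnW hxy) /= IH.
Qed.

Lemma row_bumps_dom r r2 : sorted ltn r -> dom r r2 -> row_bumps r r2 = (r, r2).
Proof.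
elim: r r2 => [[] //|x r IH] r2 hs hd.
have hx := order_path_min ltn_trans hs; have hr := path_sorted hs.
case: r2 hd => [_|y r2 /andP[hxy hd]] /=; first by rewrite row_bumps_skip // IH ?dom0.
by rewrite hxy /= row_bumps_skip // IH.
Qed.

Theorem tabl_reading T : tab T -> tabl (reading T) = T.
Proof.
(* A row inserted on top of a tableau that it may legally cover displaces the old top row as a
   whole, which then displaces the next one in the same way. *)
have top r U : tab (r :: U) -> insert_word r U = r :: U.
  elim: U r => [|r2 U IH] r /and3P[].
    move=> h0 /andP[hs _] _; case: r h0 hs => // x r _ hs.
    by rewrite insert_word_nil row_bumps_dom.
  rewrite inE negb_or => /andP[_ h0] /andP[hs hss] /andP[hd hds].
  rewrite insert_word_cons row_bumps_dom //=; congr cons; apply: IH.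
  by apply/and3P.
elim: T => [//|r T IH] hT; rewrite reading_cons insert_word_cat IH ?top //.
by case/and3P: hT; rewrite inE negb_or => /andP[_ h1] /andP[_ h2] /path_sorted h3; apply/and3P.
Qed.

Lemma knuth_rev s t : knuth s t -> knuth (rev s) (rev t).
Proof.
elim=> {s t} [s|s t _ IH|s t w _ IH1 _ IH2|u v x y z h|u v x y z h].
- exact: knuth_refl.
- exact: knuth_sym.
- exact: knuth_trans IH1 IH2.
- by rewrite !rev_cat -!catA; apply: knuth_sym; exact: knuth_acb.
- by rewrite !rev_cat -!catA; apply: knuth_sym; exact: knuth_bac.
Qed.

(** * Lengths of increasing and decreasing subwords *)

Definition has_inc (l : nat) (s : seq nat) : Prop :=
  exists t, [/\ subseq t s, sorted ltn t & size t = l].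

Lemma subseq_catP (t u v : seq nat) : subseq t (u ++ v) ->
  exists t1 t2, [/\ t = t1 ++ t2, subseq t1 u & subseq t2 v].
Proof.
case/subseqP => m hm ->; rewrite size_cat in hm.
exists (mask (take (size u) m) u), (mask (drop (size u) m) v).
rewrite -mask_cat ?cat_take_drop ?mask_subseq //.
by rewrite size_takel // hm leq_addr.
Qed.

(** An increasing subword is cut into its parts in [u], [m] and [v]. The replacement of the middle
    part respects the same lower and upper bounds, so it still fits between the other two. *)
Lemma has_inc_local l u v m m' :
    (forall t, subseq t m -> sorted ltn t -> exists t',
      [/\ subseq t' m', sorted ltn t', size t' = size t &
          (forall a, all (ltn a) t -> all (ltn a) t') /\
          (forall a, all (ltn^~ a) t -> all (ltn^~ a) t')]) ->
  has_inc l (u ++ m ++ v) -> has_inc l (u ++ m' ++ v).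
Proof.
move=> loc [t [/subseq_catP[t1 [t23 [-> h1 /subseq_catP[t2 [t3 [-> h2 h3]]]]]]]].
rewrite (sorted_pairwise ltn_trans) !pairwise_cat -!(sorted_pairwise ltn_trans).
rewrite allrel_catr => /and3P[/andP[a12 a13] s1 /and3P[a23 s2 s3]] hs.
have [t' [h2' s2' hs' [lo hi]]] := loc _ h2 s2.
exists (t1 ++ t' ++ t3); split; first by rewrite !cat_subseq.
  rewrite (sorted_pairwise ltn_trans) !pairwise_cat -!(sorted_pairwise ltn_trans).
  rewrite allrel_catr a13 s1 s2' s3 !andbT /=; apply/andP; split.
    by apply/allP => a /(allP a12); exact: lo.
  rewrite allrelC; apply/allP => a ha; apply: hi.
  by move: a23; rewrite allrelC => /allP/(_ a ha).
by rewrite -hs !size_cat hs'.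
Qed.

(** Only the increasing pair [x], [z] of exchanged letters can be lost. It is replaced by [y], [z]
    in the first kind of move and by [x], [y] in the second. *)
Lemma has_inc_knuth l s t : knuth s t -> has_inc l s <-> has_inc l t.
Proof.
elim=> {s t} [s|s t _ [IH1 IH2]|s t w _ IH1 _ IH2|u v x y z|u v x y z].
- by [].
- by split.
- by rewrite IH1.
- move=> /andP[hxy hyz]; have hxz := ltn_trans hxy hyz.
  have hyx : (y < x) = false by apply/negbTE; rewrite -leqNgt ltnW.
  have hzx : (z < x) = false by apply/negbTE; rewrite -leqNgt ltnW.
  split; apply: has_inc_local => t /subseqP[[|[] [|[] [|[] [|? ?]]]] // _ ->];
    rewrite [mask _ _]/= [sorted _ _]/=;
    rewrite ?hyx ?hzx ?andbF // => _;
    first [ by exists [::]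
    | by exists [:: y; z]; split; rewrite //= ?hyz ?eqxx ?(gtn_eqF hxz) ?eqxx //;
        split=> a /=; rewrite !andbT => /andP[h1 h2]; apply/andP; split;
        first [assumption | exact: ltn_trans h1 hxy | exact: ltn_trans hyz h2]
    | by exists [:: x]; split; rewrite ?sub1seq ?inE ?eqxx ?orbT
    | by exists [:: y]; split; rewrite ?sub1seq ?inE ?eqxx ?orbT
    | by exists [:: z]; split; rewrite ?sub1seq ?inE ?eqxx ?orbT ].
- move=> /andP[hxy hyz]; have hxz := ltn_trans hxy hyz.
  have hzy : (z < y) = false by apply/negbTE; rewrite -leqNgt ltnW.
  have hzx : (z < x) = false by apply/negbTE; rewrite -leqNgt ltnW.
  split; apply: has_inc_local => t /subseqP[[|[] [|[] [|[] [|? ?]]]] // _ ->];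
    rewrite [mask _ _]/= [sorted _ _]/=;
    rewrite ?hzy ?hzx ?andbF // => _;
    first [ by exists [::]
    | by exists [:: x; y]; split; rewrite //= ?hxy ?eqxx ?(ltn_eqF hxz) ?(gtn_eqF hyz) ?(ltn_eqF hyz) ?eqxx //;
        split=> a /=; rewrite !andbT => /andP[h1 h2]; apply/andP; split;
        first [assumption | exact: ltn_trans h1 hxy | exact: ltn_trans hyz h2]
    | by exists [:: x]; split; rewrite ?sub1seq ?inE ?eqxx ?orbT
    | by exists [:: y]; split; rewrite ?sub1seq ?inE ?eqxx ?orbT
    | by exists [:: z]; split; rewrite ?sub1seq ?inE ?eqxx ?orbT ].
Qed.

(** * The weak order on words *)

Inductive weak : seq nat -> seq nat -> Prop :=
| weak_knuth s t : knuth s t -> weak s t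
| weak_swap u v a b : a < b -> weak (u ++ [:: a; b] ++ v) (u ++ [:: b; a] ++ v)
| weak_trans s t w : weak s t -> weak t w -> weak s w.

Lemma weak_refl s : weak s s.
Proof. exact/weak_knuth/knuth_refl. Qed.

Lemma weak_ctx u v s t : weak s t -> weak (u ++ s ++ v) (u ++ t ++ v).
Proof.
elim=> {s t} [s t h|u' v' a b h|s t w _ IH1 _ IH2].
- exact/weak_knuth/knuth_ctx.
- by have := weak_swap (u ++ u') (v' ++ v) h; rewrite -!catA.
- exact: weak_trans IH1 IH2.
Qed.

Lemma weak_catl u s t : weak s t -> weak (u ++ s) (u ++ t).
Proof. by move/(weak_ctx u [::]); rewrite !cats0. Qed.

Lemma weak_perm s t : weak s t -> perm_eq s t.
Proof.
elim=> {s t} [s t|u v a b _|s t w _ IH1 _ IH2]; first exact: knuth_perm.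
  by rewrite perm_cat2l perm_cat2r; apply/seq.permP=> p /=; lia.
exact: perm_trans IH1 IH2.
Qed.

Lemma weak_filter (p : pred nat) s t :
    (forall x y z, x < y < z -> p x -> p z -> p y) ->
  weak s t -> weak (filter p s) (filter p t).
Proof.
move=> cvx; elim=> {s t} [s t h|u v a b h|s t w _ IH1 _ IH2].
- exact/weak_knuth/knuth_filter.
- rewrite !filter_cat; apply: weak_ctx => /=.
  case: (p a); case: (p b); try exact: weak_refl.
  exact: (weak_swap [::] [::]).
- exact: weak_trans IH1 IH2.
Qed.

Lemma has_inc_swap l u v a b : a < b ->
  has_inc l (u ++ [:: b; a] ++ v) -> has_inc l (u ++ [:: a; b] ++ v).
Proof.
move=> hab; have hba : (b < a) = false by apply/negbTE; rewrite -leqNgt ltnW.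
apply: has_inc_local => t /subseqP[[|[] [|[] [|? ?]]] // _ ->];
    rewrite [mask _ _]/= [sorted _ _]/=;
  rewrite ?hba // => _;
  first [ by exists [::]
  | by exists [:: a]; split; rewrite ?sub1seq ?inE ?eqxx ?orbT
  | by exists [:: b]; split; rewrite ?sub1seq ?inE ?eqxx ?orbT ].
Qed.

Lemma has_inc_weak l s t : weak s t -> has_inc l t -> has_inc l s.
Proof.
elim=> {s t} [s t h|u v a b|s t w _ IH1 _ IH2 h].
- by rewrite (has_inc_knuth _ h).
- exact: has_inc_swap.
- exact/IH1/IH2.
Qed.

Lemma has_dec_weak l s t : weak s t -> has_inc l (rev s) -> has_inc l (rev t).
Proof.
elim=> {s t} [s t h|u v a b hab|s t w _ IH1 _ IH2 h].
- by rewrite (has_inc_knuth _ (knuth_rev h)).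
- by rewrite !rev_cat -!catA; apply: has_inc_swap.
- exact/IH2/IH1.
Qed.

(** Reversal turns decreasing subwords into increasing ones. A decreasing subword of the reading
    word meets each row at most once, since rows increase. *)
Lemma has_inc_rows l T : all (sorted ltn) T ->
  has_inc l (rev (reading T)) -> l <= size T.
Proof.
elim: T l => [|r T IH] l /=.
  by move=> _ [t [ht _ <-]]; move: ht; rewrite subseq0 => /eqP->.
case/andP=> hr hT; rewrite reading_cons rev_cat.
case=> t [/subseq_catP[t1 [t2 [-> h1 h2]]] hs <-]; rewrite size_cat.
have [hs1 hs2] := cat_sorted2 hs.
have h2' : size t2 <= size T by apply: IH => //; exists t2.
suff h : size t1 <= 1 by rewrite -add1n leq_add.
have : subseq (rev t1) r by rewrite -subseq_rev revK.
move/(subseq_sorted ltn_trans)/(_ hr); rewrite rev_sorted.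
case: t1 hs1 {h1 hs} => [|x [|y t1]] //= /andP[hxy _] /andP[hyx _].
by have := ltn_trans hxy hyx; rewrite ltnn.
Qed.

Lemma tab_cons r T : tab (r :: T) = [&& r != [::], sorted ltn r, tab T &
  (if T is r2 :: _ then dom r r2 else true)].
Proof.
rewrite /tab inE negb_or eq_sym /=; case: T => [|r2 T] /=; last rewrite !inE.
  by rewrite !andbT; case: (r == _) => //=; rewrite andbT.
by case: (r != _); case: (sorted ltn r); case: (dom r r2); rewrite /= ?andbF ?andbT.
Qed.

Lemma tab_heads T : tab T -> sorted ltn (map (head 0) T).
Proof.
elim: T => [//|r T IH]; rewrite tab_cons => /and4P[hr _ hT hd].
case: T hT hd IH => [//|r2 T] hT hd IH; rewrite /= -[path _ _ _]/(sorted ltn (map (head 0) (r2 :: T))) IH // andbT.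
move: hT; rewrite tab_cons => /andP[h2 _].
by case: r r2 hr h2 hd {IH} => [|x r] [|y r2] //= _ _ /andP[].
Qed.

Lemma has_inc_tab T : tab T -> has_inc (size T) (rev (reading T)).
Proof.
move=> hT; exists (map (head 0) T); rewrite size_map tab_heads //; split=> //.
elim: T hT => [//|r T IH]; rewrite tab_cons => /and4P[hr _ hT _].
rewrite reading_cons rev_cat -[map _ _]/([:: head 0 r] ++ map (head 0) T).
apply: cat_subseq; last exact: IH.
by case: r hr => //= x r _; rewrite sub1seq mem_rev mem_head.
Qed.

Lemma has_inc_row T r : r \in T -> sorted ltn r -> has_inc (size r) (reading T).
Proof.
move=> hr hs; exists r; split=> //; elim: T hr => [//|r2 T IH].
rewrite inE reading_cons => /orP[/eqP->|/IH h]; first exact: suffix_subseq.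
exact: subseq_trans h (prefix_subseq _ _).
Qed.

(** The number of rows is the largest length of a decreasing subword, and ascent swaps destroy no
    decreasing subword. *)
Lemma nrows_weak s t : uniq s -> weak s t -> size (tabl s) <= size (tabl t).
Proof.
move=> hu h; have hut : uniq t by rewrite -(perm_uniq (weak_perm h)).
have /and3P[_ hs _] := tabl_tab hut.
apply: has_inc_rows => //.
apply/(has_inc_knuth _ (knuth_rev (knuth_reading hut))).
apply: has_dec_weak h _.
by apply/(has_inc_knuth _ (knuth_rev (knuth_reading hu))); apply: has_inc_tab; exact: tabl_tab.
Qed.

(** * Inner tableaux *)

Lemma inner_cons k r T : inner_tableau k (r :: T) =
  if [seq x <- r | x <= k] == [::] then inner_tableau k T
  else [seq x <- r | x <= k] :: inner_tableau k T.
Proof. by rewrite /inner_tableau map_cons; case: ([seq x <- r | x <= k]). Qed.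

Lemma reading_inner k T : reading (inner_tableau k T) = [seq x <- reading T | x <= k].
Proof.
elim: T => [//|r T IH]; rewrite inner_cons reading_cons filter_cat -IH.
by case: eqP => [->|_]; rewrite ?cats0 // reading_cons.
Qed.

Lemma dom_filter k r r2 : sorted ltn r2 -> dom r r2 ->
  dom [seq x <- r | x <= k] [seq x <- r2 | x <= k].
Proof.
elim: r r2 => [|x r IH] [|y r2]; rewrite ?dom0 //.
move=> hs /andP[hxy hd]; have hs2 := path_sorted hs => /=.
case: (leqP y k) => hy; first by rewrite (ltnW (leq_trans hxy hy)) /= hxy IH.
suff -> : [seq x <- r2 | x <= k] = [::] by exact: dom0.
apply/eqP; rewrite -[_ == _]negbK -has_filter; apply/hasPn => z.
by move/(allP (order_path_min ltn_trans hs)) => /= hz; rewrite -ltnNge (ltn_trans hy hz).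
Qed.

Lemma inner_nil k r T : tab (r :: T) -> [seq x <- r | x <= k] = [::] ->
  inner_tableau k T = [::].
Proof.
elim: T r => [//|r2 T IH] r; rewrite tab_cons => /and4P[_ _ hT hd] E.
have E2 : [seq x <- r2 | x <= k] = [::].
  move: hT; rewrite tab_cons => /and4P[_ hs _ _].
  by have := dom_filter k hs hd; rewrite E; case: [seq x <- r2 | x <= k].
by rewrite inner_cons E2 eqxx (IH r2).
Qed.

Lemma inner_tab k T : tab T -> tab (inner_tableau k T).
Proof.
elim: T => [//|r T IH] hrT; move: (hrT); rewrite tab_cons inner_cons => /and4P[_ hr hT hd].
case: eqP => [E|/eqP E]; first exact: IH.
rewrite tab_cons E (sorted_filter ltn_trans) // IH //=.
case: T hT hd {IH hrT} => [//|r2 T] hT hd; rewrite inner_cons.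
case: eqP => [E2|_]; first by rewrite (inner_nil hT E2).
by apply: dom_filter => //; move: hT; rewrite tab_cons => /and4P[].
Qed.

Lemma leq_convex k x y z : x < y < z -> x <= k -> z <= k -> y <= k.
Proof. by move=> /andP[_ /ltnW hyz] _; exact: leq_trans. Qed.

(** Restriction to the letters at most [k] respects Knuth equivalence and turns the reading word of
    a tableau into that of its inner tableau. *)
Lemma inner_tabl k s : uniq s ->
  inner_tableau k (tabl s) = tabl [seq x <- s | x <= k].
Proof.
move=> hu; have h := knuth_filter (@leq_convex k) (knuth_reading hu).
rewrite (knuth_tabl h) ?filter_uniq //.
by rewrite -reading_inner tabl_reading // inner_tab // tabl_tab.
Qed.

(** * Two-column tableaux *)

Fixpoint two_columns (a b : seq nat) : tableau :=
  match a, b with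
  | x :: a', y :: b' => [:: x; y] :: two_columns a' b'
  | x :: a', [::] => [:: x] :: two_columns a' [::]
  | [::], _ => [::]
  end.

Lemma row_insert_col x a : path ltn x a ->
  row_insert x (two_columns a [::]) = two_columns (x :: a) [::].
Proof.
elim: a x => [//|y a IH] x /andP[hxy hp].
by rewrite row_insert_cons row_bump_lt //= -/(row_insert _ _) IH.
Qed.

Lemma row_insert_col2 y a b : path ltn y b -> dom a (y :: b) ->
  row_insert y (two_columns a b) = two_columns a (y :: b).
Proof.
elim: b a y => [|z b IH] [//|x a] y hp /andP[hxy hd].
  by rewrite row_insert_cons row_bump_gt.
case/andP: hp => hyz hp.
rewrite row_insert_cons row_bump_gt // row_bump_lt //.
by rewrite -[RHS]/([:: x; y] :: two_columns a (z :: b)) -(IH a z).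
Qed.

Lemma tabl_two_columns a b : sorted ltn a -> sorted ltn b -> dom a b ->
  tabl (rev a ++ rev b) = two_columns a b.
Proof.
move=> ha; have Ea : tabl (rev a) = two_columns a [::].
  elim: a ha => [//|x a IH] hp; rewrite rev_cons -cats1 insert_word_cat.
  by rewrite IH ?(path_sorted hp) //= row_insert_col.
rewrite insert_word_cat {}Ea.
elim: b => [//|y b IH] hp hd; rewrite rev_cons -cats1 insert_word_cat IH.
- exact: row_insert_col2.
- exact: path_sorted hp.
elim: a b y hp hd {IH ha} => [//|x a IH] [//|z b] y /andP[hyz hp] /andP[hxy hd] /=.
by rewrite (ltn_trans hxy hyz) (IH b z).
Qed.

Lemma has_inc_two_decreasing l a b : sorted ltn a -> sorted ltn b ->
  has_inc l (rev a ++ rev b) -> l <= 2.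
Proof.
have one c t : sorted ltn c -> subseq t (rev c) -> sorted ltn t -> size t <= 1.
  move=> hc h hs; have : subseq (rev t) c by rewrite -subseq_rev revK.
  move/(subseq_sorted ltn_trans)/(_ hc); rewrite rev_sorted.
  case: t hs {h} => [|x [|y t1]] //= /andP[hxy _] /andP[hyx _].
  by have := ltn_trans hxy hyx; rewrite ltnn.
move=> ha hb [t [/subseq_catP[t1 [t2 [-> h1 h2]]] hs <-]].
have [hs1 hs2] := cat_sorted2 hs; rewrite size_cat -[2]/(1 + 1).
exact: leq_add (one _ _ ha h1 hs1) (one _ _ hb h2 hs2).
Qed.

Lemma two_columns_eq T : tab T -> all (fun r => size r <= 2) T ->
  let b := flatten (map behead T) in
  [/\ T = two_columns (map (head 0) T) b, sorted ltn b & dom (map (head 0) T) b].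
Proof.
have one r U : size r <= 1 -> tab (r :: U) -> flatten (map behead U) = [::] /\
    U = two_columns (map (head 0) U) [::].
  elim: U r => [//|r2 U IH] r hr; rewrite tab_cons => /and4P[_ _ hT hd].
  have hr2 : size r2 <= 1.
    by case: r hr hd => [|? [|? ?]] //= _; case: r2 {hT IH} => [|? [|? ?]] //= /andP[].
  have [h1 h2] := IH _ hr2 hT.
  move: hT; rewrite tab_cons => /and4P[h0 _ _ _].
  by case: r2 hr2 h0 {hd} => [|x [|? ?]] //= _ _; rewrite h1 -h2.
elim: T => [//|r T IH] hrT /= /andP[hr hs].
move: (hrT); rewrite tab_cons => /and4P[h0 hsr hT hd].
have [h1 h2 h3] := IH hT hs.
case: r hr h0 hrT hd hsr => [|x [|y [|? ?]]] //= _ _ hrT hd hxy.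
  by have [-> <-] := one [:: x] T isT hrT.
rewrite -h1 h3; split=> //.
case: T h2 hs hd hT {IH h1 h3 hrT} => [//|r2 T] /= h2 /andP[hr2 hs] hd hT.
move: (hT); rewrite tab_cons => /and4P[h0 _ _ _].
case: r2 h2 hr2 h0 hd hT => [|x' [|y' [|? ?]]] //= h2 _ _ /andP[_ hyy] hT.
  by have [-> _] := one [:: x'] T isT hT.
by rewrite h2; case/andP: hyy => ->.
Qed.

Lemma size_inner k T : tab T -> size (inner_tableau k T) = count (leq^~ k) (map (head 0) T).
Proof.
elim: T => [//|r T IH]; rewrite tab_cons inner_cons => /and4P[h0 hs hT _] /=.
case: r h0 hs => [//|x r] _ hs /=.
case: (leqP x k) => hx /=; first by rewrite IH // add1n.
suff -> : [seq x <- r | x <= k] = [::] by rewrite eqxx IH.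
apply/eqP; rewrite -[_ == _]negbK -has_filter; apply/hasPn => z.
by move/(allP (order_path_min ltn_trans hs)) => /= hz; rewrite -ltnNge (ltn_trans hx hz).
Qed.

Lemma perm_columns T : tab T ->
  perm_eq (flatten T) (map (head 0) T ++ flatten (map behead T)).
Proof.
elim: T => [//|r T IH]; rewrite tab_cons => /and4P[+ _ /IH h _].
case: r => [//|x r] _ /=; rewrite perm_cons perm_sym perm_catCA perm_cat2l perm_sym.
exact: h.
Qed.

Lemma two_columns_inj Q R : tab Q -> tab R ->
    all (fun r => size r <= 2) Q -> all (fun r => size r <= 2) R ->
    perm_eq (flatten Q) (flatten R) -> uniq (flatten Q) ->
    (forall j, size (inner_tableau j Q) = size (inner_tableau j R)) ->
  Q = R.
Proof.
move=> hQ hR cQ cR hp hu hj.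
have [EQ sQ _] := two_columns_eq hQ cQ; have [ER sR _] := two_columns_eq hR cR.
have hds := perm_columns.
have E : map (head 0) Q = map (head 0) R.
  apply: (irr_sorted_eq ltn_trans ltnn); rewrite ?tab_heads // => x.
  (* An entry lies in the first column exactly when admitting it adds a row to the inner tableau. So
     the row counts determine the first column, and the second is its complement. *)
  have cnt T : tab T -> uniq (flatten T) ->
      (x \in map (head 0) T) + (if x is y.+1 then size (inner_tableau y T) else 0) =
      size (inner_tableau x T).
    move=> hT hU; rewrite -(count_uniq_mem x).
      rewrite size_inner //; case: x => [|y].
        by rewrite addn0; apply: eq_count => z /=; rewrite leqn0.
      rewrite size_inner // -count_predUI.
      rewrite [X in _ + X](eq_count (a2 := pred0)) ?count_pred0 ?addn0.
        by apply: eq_count => z /=; rewrite [z <= y.+1]leq_eqVlt.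
      by move=> z /=; apply/negbTE/negP => /andP[/eqP->]; rewrite ltnn.
    by move: hU; rewrite (perm_uniq (hds _ hT)) cat_uniq => /and3P[].
  have := cnt Q hQ hu; have := cnt R hR; rewrite -(perm_uniq hp) => /(_ hu).
  rewrite -(hj x); case: x {cnt} => [|y]; rewrite -?(hj y) => <- /eqP;
  by rewrite eqn_add2r => /eqP; do 2 case: (_ \in _).
rewrite EQ ER E; congr two_columns.
apply: (irr_sorted_eq ltn_trans ltnn) => // x.
have hm T : tab T -> uniq (flatten T) -> (x \in flatten (map behead T)) =
    (x \in flatten T) && (x \notin map (head 0) T).
  move=> hT; rewrite (perm_uniq (hds _ hT)) (perm_mem (hds _ hT)) mem_cat cat_uniq.
  case/and3P=> _ /hasPn hn _; case h: (x \in flatten _); rewrite ?orbT ?orbF ?andbN //.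
  by rewrite /= (hn x h).
by rewrite !hm -?(perm_uniq hp) // (perm_mem hp) E.
Qed.

Theorem weak_between s x t : uniq s -> weak s x -> weak x t ->
    tabl s = tabl t -> all (fun r => size r <= 2) (tabl s) ->
  tabl x = tabl s.
Proof.
move=> hus hsx hxt hst hc.
have px := weak_perm hsx; have hux : uniq x by rewrite -(perm_uniq px).
have hut : uniq t by rewrite -(perm_uniq (weak_perm hxt)).
apply: two_columns_inj; rewrite ?tabl_tab //.
(* A row of length 3 would be an increasing subword of length 3. It would pull back along [weak] to
   [s], whose class contains a union of two decreasing words. *)
- apply/allP => r hr; rewrite leqNgt; apply/negP => h3.
  have /and3P[_ /allP/(_ r hr) hsr _] := tabl_tab hux.
  have : has_inc 3 s.
    apply: has_inc_weak hsx _; apply/(has_inc_knuth _ (knuth_reading hux)).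
    have [u [h1 h2 h3']] := has_inc_row hr hsr.
    exists (take 3 u); rewrite take_sorted // size_takel ?h3' //; split=> //.
    exact: subseq_trans (take_subseq _ _) h1.
  have [E hb hd] := two_columns_eq (tabl_tab hus) hc.
  have ha := tab_heads (tabl_tab hus).
  rewrite -tabl_two_columns // in E.
  set u := rev _ ++ rev _ in E.
  have huu : uniq u.
    by rewrite -(perm_uniq (tabl_perm u)) -E (perm_uniq (tabl_perm s)).
  have hk : knuth s u.
    apply: knuth_trans (knuth_reading hus) _.
    by rewrite E; exact: knuth_sym (knuth_reading huu).
  by move/(has_inc_knuth _ hk)/(has_inc_two_decreasing ha hb).
- by rewrite (perm_trans (tabl_perm _)) // perm_sym (perm_trans (tabl_perm _)).
- by rewrite (perm_uniq (tabl_perm _)).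
(* The row counts of the restrictions grow from [s] to [x] to [t] and agree at both ends. *)
move=> j; rewrite !inner_tabl //.
apply/eqP; rewrite eqn_leq -inner_tabl // -(inner_tabl _ hus) {1}hst !inner_tabl //.
by apply/andP; split; apply: nrows_weak; rewrite ?filter_uniq //;
  exact: weak_filter (@leq_convex j) _.
Qed.

(** * Exchanging three consecutive values around a word *)

(* [Y] is the first row of the insertion tableau of [L], and [X] is read off the
   letters bumped out of it; a smaller letter [z] in front is never bumped. *)
Lemma row_normal_form L : uniq L -> exists X Y,
  [/\ perm_eq (X ++ Y) L, sorted ltn Y, (Y == [::]) = (L == [::]) &
      forall z, all (ltn z) L -> knuth (z :: L) (X ++ z :: Y)].
Proof.
elim/last_ind: L => [|L x IH]; first by exists [::], [::]; split=> // z _; exact: knuth_refl.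
rewrite rcons_uniq => /andP[hx /IH[X [Y [hp hY _ hz]]]].
have hxY : x \notin Y.
  by apply: contra hx => h; rewrite -(perm_mem hp) mem_cat h orbT.
have [hs hp2] := row_bump_sorted hY hxY.
exists (X ++ (row_bump x Y).2), (row_bump x Y).1; split=> //.
- rewrite -cats1 -catA; apply: (@perm_trans _ (X ++ Y ++ [:: x])); last first.
    by rewrite catA perm_cat2r.
  by rewrite perm_cat2l perm_catC (perm_trans hp2) // perm_sym perm_catC.
- have [_] := row_bump_size x Y.
  by case: (row_bump x Y).1 => // ? ? _; case: L {IH hx hp hz}.
move=> z; rewrite all_rcons => /andP[/= hzx hzL].
rewrite -cats1 -catA -[z :: L ++ [:: x]]/((z :: L) ++ [:: x]).
apply: knuth_trans (knuth_catr _ (hz _ hzL)) _; rewrite -catA; apply: knuth_catl.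
have hzY : all (ltn z) Y.
  by apply/allP => y hy; apply: (allP hzL); rewrite -(perm_mem hp) mem_cat hy orbT.
have hszY : sorted ltn (z :: Y) by rewrite /= (path_sortedE ltn_trans) hzY.
have hxzY : x \notin z :: Y by rewrite inE negb_or hxY andbT gtn_eqF.
by have := knuth_row_bump hszY hxzY; rewrite row_bump_gt.
Qed.

(** The normal form of [L] takes the same prefix out of both words and leaves [r Y p q] and
    [p Y r q]. For empty [Y] these are Knuth equivalent. If [Y] starts with [h] and continues with
    [Y'], they become [r h p q Y'] and [h r p q Y'], which differ by swapping the ascent [r h]. *)
Lemma weak_rotate_max p q r L : p < q -> q < r -> uniq L -> all (ltn r) L ->
  weak (r :: L ++ [:: p; q]) (p :: L ++ [:: r; q]).
Proof.
move=> hpq hqr hu hL; have hpr := ltn_trans hpq hqr.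
have hLp : all (ltn p) L by apply: sub_all hL => z; apply: ltn_trans.
have [X [Y [hp hY h0 hz]]] := row_normal_form hu.
apply: weak_trans (weak_knuth (knuth_catr [:: p; q] (hz r hL))) _.
apply: weak_trans _ (weak_knuth (knuth_sym (knuth_catr [:: r; q] (hz p hLp)))).
have hrY : all (ltn r) Y.
  by apply/allP => y hy; apply: (allP hL); rewrite -(perm_mem hp) mem_cat hy orbT.
rewrite -!catA; apply: weak_catl.
case: Y hY hrY {h0 hp hz} (h0) => [_ _|h Y hY /andP[hrh hrY] _].
  by move=> _; apply/weak_knuth/knuth_sym; exact: knuth_acb3.
have {}hrh : r < h := hrh.
have {}hrY : all (ltn r) Y := hrY.
have hshY : sorted ltn [:: r, h & Y] by rewrite /= hrh.
have hsrY : sorted ltn (r :: Y) by rewrite /= (path_sortedE ltn_trans) hrY (path_sorted hY).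
apply: (@weak_trans _ [:: r, h, p, q & Y]).
  apply: weak_knuth.
  apply: (knuth_at (u := [::]) (v := [:: q]) (knuth_slide hshY hpr)).
    by rewrite /= -catA.
  apply: (knuth_at (u := [:: r; p]) (v := [::]) (knuth_slide hY (ltn_trans hqr hrh))).
    by rewrite cats0.
  by rewrite cats0; apply: knuth_bac3.
apply: (@weak_trans _ [:: h, r, p, q & Y]).
  exact: (weak_swap [::] [:: p, q & Y] hrh).
apply/weak_knuth/knuth_sym.
apply: (knuth_at (u := [:: p]) (v := [:: q]) (knuth_slide hY hrh)).
  by rewrite /= -catA.
apply: (knuth_at (u := [:: p; h]) (v := [::]) (knuth_slide hsrY hqr)).
  by rewrite cats0.
rewrite cats0; apply: knuth_trans (knuth_acb3 _ hpr hrh) _.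
by apply/knuth_cons/knuth_acb3.
Qed.

(** The ascent [x y] moves right past the next letter [z < y]: for [x < z] the word becomes [y x z]
    with ascent [x z], otherwise [x z y] with ascent [z y]. *)
Lemma knuth_ascent_last x y L : x < y -> sorted gtn (y :: L) -> uniq (x :: L) ->
  exists M p q, p < q /\ knuth [:: x, y & L] (M ++ [:: p; q]).
Proof.
elim: L x y => [|z L IH] x y hxy hs; first by exists [::], x, y; split=> //; exact: knuth_refl.
move: (hs) => /= /andP[hzy hL]; rewrite inE negb_or => /andP[/andP[hxz hxL] /andP[hzL hu]].
case: (ltngtP x z) hxz => // hxz _.
  have [|M [p [q [hpq hk]]]] := IH x z hxz hL; first by rewrite /= hxL.
  exists (y :: M), p, q; split=> //.
  exact: knuth_trans (knuth_acb3 _ hxz hzy) (knuth_cons _ hk).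
have hyL : sorted gtn (y :: L).
  have gt_trans : transitive gtn by move=> ? ? ? /= h1 h2; exact: ltn_trans h2 h1.
  rewrite /= (path_sortedE gt_trans) (path_sorted hL) andbT.
  apply: sub_all (order_path_min gt_trans hL) => w /= hw; exact: ltn_trans hw hzy.
have [|M [p [q [hpq hk]]]] := IH z y hzy hyL; first by rewrite /= hzL.
exists (x :: M), p, q; split=> //.
exact: knuth_trans (knuth_sym (knuth_bac3 _ hxz hxy)) (knuth_cons _ hk).
Qed.

Lemma knuth_last_ascent L : uniq L -> sorted gtn L \/
  exists M p q, p < q /\ knuth L (M ++ [:: p; q]).
Proof.
elim: L => [|x L IH] hu; [by left|move: (hu) => /andP[hx /IH[hs|]]]; last first.
  move=> [M [p [q [hpq hk]]]]; right; exists (x :: M), p, q; split=> //.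
  exact: knuth_cons.
case: L hs hx hu {IH} => [|y L] hs; first by left.
rewrite inE negb_or => /andP[hxy hxL] hu.
case: (ltngtP x y) hxy => // hxy _; last by left; rewrite /= hxy.
right; apply: knuth_ascent_last => //=; rewrite hxL.
by case/and3P: hu.
Qed.

Lemma knuth_slide_decreasing z D x : sorted gtn (D ++ [:: x]) -> z < x ->
  knuth (z :: D ++ [:: x]) (D ++ [:: z; x]).
Proof.
elim: D => [|d D IH] hs hz; first exact: knuth_refl.
have hs' : sorted gtn (D ++ [:: x]) := path_sorted hs.
apply: knuth_trans _ (knuth_cons d (IH hs' hz)).
case: D hs {IH hs'} => [|k D] /= /andP[hkd hp]; apply: knuth_acb3 => //.
have gt_trans : transitive gtn by move=> ? ? ? /= h1 h2; exact: ltn_trans h2 h1.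
have := order_path_min gt_trans hp; rewrite all_cat => /and3P[_ /= hxk _].
exact: ltn_trans hz hxk.
Qed.

(** If [L] is Knuth equivalent to a word ending in an ascent [a b], then [b] can be moved out to the
    right past [p] and past [r], with [a] as witness, and induction applies to what is left.
    Otherwise [L] is decreasing, and everything but its last letter moves out to the left. *)
Lemma weak_exchange p q r L : p < q -> q < r -> uniq L -> all (ltn r) L ->
  weak (q :: r :: L ++ [:: p]) (q :: p :: L ++ [:: r]).
Proof.
move=> hpq hqr; have hpr := ltn_trans hpq hqr.
have [n] := ubnP (size L); elim: n L => // n IH L hn hu hL.
case: (knuth_last_ascent hu) => [hs|[M [a [b [hab hk]]]]]; last first.
  have hperm := knuth_perm hk.
  have /and3P[hrM hra hrb] : [&& all (ltn r) M, r < a & r < b].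
    by move: hL; rewrite (perm_all _ hperm) all_cat /= andbT.
  have huM : uniq (M ++ [:: a]).
    move: hu; rewrite (perm_uniq hperm) -[M ++ [:: a; b]]/(M ++ [:: a] ++ [:: b]) catA.
    by rewrite cat_uniq => /andP[].
  have hMa : all (ltn r) (M ++ [:: a]) by rewrite all_cat hrM /= hra.
  have hsz : size (M ++ [:: a]) < n.
    by move: hn; rewrite (perm_size hperm) !size_cat /= addn2 addn1.
  apply: (@weak_trans _ ([:: q; r] ++ M ++ [:: a; p; b])).
    apply: weak_knuth.
    apply: (knuth_at (u := [:: q; r]) (v := [:: p]) hk) => //.
    rewrite -catA; apply: (knuth_at (u := [:: q, r & M]) (v := [::])
      (knuth_sym (knuth_bac3 [::] (ltn_trans hpr hra) hab))) => //=.
    exact: knuth_refl.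
  apply: weak_trans (_ : weak _ ([:: q; p] ++ M ++ [:: a; r; b])) _.
    have := weak_ctx [::] [:: b] (IH _ hsz huM hMa).
    by rewrite /= -!catA.
  apply: weak_knuth; apply: knuth_sym.
  apply: (knuth_at (u := [:: q; p]) (v := [:: r]) hk) => //.
  rewrite -catA; apply: (knuth_at (u := [:: q, p & M]) (v := [::])
      (knuth_sym (knuth_bac3 [::] hra hab))) => //=.
  exact: knuth_refl.
case/lastP: L hs hL {hn hu} => [_ _|L l].
  by apply/weak_knuth/knuth_sym; exact: knuth_bac3.
rewrite -cats1 all_cat /= andbT => hs /andP[hrL hrl].
have hsx x : x < l -> sorted gtn ((L ++ [:: l]) ++ [:: x]).
  move=> hxl; case: L hs {hrL} => [|d L] /=; first by rewrite hxl.
  by rewrite cats1 => hs; rewrite cats1 rcons_path hs last_rcons.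
have hsr x : all (ltn x) L -> sorted gtn (L ++ [:: x]).
  case: L hs {hrL hsx} => [|d L] //= hs hx.
  rewrite cats1 rcons_path; move: hs; rewrite cats1 rcons_path => /andP[-> _] /=.
  exact: (allP (hx : all (ltn x) (d :: L)) _ (mem_last d L)).
apply: (@weak_trans _ (L ++ [:: q; p; r; l])).
  apply: weak_knuth.
  apply: (knuth_at (u := [:: q]) (v := [:: p]) (knuth_slide_decreasing hs hrl)) => //.
  apply: (knuth_at (u := [::]) (v := [:: l; p]) (knuth_slide_decreasing (hsr _ hrL) hqr)).
    by rewrite /= -!catA.
  rewrite cat0s -catA; apply: knuth_catl.
  apply: knuth_trans (knuth_cons q (knuth_sym (knuth_bac3 _ hpr hrl))) _.
  exact: knuth_sym (knuth_bac3 _ hpq hqr).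
apply: (@weak_trans _ (L ++ [:: q; p; l; r])).
  by have := weak_swap (L ++ [:: q; p]) [::] hrl; rewrite -!catA.
apply/weak_knuth/knuth_sym.
apply: (knuth_at (u := [:: q]) (v := [::]) (knuth_slide_decreasing (hsx _ hrl) hpr)).
  by rewrite cats0.
have hql := ltn_trans hqr hrl.
rewrite cats0 -catA.
apply: (knuth_at (u := [::]) (v := [:: p; r]) (knuth_slide_decreasing hs hql)).
  by rewrite /= -!catA.
rewrite cat0s -catA; apply: knuth_catl.
exact: knuth_sym (knuth_bac3 _ hpq hql).
Qed.

Lemma knuth_pass A B : uniq (A ++ B) -> exists X Y, perm_eq (X ++ Y) (A ++ B) /\
  forall s y c, s < y -> y < c -> all (ltn c) (A ++ B) ->
    knuth (s :: A ++ c :: B ++ [:: y]) (X ++ [:: c, s, y & Y]).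
Proof.
move=> hu; have huB : uniq B by move: hu; rewrite cat_uniq => /and3P[].
have [X1 [Y1 [hp1 hY1 _ hz1]]] := row_normal_form huB.
have hu2 : uniq (A ++ X1).
  have : uniq ((A ++ X1) ++ Y1) by rewrite -catA (perm_uniq (s2 := A ++ B)) // perm_cat2l.
  by rewrite cat_uniq => /andP[].
have [X2 [Y2 [hp2 hY2 h02 hz2]]] := row_normal_form hu2.
have hp : perm_eq (X2 ++ Y2 ++ Y1) (A ++ B).
  by rewrite catA (perm_trans (y := (A ++ X1) ++ Y1)) ?perm_cat2r // -catA perm_cat2l.
have step s y c : s < y -> y < c -> all (ltn c) (A ++ B) ->
    knuth (s :: A ++ c :: B ++ [:: y]) (X2 ++ (s :: Y2) ++ [:: c, y & Y1]).
  move=> hsy hyc hc; have hsc := ltn_trans hsy hyc.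
  have hcB : all (ltn c) B by move: hc; rewrite all_cat => /andP[].
  have hcY1 : sorted ltn (c :: Y1).
    rewrite /= (path_sortedE ltn_trans) hY1 andbT.
    by move: hcB; rewrite -(perm_all _ hp1) all_cat => /andP[].
  have hs2 : all (ltn s) (A ++ X1).
    apply: sub_all (_ : all (ltn c) _) => [z|]; first exact: ltn_trans.
    by move: hc; rewrite -(perm_all _ hp) catA all_cat (perm_all _ hp2) => /andP[].
  apply: (knuth_at (u := s :: A) (v := [:: y]) (hz1 c hcB)) => //.
  apply: (knuth_at (u := (s :: A) ++ X1) (v := [::]) (knuth_slide hcY1 hyc)).
    by rewrite cats0 -!catA.
  rewrite cats0.
  apply: (knuth_at (u := [::]) (v := [:: c, y & Y1]) (hz2 s hs2)) => //.
  by rewrite -catA; exact: knuth_refl.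
case: Y2 hY2 h02 hp hp2 step {hz2} => [|h Y2] hY2 h02 hp hp2 step.
  exists X2, Y1; split=> // s y c hsy hyc hc.
  apply: knuth_trans (step _ _ _ hsy hyc hc) _; apply: knuth_catl.
  exact: knuth_acb3.
exists (X2 ++ [:: h]), (Y2 ++ Y1); split=> [|s y c hsy hyc hc].
  by rewrite -catA.
apply: knuth_trans (step _ _ _ hsy hyc hc) _; rewrite -catA; apply: knuth_catl.
have /andP[hch hcY2] : all (ltn c) (h :: Y2).
  by move: hc; rewrite -(perm_all _ hp) !all_cat => /and3P[].
have {}hcY2 : all (ltn c) Y2 := hcY2.
have hcY : sorted ltn (c :: Y2) by rewrite /= (path_sortedE ltn_trans) hcY2 (path_sorted hY2).
apply: (knuth_at (u := [:: s]) (v := y :: Y1) (knuth_slide hY2 hch)).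
  by rewrite /= -!catA.
apply: (knuth_at (u := [:: s; h]) (v := Y1) (knuth_slide hcY hyc)).
  by rewrite /= -!catA.
apply: knuth_trans (knuth_acb3 _ (ltn_trans hsy hyc) hch) _.
by apply/knuth_cons/knuth_acb3.
Qed.

(* Letters [x <= u] are openers, letters [u < x < v] closers, all others are
   neutral: the largest surplus of closers over openers in a prefix. *)
Fixpoint surplus (u v : nat) (s : seq nat) : nat :=
  if s is x :: s' then
    if x <= u then (surplus u v s').-1
    else if x < v then (surplus u v s').+1 else surplus u v s'
  else 0.

(** * Matching small letters like brackets *)

Section Brackets.
Variables u v w : nat.
Hypotheses (huv : u < v) (hvw : v <= w).

Let closers (s : seq nat) := [seq x <- s | u < x < v].
Let good (s : seq nat) := all (fun x => (x < v) || (w < x)) s.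

Lemma surplus_big s t : all (ltn w) s -> surplus u v (s ++ t) = surplus u v t.
Proof.
elim: s => [//|x s IH] /= /andP[hx /IH ->].
have hvx := leq_ltn_trans hvw hx.
by rewrite leqNgt (ltn_trans huv hvx) ltnNge (ltnW hvx).
Qed.

Lemma closers_big s t : all (ltn w) s -> closers (s ++ t) = closers t.
Proof.
move=> hs; rewrite /closers filter_cat.
rewrite (eq_in_filter (a2 := pred0)) ?filter_pred0 // => x /(allP hs) /= hx.
by rewrite [x < v]ltnNge (ltnW (leq_ltn_trans hvw hx)) andbF.
Qed.

(** If an opener [x] comes first, the rest has surplus at least 2, so two closers can be extracted
    from it in turn. They satisfy [b' < b] because closers decrease, and [knuth_pass] brings [b] in
    front of [x] with [b'] as witness. *)
Lemma knuth_first_closer s : uniq s -> good s -> sorted gtn (closers s) ->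
    0 < surplus u v s ->
  exists s0 b s1, [/\ knuth s (s0 ++ b :: s1), all (ltn w) s0, u < b < v,
    surplus u v s <= (surplus u v s1).+1 & closers (b :: s1) = closers s].
Proof.
have [n] := ubnP (size s); elim: n s => // n IH [//|x s] hn hu hg.
have /andP[hxs hus] := hu; have /andP[hx hgs'] := hg.
have hgs : good s := hgs'.
rewrite [surplus _ _ _]/=; case: (leqP x u) => hxu.
  have Ec : closers (x :: s) = closers s by rewrite /closers /= ltnNge hxu.
  rewrite Ec => hc h1; have h2 : 1 < surplus u v s by case: (surplus u v s) h1 => [|[]].
  have [s0 [b [s1 [hk h0 hb hs1 hc1]]]] := IH s hn hus hgs hc (ltnW h2).
  have hperm := knuth_perm hk.
  have hu1 : uniq (s0 ++ b :: s1) by rewrite -(perm_uniq hperm).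
  have hus1 : uniq s1.
    by move: hu1; rewrite cat_uniq => /and3P[_ _ /andP[]].
  have hgs1 : good s1.
    by move: hgs; rewrite /good (perm_all _ hperm) all_cat => /and3P[].
  have hcs1 : sorted gtn (b :: closers s1).
    by move: hc; rewrite -hc1 /closers /= hb.
  have hn1 : size s1 < n.
    move: hn; rewrite /= ltnS (perm_size hperm) size_cat /= addnS.
    by apply: leq_trans; rewrite ltnS; apply: leqW; exact: leq_addl.
  have hp1 : 0 < surplus u v s1 by rewrite -ltnS; exact: leq_trans h2 hs1.
  have [t0 [b' [t1 [hk' h0' hb' ht1 hc2]]]] :=
    IH s1 hn1 hus1 hgs1 (path_sorted hcs1) hp1.
  have hbb : b' < b.
    by move: hcs1; rewrite -hc2 /closers /= hb' /= => /andP[].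
  have hu2 : uniq (s0 ++ t0).
    have : uniq (s0 ++ [:: b] ++ t0 ++ b' :: t1).
      rewrite (perm_uniq (s2 := s0 ++ b :: s1)) // perm_cat2l perm_cons perm_sym.
      exact: knuth_perm.
    apply: subseq_uniq; rewrite cat_subseq //.
    by apply: subseq_trans (suffix_subseq _ _); exact: prefix_subseq.
  have [X [Y [hXY hpass]]] := knuth_pass hu2.
  have hall c : c <= w -> all (ltn c) (s0 ++ t0).
    by move=> hcw; rewrite all_cat; apply/andP; split;
      [apply: sub_all h0|apply: sub_all h0'] => z /=; apply: leq_ltn_trans.
  have /andP[hX hY] : all (ltn w) X && all (ltn w) Y.
    by rewrite -all_cat (perm_all _ hXY) hall.
  have [/andP[hub hbv] /andP[hub' hbv']] := (hb, hb').
  exists X, b, [:: x, b' & Y ++ t1]; split=> //.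
  - apply: knuth_trans (knuth_cons x (knuth_trans hk (knuth_catl s0 (knuth_cons b hk')))) _.
    apply: (knuth_at (u := [::]) (v := t1)
      (hpass x b' b (leq_ltn_trans hxu hub') hbb (hall b (leq_trans (ltnW hbv) hvw)))).
      by rewrite /= -!catA /= -!catA.
    by rewrite -catA; exact: knuth_refl.
  - rewrite /= hxu [b' <= u]leqNgt hub' /= hbv' surplus_big //=.
    by move: hs1 ht1; case: (surplus u v s) => //= m; rewrite ltnS; exact: leq_trans.
  - rewrite -hc1 /closers /= hb hb' ltnNge hxu /=; congr cons.
    by rewrite -!/(closers _) closers_big // -hc2 /closers /= hb'.
case: (ltnP x v) => hxv.
  move=> _ _; exists [::], x, s; split=> //; try exact: knuth_refl; try by rewrite hxu.
have hxw : w < x by move: hx; case/orP=> // h; move: hxv; rewrite leqNgt h.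
have Ec : closers (x :: s) = closers s by apply: (@closers_big [:: x] s); rewrite /= hxw.
rewrite Ec => hc h1.
have [s0 [b [s1 [hk h0 hb hs1 hc1]]]] := IH s hn hus hgs hc h1.
by exists (x :: s0), b, s1; split=> //=; [exact: knuth_cons|rewrite hxw].
Qed.

(** Openers of [L] are carried across [c] from right to left; each one uses a closer extracted from
    the word behind [c] and costs at most one unit of surplus. *)
Lemma knuth_move_openers L W : uniq (L ++ W) -> good (L ++ W) -> closers L = [::] ->
    sorted gtn (closers W) -> count (leq^~ u) L <= surplus u v W ->
  exists N Y, [/\ perm_eq (N ++ Y) (L ++ W), all (ltn w) N, closers Y = closers W,
    surplus u v W <= surplus u v Y + count (leq^~ u) L &
    forall c, v <= c <= w -> knuth (L ++ c :: W) (N ++ c :: Y)].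
Proof.
elim: L => [|x L IH] hu hg hL hW hcnt.
  by exists [::], W; split=> // [|c _]; [rewrite addn0|exact: knuth_refl].
have /andP[hx hgs'] := hg; have /andP[hxs hus] := hu.
have hgs : good (L ++ W) := hgs'.
have hL' : closers L = [::] by move: hL; rewrite /closers /=; case: ifP.
have hcnt' : count (leq^~ u) L <= surplus u v W by apply: leq_trans hcnt; exact: leq_addl.
have [N [Y [hNY hN hcY hsY hk]]] := IH hus hgs hL' hW hcnt'.
have [hxw|hxw] := ltnP w x.
  exists (x :: N), Y; split=> [||||c hc] //=; rewrite ?perm_cons ?hxw //.
    by rewrite [x <= u]leqNgt (leq_trans huv) // (leq_trans hvw) // ltnW.
  exact/knuth_cons/hk.
have hxv : x < v by case/orP: hx => // h; move: hxw; rewrite leqNgt h.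
have hxu : x <= u.
  by rewrite leqNgt; apply/negP => h; move: hL; rewrite /closers /= h hxv.
rewrite /= hxu add1n in hcnt *.
have hp : 0 < surplus u v Y.
  rewrite lt0n; apply/eqP => h0; move: hsY; rewrite h0 add0n leqNgt => /negP; exact.
have huNY : uniq (N ++ Y) by rewrite (perm_uniq hNY).
have huY : uniq Y by move: huNY; rewrite cat_uniq => /and3P[].
have hgY : good Y by move: hgs; rewrite /good -(perm_all _ hNY) all_cat => /andP[].
have hscY : sorted gtn (closers Y) by rewrite hcY.
have [s0 [b [s1 [hkY h0 hb hs1 hc1]]]] := knuth_first_closer huY hgY hscY hp.
have hperm := knuth_perm hkY.
have hu2 : uniq (N ++ s0).
  have : uniq (N ++ s0 ++ b :: s1).
    by rewrite (perm_uniq (s2 := N ++ Y)) // perm_cat2l perm_sym.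
  by rewrite catA cat_uniq => /andP[].
have [X [Z [hXZ hpass]]] := knuth_pass hu2.
have hall c : c <= w -> all (ltn c) (N ++ s0).
  by move=> hcw; rewrite all_cat; apply/andP; split;
    [apply: sub_all hN|apply: sub_all h0] => z /=; apply: leq_ltn_trans.
have /andP[hX hZ] : all (ltn w) X && all (ltn w) Z.
  by rewrite -all_cat (perm_all _ hXZ) hall.
have /andP[hub hbv] := hb.
(* Behind [c], the opener [x] is directly followed by its closer [b]. The two cancel in the count,
   so the surplus is that of [s1]. *)
exists X, [:: x, b & Z ++ s1]; split=> //.
- apply/seq.permP => p; move/seq.permP/(_ p): hNY; move/seq.permP/(_ p): hXZ.
  move/seq.permP/(_ p): hperm; rewrite /= !count_cat /= !count_cat; clear; lia.
- rewrite -hcY -hc1 /closers /= hb ltnNge hxu /=; congr cons.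
  by rewrite -!/(closers _) closers_big.
- rewrite /= hxu [b <= u]leqNgt hub /= hbv surplus_big //=.
  apply: leq_trans hsY _; rewrite addnS -addSn leq_add2r //.
move=> c /andP[hvc hcw].
apply: knuth_trans (knuth_cons x (hk c _)) _; first by rewrite hvc.
apply: knuth_trans (knuth_cons x (knuth_catl N (knuth_cons c hkY))) _.
apply: (knuth_at (u := [::]) (v := s1)
  (hpass x b c (leq_ltn_trans hxu hub) (leq_trans hbv hvc) (hall c hcw))).
  by rewrite /= -!catA /= -!catA.
by rewrite -catA; exact: knuth_refl.
Qed.

(** The words [N] and [Y] are the same for [c := p] and [c := r]. Once the openers are gone, only
    letters above [w] separate the exchanged values, and [weak_exchange] applies. *)
Lemma weak_exchange_brackets p q r L W : v <= p -> p < q -> q < r -> r <= w ->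
    uniq (L ++ W) -> good (L ++ W) -> closers L = [::] ->
    sorted gtn (closers W) -> count (leq^~ u) L <= surplus u v W ->
  weak (q :: r :: L ++ p :: W) (q :: p :: L ++ r :: W).
Proof.
move=> hvp hpq hqr hrw hu hg hL hW hcnt.
have hpr := ltn_trans hpq hqr.
have [N [Y [hNY hN _ _ hk]]] := knuth_move_openers hu hg hL hW hcnt.
have hcp : v <= p <= w by rewrite hvp (leq_trans (ltnW hpr)).
have hcr : v <= r <= w by rewrite hrw (leq_trans hvp (ltnW hpr)).
apply: weak_trans (weak_knuth (knuth_catl [:: q; r] (hk _ hcp))) _.
apply: weak_trans _ (weak_knuth (knuth_sym (knuth_catl [:: q; p] (hk _ hcr)))).
have huN : uniq N.
  by move: hu; rewrite -(perm_uniq hNY) cat_uniq => /andP[].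
have hrN : all (ltn r) N by apply: sub_all hN => z /=; apply: leq_ltn_trans.
have := weak_ctx [::] Y (weak_exchange hpq hqr huN hrN).
by rewrite /= -!catA.
Qed.

End Brackets.

(** * Dual Knuth moves *)

Definition transp (x y z : nat) : nat :=
  if z == x then y else if z == y then x else z.

Definition triple (c : nat) (s : seq nat) : seq nat :=
  [seq x <- s | c <= x <= c.+2].

(* When [c.+1] is the first or the last of the letters [c], [c.+1], [c.+2] in
   [s], this reverses the subword of these three letters. *)
Definition dual (c : nat) (s : seq nat) : seq nat :=
  [seq transp (nth 0 (triple c s) 0) (nth 0 (triple c s) 2) x | x <- s].

Lemma dual_eq c s f m l : triple c s = [:: f; m; l] -> dual c s = map (transp f l) s.
Proof. by rewrite /dual => ->. Qed.

Definition has_triple (c : nat) (s : seq nat) : bool :=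
  perm_eq (triple c s) [:: c; c.+1; c.+2].

Lemma mem_triple c :
  (c <= c <= c.+2) * (c <= c.+1 <= c.+2) * (c <= c.+2 <= c.+2).
Proof. by split; [split|]; lia. Qed.

Lemma triple_neq c :
  ((c == c.+1) = false) * ((c == c.+2) = false) * ((c.+1 == c) = false) *
  ((c.+1 == c.+2) = false) * ((c.+2 == c) = false) * ((c.+2 == c.+1) = false).
Proof. by do 5 (split; last lia); lia. Qed.

Lemma triple_cat c s t : triple c (s ++ t) = triple c s ++ triple c t.
Proof. exact: filter_cat. Qed.

(** No value lies strictly between [f] and [l], so exchanging them affects only their own
    comparison. *)
Lemma transp_lt f l x y : (f == l.+1) || (l == f.+1) -> x < y ->
  ~~ ((x == f) && (y == l)) -> ~~ ((x == l) && (y == f)) ->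
  transp f l x < transp f l y.
Proof.
rewrite /transp => h1 h2 h3 h4; case: (boolP (x == f)) => ?; case: (boolP (y == f)) => ?;
  try case: (boolP (x == l)) => ?; try case: (boolP (y == l)) => ?; lia.
Qed.

Lemma map_transp_id c f l s : c <= f <= c.+2 -> c <= l <= c.+2 -> triple c s = [::] ->
  map (transp f l) s = s.
Proof.
move=> hf hl h; rewrite -[RHS]map_id; apply/eq_in_map => x hx; rewrite /transp.
have : ~~ (c <= x <= c.+2).
  by apply/negP => h'; have := in_nil x; rewrite -h mem_filter h' hx.
by case: (x =P f) => [->|_]; [rewrite hf|case: (x =P l) => [->|_]; rewrite ?hl].
Qed.

Definition middle_first (c : nat) (s : seq nat) : bool := nth 0 (triple c s) 0 == c.+1.
Definition middle_last (c : nat) (s : seq nat) : bool := nth 0 (triple c s) 2 == c.+1.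

Lemma triple_end c s : has_triple c s -> middle_first c s || middle_last c s ->
  let f := nth 0 (triple c s) 0 in let l := nth 0 (triple c s) 2 in
  [/\ (f == l.+1) || (l == f.+1), c <= f <= c.+2 & c <= l <= c.+2].
Proof.
rewrite /has_triple /middle_first /middle_last => hp.
have hs := perm_size hp; have hu := perm_uniq hp; have hm := perm_mem hp.
case: (triple c s) hs hu hm => [|f [|m [|l [|? ?]]]] // _ hu hm /=.
have := hm f; rewrite inE eqxx /= !inE => /esym hf.
have := hm l; rewrite !inE eqxx !orbT /= => /esym hl.
have hc : uniq [:: c; c.+1; c.+2] by clear; rewrite /= !inE; lia.
have hfl : f != l.
  by apply/eqP => E; move: hu; rewrite hc E /= !inE eqxx orbT.
move: hf hl hfl; clear => /or3P hf /or3P hl hfl h; move: hfl h.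
case: hf => /eqP->; case: hl => /eqP-> => h1 h2; split; lia.
Qed.

Lemma triple_adjacent (p q : seq nat) a b : size (p ++ [:: a; b] ++ q) = 3 ->
    uniq (p ++ [:: a; b] ++ q) ->
  let f := nth 0 (p ++ [:: a; b] ++ q) 0 in
  let l := nth 0 (p ++ [:: a; b] ++ q) 2 in
  ~~ ((a == f) && (b == l)) /\ ~~ ((a == l) && (b == f)).
Proof.
case: p => [|x [|? ?]]; case: q => [|y [|? ?]]; rewrite /= ?inE ?andbT //.
- rewrite negb_or => _ /andP[/andP[h1 h2] h3].
  by rewrite (negbTE h3) (negbTE h2) andbF.
- rewrite negb_or => _ /andP[/andP[h1 h2] h3].
  by rewrite ![_ == x]eq_sym (negbTE h1) (negbTE h2) andbF.
- by rewrite size_cat /= addn2.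
- by rewrite size_cat /= !addnS.
- by rewrite size_cat /= !addnS.
Qed.

(** If [x], [y], [z] are the triple itself, the dual move turns a Knuth move of one kind into one of
    the other kind. Otherwise the triple is read in the same order in both words, so one
    transposition acts on both and keeps the order of [x], [y], [z]. *)
Lemma dual_knuth_step c u v m m' x y z : x < y < z ->
    (m, m') = ([:: y; x; z], [:: y; z; x]) \/
    (m, m') = ([:: x; z; y], [:: z; x; y]) ->
    uniq (u ++ m ++ v) -> has_triple c (u ++ m ++ v) ->
  [/\ middle_first c (u ++ m ++ v) = middle_first c (u ++ m' ++ v),
      middle_last c (u ++ m ++ v) = middle_last c (u ++ m' ++ v) &
      middle_first c (u ++ m ++ v) || middle_last c (u ++ m ++ v) ->
      knuth (dual c (u ++ m ++ v)) (dual c (u ++ m' ++ v))].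
Proof.
move=> hxyz hm hu ht; have /andP[hxy hyz] := hxyz.
have hs := perm_size ht; rewrite !triple_cat in hs.
case hC : ((c <= x) && (z <= c.+2)).
  have [Ex Ey Ez] : [/\ x = c, y = c.+1 & z = c.+2].
    by case/andP: hC; clear -hxy hyz => *; split; lia.
  subst x y z; clear hC hxyz hxy hyz.
  have E3 : size (triple c m) = 3.
    by case: hm => -[-> _]; rewrite /triple /= !leqnn !leqnSn ltnW // !leqnSn !ltnSn.
  rewrite !size_cat E3 [RHS]/= in hs.
  have hu0 : triple c u = [::] by apply/eqP; rewrite -size_eq0; clear -hs; lia.
  have hv0 : triple c v = [::] by apply/eqP; rewrite -size_eq0; clear -hs; lia.
  have [[h0 h1] h2] := mem_triple c.
  have Em : triple c m = m by case: hm => -[-> _]; rewrite /triple /= !mem_triple.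
  have Em' : triple c m' = m' by case: hm => -[_ ->]; rewrite /triple /= !mem_triple.
  have Eu f l : c <= f <= c.+2 -> c <= l <= c.+2 -> map (transp f l) u = u.
    by move=> *; apply: (@map_transp_id c).
  have Ev f l : c <= f <= c.+2 -> c <= l <= c.+2 -> map (transp f l) v = v.
    by move=> *; apply: (@map_transp_id c).
  have Ts : triple c (u ++ m ++ v) = m by rewrite !triple_cat hu0 hv0 Em cats0.
  have Ts' : triple c (u ++ m' ++ v) = m' by rewrite !triple_cat hu0 hv0 Em' cats0.
  rewrite /middle_first /middle_last Ts Ts'.
  case: hm => -[Em0 Em0']; subst m m'; rewrite (dual_eq Ts) (dual_eq Ts');
    (split; [by rewrite /= ?triple_neq|by rewrite /= ?triple_neq|move=> _]);
    rewrite !map_cat !Eu // !Ev //; apply: knuth_ctx;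
    cbn [map].
  - rewrite /transp !(eqxx, triple_neq).
    by apply: knuth_sym; apply: knuth_acb3.
  - rewrite /transp !(eqxx, triple_neq).
    by apply: knuth_sym; apply: knuth_bac3.
have E : triple c m = triple c m'.
  have : ~~ ((c <= x <= c.+2) && (c <= z <= c.+2)).
    by move/negbT: hC; clear -hxy hyz; lia.
  case: hm => -[-> ->]; rewrite /triple /=; case: (c <= x <= _); case: (c <= z <= _) => //.
have Et : triple c (u ++ m ++ v) = triple c (u ++ m' ++ v) by rewrite !triple_cat E.
rewrite /middle_first /middle_last /dual -Et; split=> //.
rewrite -/(middle_first c _) -/(middle_last c _) => /(triple_end ht) [hfl hf hl].
set f := nth 0 _ 0 in hfl hf hl *; set l := nth 0 _ 2 in hfl hf hl *.
(* Letters of the triple that are neighbours in its subword cannot be its two ends, and only the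
   ends are exchanged. *)
have hadj a b : a < b -> (c <= a <= c.+2 -> c <= b <= c.+2 ->
    triple c m = [:: a; b] \/ triple c m = [:: b; a]) -> transp f l a < transp f l b.
  move=> hab hE; have huT : uniq (triple c (u ++ m ++ v)) by exact: filter_uniq.
  have hsT : size (triple c (u ++ m ++ v)) = 3 by rewrite !triple_cat.
  suff h : c <= a <= c.+2 -> c <= b <= c.+2 ->
      ~~ ((a == f) && (b == l)) /\ ~~ ((a == l) && (b == f)).
    apply: transp_lt => //; apply/negP => /andP[/eqP Ea /eqP Eb].
      by have := h; rewrite Ea Eb !eqxx => /(_ hf hl) [].
    by have := h; rewrite Ea Eb !eqxx => /(_ hl hf) [].
  move=> ha hb; move: (hE ha hb) huT hsT; rewrite /f /l !triple_cat => -[]-> huT hsT.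
    exact: triple_adjacent.
  have [h1 h2] := triple_adjacent hsT huT.
  by split; [move: h2|move: h1]; rewrite andbC.
have hpi : transp f l x < transp f l y < transp f l z.
  have hnot : ~~ ((c <= x <= c.+2) && (c <= z <= c.+2)).
    by move/negbT: hC; clear -hxy hyz; lia.
  apply/andP; split; apply: hadj => // ha hb.
    have hz : (c <= z <= c.+2) = false by apply/negbTE; move: hnot; rewrite ha.
    by case: hm => -[-> _]; rewrite /triple [filter _ _]/= ?ha ?hb ?hz; [right|left].
  have hx : (c <= x <= c.+2) = false by apply/negbTE; move: hnot; rewrite hb andbT.
  by case: hm => -[-> _]; rewrite /triple [filter _ _]/= ?ha ?hb ?hx; [left|right].
rewrite !map_cat; case: hm => -[-> ->]; [exact: knuth_bac | exact: knuth_acb].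
Qed.

Lemma has_triple_perm c s t : perm_eq s t -> has_triple c s = has_triple c t.
Proof. by move=> h; apply: (seq.permPl (perm_filter _ h)). Qed.

Lemma dual_knuth c s t : knuth s t -> uniq s -> has_triple c s ->
  [/\ middle_first c s = middle_first c t, middle_last c s = middle_last c t &
      middle_first c s || middle_last c s -> knuth (dual c s) (dual c t)].
Proof.
elim=> {s t} [s|s t h IH|s t w h IH1 _ IH2|u v x y z h|u v x y z h] hu ht.
- by split=> // _; exact: knuth_refl.
- rewrite -(knuth_uniq h) in hu; rewrite -(has_triple_perm c (knuth_perm h)) in ht.
  have [e1 e2 hk] := IH hu ht; rewrite -e1 -e2; split=> // /hk; exact: knuth_sym.
- have [e1 e2 hk1] := IH1 hu ht.
  rewrite (knuth_uniq h) in hu; rewrite (has_triple_perm c (knuth_perm h)) in ht.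
  have [e3 e4 hk2] := IH2 hu ht; rewrite e1 e2 -e3 -e4; split=> // hml.
  by apply: knuth_trans (hk1 _) (hk2 hml); rewrite e1 e2.
- by apply: (dual_knuth_step h) => //; left.
- by apply: (dual_knuth_step h) => //; right.
Qed.

Lemma triple_split c u x : triple c u = [:: x] ->
  exists u1 u2, [/\ u = u1 ++ x :: u2, triple c u1 = [::] & triple c u2 = [::]].
Proof.
elim: u => [//|y u IH]; rewrite /triple /=; case: ifP => hy.
  by case=> -> h; exists [::], u.
move=> /IH[u1 [u2 [-> h1 h2]]]; exists (y :: u1), u2; split=> //.
by rewrite /triple /= hy.
Qed.

Lemma notin_triple c s x : triple c s = [::] -> x \in s -> (x < c) || (c.+2 < x).
Proof.
move=> h hx; have : ~~ (c <= x <= c.+2).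
  by apply/negP => h'; have := in_nil x; rewrite -h mem_filter h' hx.
by rewrite negb_and -!ltnNge.
Qed.

(** If [a] and [b] do not both lie in the triple, the same transposition acts on both words and
    keeps [a] below [b]. If they do, neither is [c.+1], since the swap would move [c.+1] away from
    its end of the subword. *)
Lemma dual_swap c u v a b : a < b -> uniq (u ++ [:: a; b] ++ v) ->
    let s := u ++ [:: a; b] ++ v in let t := u ++ [:: b; a] ++ v in
    has_triple c s -> middle_first c s = middle_first c t ->
    middle_last c s = middle_last c t -> middle_first c s || middle_last c s ->
  weak (dual c s) (dual c t) \/
  [/\ a = c, b = c.+2 &
    if middle_first c s then triple c u = [:: c.+1] /\ triple c v = [::]
    else triple c u = [::] /\ triple c v = [:: c.+1]].
Proof.
move=> hab hu s t ht ef el hml.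
have hut : uniq (triple c s) by exact: filter_uniq.
have hst : size (triple c s) = 3 := perm_size ht.
have [hfl hf hl] := triple_end ht hml.
case hC : ((c <= a <= c.+2) && (c <= b <= c.+2)); last first.
  left; have E : triple c t = triple c s.
    rewrite /s /t !triple_cat; congr (_ ++ (_ ++ _)); rewrite /triple /=.
    by move: hC; case: (c <= a <= _); case: (c <= b <= _).
  rewrite /dual E; set f := nth 0 _ 0 in hfl hf hl *; set l := nth 0 _ 2 in hfl hf hl *.
  rewrite /s /t !map_cat; apply: weak_swap; apply: transp_lt => //.
    by apply/negP => /andP[/eqP Ea /eqP Eb]; rewrite Ea Eb hf hl in hC.
  by apply/negP => /andP[/eqP Ea /eqP Eb]; rewrite Ea Eb hf hl in hC.
right; have Eab x y : (x, y) = (a, b) \/ (x, y) = (b, a) -> triple c [:: x; y] = [:: x; y].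
  by case/andP: hC => ha hb [] [-> ->]; rewrite /triple /= ha hb.
have Es : triple c s = triple c u ++ [:: a; b] ++ triple c v.
  by rewrite /s !triple_cat Eab //; left.
have Et : triple c t = triple c u ++ [:: b; a] ++ triple c v.
  by rewrite /t !triple_cat Eab //; right.
have hm := perm_mem ht.
rewrite /middle_first /middle_last Es Et in ef el hml hut hst hm *.
have hne : a == b = false by apply/negbTE; rewrite neq_ltn hab.
have fin : (a == c.+1) = false -> (b == c.+1) = false -> a = c /\ b = c.+2.
  case/andP: hC => ha hb; clear -hab ha hb => h1 h2.
  move/negbT: h1 => h1; move/negbT: h2 => h2; split; lia.
have two (d : bool) : (a == c.+1) = (b == c.+1) -> d || (b == c.+1) ->
    [/\ d, a = c & b = c.+2].
  case: (b =P c.+1) => [Eb /eqP Ea|/eqP/negbTE hb ha]; last first.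
    by rewrite orbF; have [-> ->] := fin ha hb.
  by rewrite Ea Eb eqxx in hne.
case: (triple c u) hst ef el hml => [|x [|? ?]]; case: (triple c v) => [|y [|? ?]] //=.
- move=> _ ef _ hml; have [|hy -> ->] := two (y == c.+1) ef.
    by rewrite orbC -ef.
  by rewrite triple_neq (eqP hy).
- move=> _ _ el hml; have [//|hx -> ->] := two (x == c.+1) (esym el).
  by rewrite hx (eqP hx).
all: by rewrite ?size_cat /= ?addnS.
Qed.

(** Both sides of every Knuth move contain an increasing pair, so no move applies to a decreasing
    word. *)
Lemma knuth_decreasing s t : knuth s t -> sorted gtn s -> s = t.
Proof.
suff h : knuth s t -> sorted gtn s || sorted gtn t -> s = t.
  by move=> /h + hs; rewrite hs; apply.
elim=> {s t} [s|s t _ IH|s t w _ IH1 _ IH2|u v x y z|u v x y z] //.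
- by rewrite orbC => /IH.
- case/orP=> h.
    have E : s = t by apply: IH1; rewrite h.
    by rewrite E; apply: IH2; rewrite -E h.
  have E : t = w by apply: IH2; rewrite h orbT.
  by rewrite -E; apply: IH1; rewrite E h orbT.
- move=> /andP[hxy hyz]; case/orP=> /cat_sorted2[_ /cat_sorted2[+ _]] /=.
    by move=> /and3P[_ h _]; have := ltn_trans h (ltn_trans hxy hyz); rewrite ltnn.
  by move=> /andP[h _]; have := ltn_trans h hyz; rewrite ltnn.
- move=> /andP[hxy hyz]; case/orP=> /cat_sorted2[_ /cat_sorted2[+ _]] /=.
    by move=> /andP[h _]; have := ltn_trans h (ltn_trans hxy hyz); rewrite ltnn.
  by move=> /and3P[_ h _]; have := ltn_trans h hxy; rewrite ltnn.
Qed.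

(** * Words with a prescribed inner class, and monotonicity of dual moves *)

Definition in_class (n k : nat) (u s : seq nat) : Prop :=
  perm_eq s (iota 1 n) /\ knuth [seq x <- s | x <= k] u.

Lemma in_class_uniq n k u s : in_class n k u s -> uniq s.
Proof. by case=> /perm_uniq-> _; exact: iota_uniq. Qed.

Lemma in_class_filter n k u s (p : pred nat) :
    (forall x, p x -> x <= k) -> (forall x y z, x < y < z -> p x -> p z -> p y) ->
  in_class n k u s -> knuth (filter p s) (filter p u).
Proof.
move=> hpk cvx [_ /(knuth_filter cvx)]; rewrite -filter_predI.
by rewrite (eq_filter (a2 := p)) // => x /=; apply: andb_idr; exact: hpk.
Qed.

Lemma in_class_inc3 n k u s x y z : in_class n k u s -> ~ has_inc 3 u ->
  subseq [:: x; y; z] s -> x < y -> y < z -> z <= k -> False.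
Proof.
case=> _ hk h3 hs hxy hyz hz; apply/h3/(has_inc_knuth _ hk); exists [:: x; y; z].
rewrite /= hxy hyz subseq_filter hs /= hz (leq_trans (ltnW hyz)) //.
by rewrite (leq_trans (ltnW (ltn_trans hxy hyz))).
Qed.

Lemma in_class_between n k u s x t : uniq u -> all (fun r => size r <= 2) (tabl u) ->
  in_class n k u s -> in_class n k u t -> weak s x -> weak x t -> in_class n k u x.
Proof.
move=> hu h2 hs ht hsx hxt; have us := in_class_uniq hs.
case: hs ht => ps ks [pt kt].
have ux : uniq x by rewrite -(perm_uniq (weak_perm hsx)).
split; first by rewrite (perm_trans _ ps) // perm_sym weak_perm.
have uf y : uniq y -> uniq [seq z <- y | z <= k] by exact: filter_uniq.
have Es : tabl [seq z <- s | z <= k] = tabl u by apply: knuth_tabl; rewrite ?uf.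
have Et : tabl [seq z <- t | z <= k] = tabl u.
  by apply: knuth_tabl kt _; rewrite uf // (perm_uniq pt) iota_uniq.
have Ex : tabl [seq z <- x | z <= k] = tabl u.
  rewrite -Es; apply: (@weak_between _ _ [seq z <- t | z <= k]); rewrite ?uf ?Es ?Et //.
    exact: weak_filter (@leq_convex k) hsx.
  exact: weak_filter (@leq_convex k) hxt.
apply: knuth_trans (knuth_reading (uf _ ux)) _.
by rewrite Ex; apply: knuth_sym; exact: knuth_reading.
Qed.

Lemma in_class_triple n k u s c : in_class n k u s -> c.+2 <= k ->
    has_triple c u ->
  [/\ has_triple c s, middle_first c s = middle_first c u &
      middle_last c s = middle_last c u].
Proof.
move=> hs hck hu; have us := in_class_uniq hs; case: hs => _ hk.
have E : triple c [seq x <- s | x <= k] = triple c s.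
  rewrite /triple -filter_predI; apply: eq_filter => x /=.
  by apply: andb_idr => /andP[_ hx]; exact: leq_trans hx hck.
have hts : has_triple c [seq x <- s | x <= k] by rewrite (has_triple_perm c (knuth_perm hk)).
have [] := dual_knuth hk (filter_uniq _ us) hts.
by rewrite /middle_first /middle_last E => e1 e2 _; split=> //; rewrite /has_triple -E.
Qed.

(** The last hypothesis isolates the one ascent swap that [dual_swap] leaves open; the chain can be
    treated step by step because it stays in the class. *)
Lemma dual_weak n k u c : uniq u -> all (fun r => size r <= 2) (tabl u) ->
    c.+2 <= k -> has_triple c u -> middle_first c u || middle_last c u ->
    (forall v w, in_class n k u (v ++ [:: c; c.+2] ++ w) ->
      (if middle_first c u then triple c v = [:: c.+1] /\ triple c w = [::]
       else triple c v = [::] /\ triple c w = [:: c.+1]) ->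
      weak (dual c (v ++ [:: c; c.+2] ++ w)) (dual c (v ++ [:: c.+2; c] ++ w))) ->
  forall s t, in_class n k u s -> in_class n k u t -> weak s t ->
  weak (dual c s) (dual c t).
Proof.
move=> hu h2 hck htu hm rule s t hs ht hst.
elim: hst hs ht => {s t} [s t hk|v w a b hab|s x t hsx IH1 hxt IH2] hs ht.
- have [h1 h3 h4] := in_class_triple hs hck htu.
  have [_ _ h] := dual_knuth hk (in_class_uniq hs) h1.
  by apply/weak_knuth/h; rewrite h3 h4.
- have [h1 h3 h4] := in_class_triple hs hck htu.
  have [_ h5 h6] := in_class_triple ht hck htu.
  have := dual_swap hab (in_class_uniq hs) h1.
  rewrite h3 h4 h5 h6 => /(_ erefl erefl hm) [//|[Ea Eb]].
  by subst a b => h; apply: rule.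
- have hx := in_class_between hu h2 hs ht hsx hxt.
  exact: weak_trans (IH1 hs hx) (IH2 hx ht).
Qed.

Lemma dual_weak_first n k u c : uniq u -> all (fun r => size r <= 2) (tabl u) ->
    ~ has_inc 3 u -> c.+2 <= k -> has_triple c u -> middle_first c u ->
  forall s t, in_class n k u s -> in_class n k u t -> weak s t ->
  weak (dual c s) (dual c t).
Proof.
move=> hu h2 h3 hck htu hm; apply: dual_weak => //; first by rewrite hm.
move=> v w hs; rewrite hm => -[/triple_split[v1 [L [E hv1 hL]]] hw].
have [[h0 h1] h2'] := mem_triple c.
have Ev1 := map_transp_id _ _ hv1; have EL := map_transp_id _ _ hL.
have Ew := map_transp_id _ _ hw.
have Ts : triple c (v ++ [:: c; c.+2] ++ w) = [:: c.+1; c; c.+2].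
  rewrite E -[c.+1 :: L]cat1s !triple_cat hv1 hL hw cats0.
  by rewrite /triple /= !mem_triple.
have Tt : triple c (v ++ [:: c.+2; c] ++ w) = [:: c.+1; c.+2; c].
  rewrite E -[c.+1 :: L]cat1s !triple_cat hv1 hL hw cats0.
  by rewrite /triple /= !mem_triple.
rewrite (dual_eq Ts) (dual_eq Tt) E !map_cat /= !Ev1 // !EL // !Ew //.
rewrite /transp !(eqxx, triple_neq).
have us := in_class_uniq hs; rewrite E in hs us.
have uL : uniq L.
  by move: us; rewrite cat_uniq => /andP[+ _]; rewrite cat_uniq => /and3P[_ _ /andP[]].
have hcL : all (ltn c.+2) L.
  apply/allP => x hx; case/orP: (notin_triple hL hx) => // hxc.
  exfalso; apply: (in_class_inc3 hs h3 (x := x) (y := c) (z := c.+2)) => //.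
  rewrite -catA; apply: subseq_trans (suffix_subseq _ _).
  apply: (@cat_subseq _ [:: x] [:: c; c.+2]); last exact: prefix_subseq.
  by rewrite sub1seq inE hx orbT.
have := weak_ctx v1 w (weak_rotate_max (ltnSn c) (ltnSn c.+1) uL hcL).
by rewrite /= -!catA.
Qed.

Lemma sorted_gtn_split a t : sorted gtn t ->
  t = [seq x <- t | a < x] ++ [seq x <- t | x <= a].
Proof.
elim: t => [//|x t IH] hs /=.
have gt_trans : transitive gtn by move=> ? ? ? /= h1 h2; exact: ltn_trans h2 h1.
case: (ltnP a x) => h; first by rewrite /= -IH // (path_sorted hs).
have ht y : y \in t -> y <= a.
  move/(allP (order_path_min gt_trans hs)) => /= hy.
  exact: leq_trans (ltnW hy) h.
rewrite (eq_in_filter (a2 := pred0)) ?filter_pred0; last first.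
  by move=> y /ht /=; rewrite leqNgt => /negbTE.
by rewrite (eq_in_filter (a2 := predT)) ?filter_predT // => y /ht ->.
Qed.

Lemma surplus_prefix a c s t :
  size [seq x <- s | a < x < c] <= surplus a c (s ++ t) + count (leq^~ a) s.
Proof.
elim: s => [//|x s IH] /=; case: (leqP x a) => hx /=.
  by apply: leq_trans IH _; case: (surplus _ _ _) => [|m] /=; rewrite ?add0n ?leq_addl // addnA addn1.
by case: (x < c); rewrite //= addSn.
Qed.

(** * The exceptional swap when the middle value is read last *)

Section Exchange.
Variables (n k a c : nat) (u : seq nat).
Hypotheses (hac : a < c) (hck : c.+2 <= k).
Hypothesis h3 : ~ has_inc 3 u.
Hypothesis hA : [seq x <- u | x <= a] = rev (iota 1 a).
Hypothesis hB : sorted gtn [seq x <- u | a < x < c].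
Hypothesis hdec : forall l, has_inc l (rev [seq x <- u | x < c]) -> l <= a.
Hypothesis hdec2 : has_inc a.+2 (rev [seq x <- u | x <= c.+2]).

Variables v L W : seq nat.
Let s := v ++ [:: c; c.+2] ++ L ++ c.+1 :: W.
Hypothesis hs : in_class n k u s.
Hypotheses (hv : triple c v = [::]) (hL : triple c L = [::]) (hW : triple c W = [::]).

(** Such a letter would be smaller than [c] and form an increasing subword with [c] and [c.+2]. *)
Lemma exchange_front x : x \in v -> x <= c.+2 -> False.
Proof.
move=> hx hxc; case/orP: (notin_triple hv hx) => h; last by move: hxc; rewrite leqNgt h.
apply: (in_class_inc3 hs h3 (x := x) (y := c) (z := c.+2)) => //.
apply: (@cat_subseq _ [:: x] [:: c; c.+2]); last exact: prefix_subseq.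
by rewrite sub1seq.
Qed.

(** A decreasing word is alone in its Knuth class, so the openers stand in the same order in every
    word of the class. *)
Lemma exchange_openers : [seq x <- s | x <= a] = rev (iota 1 a).
Proof.
rewrite -hA; apply/esym/knuth_decreasing; last by rewrite hA rev_sorted iota_ltn_sorted.
apply/knuth_sym/(in_class_filter _ _ hs) => x /=.
  by move/leq_ltn_trans/(_ hac)/ltnW => h; rewrite (leq_trans h) // (leq_trans _ hck) // ltnW.
by move=> y z /andP[_ /ltnW h] _; exact: leq_trans.
Qed.

Lemma exchange_small l : has_inc l (rev [seq x <- s | x < c]) -> l <= a.
Proof.
have hk : knuth [seq x <- s | x < c] [seq x <- u | x < c].
  apply: (in_class_filter _ _ hs) => x /=.
    by move/ltnW=> h; rewrite (leq_trans h) // (leq_trans _ hck) // ltnW.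
  by move=> y z /andP[_ h] _; exact: ltn_trans.
by move=> h; apply: hdec; apply/(has_inc_knuth _ (knuth_rev hk)).
Qed.

(** An opener [x] before a closer [b] of [L] would give the increasing subword [x], [b], [c.+1].
    Hence all [a] openers follow [b] and form with it a decreasing subword of length [a.+1] on
    letters below [c], against [exchange_small]. *)
Lemma exchange_closers : [seq x <- L | a < x < c] = [::].
Proof.
apply/eqP; rewrite -[_ == _]negbK -has_filter; apply/hasP => -[b hb /andP[hab hbc]].
have [L1 [L2 EL]] : exists L1 L2, L = L1 ++ b :: L2.
  by case/splitPr: hb => L1 L2; exists L1, L2.
have front x : x <= a -> x \in v ++ [:: c; c.+2] ++ L1 -> False.
  move=> hxa; rewrite mem_cat => /orP[hx|].
    apply: exchange_front hx _; apply: leq_trans hxa _.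
    by apply: leq_trans (ltnW hac) _; clear; lia.
  rewrite !inE => /or3P[/eqP Ex|/eqP Ex|hx].
  - by move: hac; rewrite -Ex ltnNge hxa.
  - by have := leq_ltn_trans hxa hac; rewrite Ex; clear; lia.
  apply: (in_class_inc3 hs h3 (x := x) (y := b) (z := c.+1)).
  - rewrite /s EL; apply: subseq_trans (suffix_subseq v _).
    apply: subseq_trans (suffix_subseq _ _); rewrite -catA.
    apply: (@cat_subseq _ [:: x] [:: b; c.+1]); first by rewrite sub1seq.
    by apply: (@cat_subseq _ [:: b] [:: c.+1] (b :: L2) (c.+1 :: W));
      rewrite sub1seq mem_head.
  - exact: leq_ltn_trans hxa hab.
  - by rewrite ltnS ltnW.
  - exact: ltnW.
have hO := exchange_openers.
have Es : s = (v ++ [:: c; c.+2] ++ L1) ++ b :: L2 ++ c.+1 :: W.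
  by rewrite /s EL -!catA.
have Eo : [seq x <- s | x <= a] = [seq x <- L2 ++ c.+1 :: W | x <= a].
  rewrite Es filter_cat (eq_in_filter (a2 := pred0)) ?filter_pred0.
    by rewrite /= leqNgt hab.
  by move=> x hx; apply/negP => /front; apply.
suff : a.+1 <= a by rewrite ltnn.
apply: exchange_small; exists (rcons (iota 1 a) b); split.
- rewrite -(revK (rcons _ _)) subseq_rev rev_rcons -hO Eo Es filter_cat /= hbc.
  apply: subseq_trans (suffix_subseq _ _).
  rewrite /= eqxx; have -> : [seq x <- L2 ++ c.+1 :: W | x <= a] =
      [seq x <- [seq x <- L2 ++ c.+1 :: W | x < c] | x <= a].
    rewrite -filter_predI; apply: eq_filter => x /=.
    by rewrite andb_idr // => /leq_ltn_trans; apply.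
  exact: filter_subseq.
- have : sorted ltn (iota 1 a ++ [:: b]).
    apply: sorted_cat_lt; rewrite ?iota_ltn_sorted //.
    by apply/allP => x; rewrite mem_iota add1n ltnS => /andP[_ /leq_ltn_trans]; apply.
  by rewrite cats1.
by rewrite size_rcons size_iota.
Qed.

(** A decreasing subword of length [a.+2] on letters at most [c.+2] must pass through [c.+1] and
    leave at least [a] letters in [W], closers before openers. Since there are only [a] openers in
    all, the closers in the corresponding prefix of [W] outnumber its openers by at least the number
    of openers in [L]. *)
Lemma exchange_surplus : count (leq^~ a) L <= surplus a c W.
Proof.
have hO := exchange_openers.
have gt_trans : transitive gtn by move=> ? ? ? /= h1 h2; exact: ltn_trans h2 h1.
have hvA : [seq x <- v | x <= a] = [::].
  apply/eqP; rewrite -[_ == _]negbK -has_filter; apply/hasPn => x hx.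
  apply/negP => hxa; apply: exchange_front hx _; apply: leq_trans hxa _.
  by apply: leq_trans (ltnW hac) _; clear; lia.
have cnt : count (leq^~ a) L + count (leq^~ a) W = a.
  have := congr1 size hO; rewrite size_rev size_iota /s !filter_cat hvA /=.
  have /negbTE-> : ~~ (c <= a) by rewrite -ltnNge.
  have /negbTE-> : ~~ (c.+2 <= a) by move: hac; clear; lia.
  have /negbTE-> : ~~ (c.+1 <= a) by move: hac; clear; lia.
  by rewrite /= size_cat !size_filter.
have hvC : [seq x <- v | x <= c.+2] = [::].
  apply/eqP; rewrite -[_ == _]negbK -has_filter; apply/hasPn => x hx.
  by apply/negP => /(exchange_front hx).
have hk : knuth [seq x <- s | x <= c.+2] [seq x <- u | x <= c.+2].
  apply: (in_class_filter _ _ hs) => x /=; first by move/leq_trans; apply.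
  by move=> y z /andP[_ /ltnW h] _; exact: leq_trans.
have /(has_inc_knuth _ (knuth_rev hk)) [t0 [ht0 ht0s ht0z]] := hdec2.
have {ht0} := ht0; rewrite -subseq_rev revK.
rewrite -size_rev in ht0z; rewrite -[t0]revK rev_sorted in ht0s.
move: (rev t0) ht0s ht0z => t hts htz {t0}.
rewrite /s filter_cat hvC cat0s filter_cat.
have -> : [seq x <- [:: c; c.+2] | x <= c.+2] = [:: c; c.+2].
  have h : c <= c.+2 by clear; lia.
  by rewrite /= h leqnn.
case/subseq_catP => t1 [t2 [Et ht1 ht2]].
rewrite {}Et in hts htz; have [hts1 hts2] := cat_sorted2 hts.
have h1 : size t1 <= 1.
  have : sorted ltn [:: c; c.+2] by rewrite /= andbT; clear; lia.
  move/(subseq_sorted ltn_trans ht1).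
  case: t1 hts1 {ht1 hts htz} => [|x [|y t1]] //= /andP[hxy _] /andP[hyx _].
  by have := ltn_trans hxy hyx; rewrite ltnn.
have small t' Z : triple c Z = [::] -> subseq t' [seq x <- Z | x <= c.+2] ->
    all (ltn^~ c) t' /\ subseq t' [seq x <- Z | x < c].
  move=> hZ h; have h' : subseq t' Z by apply: subseq_trans h (filter_subseq _ _).
  suff ht' : all (ltn^~ c) t' by rewrite subseq_filter ht' h'.
  apply/allP => x /(mem_subseq h); rewrite mem_filter => /andP[hxc hx].
  by case/orP: (notin_triple hZ hx) => //; rewrite ltnNge hxc.
(* At most one letter comes from the ascent [c], [c.+2]; more than [a] remain, too many to be all
   below [c], so [c.+1] is among them. *)
have big : a < size t2.
  by rewrite -(ltn_add2l (size t1)) -size_cat htz ltnS -[a.+1]add1n leq_add2r.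
rewrite filter_cat in ht2.
have [t3 [t4 [Et2 ht3 ht4]]] := subseq_catP ht2.
have [h3s h3sub] := small _ _ hL ht3.
have [t5 Et4 ht5] : exists2 t5, t4 = c.+1 :: t5 & subseq t5 [seq x <- W | x <= c.+2].
  move: ht4; rewrite /= (ltnW (ltnSn c.+1)).
  case: t4 Et2 => [|y t4] Et2.
    move=> _; exfalso; move: big; rewrite ltnNge => /negP; apply; apply: exchange_small.
    exists (rev t2); rewrite size_rev rev_sorted subseq_rev; split=> //.
    rewrite Et2 cats0 /s !filter_cat.
    apply: subseq_trans (suffix_subseq _ _); apply: subseq_trans (suffix_subseq _ _).
    exact: subseq_trans h3sub (prefix_subseq _ _).
  rewrite /=; case: eqP => [->|_] h5; first by exists t4.
  exfalso; move: big; rewrite ltnNge => /negP; apply; apply: exchange_small.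
  have [_ h5sub] := small _ _ hW h5.
  exists (rev t2); rewrite size_rev rev_sorted subseq_rev; split=> //.
  rewrite Et2 /s !filter_cat.
  apply: subseq_trans (suffix_subseq _ _); apply: subseq_trans (suffix_subseq _ _).
  apply: cat_subseq => //; rewrite /= ltnNge leqnSn /=; exact: h5sub.
have [h5s h5sub] := small _ _ hW ht5.
(* Letters taken from [L] are below [c] and cannot precede [c.+1] in a decreasing word. *)
have Et3 : t3 = [::].
  move: hts2; rewrite Et2 Et4; case: t3 h3s {Et2 ht3 h3sub} => [//|x t3] /andP[/= hx _].
  move/(order_path_min gt_trans) => /allP/(_ c.+1); rewrite mem_cat mem_head orbT => /(_ isT) /= h.
  by have := ltn_trans h hx; rewrite ltnNge leqnSn.
rewrite Et3 Et4 cat0s in Et2; rewrite Et2 in big hts2.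
have hts5 := path_sorted hts2.
have ht5W : subseq t5 W by apply: subseq_trans h5sub (filter_subseq _ _).
rewrite (sorted_gtn_split a hts5) in ht5W.
(* [t5] is decreasing, so its closers precede its openers in [W]. *)
have [W1 [W2 [EW hW1 hW2]]] : exists W1 W2, [/\ W = W1 ++ W2,
    subseq [seq x <- t5 | a < x] W1 & subseq [seq x <- t5 | x <= a] W2].
  move: [seq x <- t5 | x <= a] ht5W => q; move: [seq x <- t5 | a < x] => p.
  clear; elim: W p => [|y W' IH] p.
    by rewrite subseq0 => /eqP/(congr1 size)/eqP; rewrite size_cat addn_eq0 !size_eq0 =>
      /andP[/eqP-> /eqP->]; exists [::], [::].
  case: p => [|x p]; first by exists [::], (y :: W').
  rewrite /=; case: eqP => [->|hne] h.
    have [W1 [W2 [-> h1 h2]]] := IH p h.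
    by exists (y :: W1), W2; split=> //=; rewrite eqxx.
  have [W1 [W2 [-> h1 h2]]] := IH (x :: p) h.
  by exists (y :: W1), W2; split=> //; apply: subseq_trans h1 (subseq_cons _ _).
have hB1 : size [seq x <- t5 | a < x] <= size [seq x <- W1 | a < x < c].
  apply: size_subseq; rewrite subseq_filter hW1 andbT.
  apply/allP => x; rewrite mem_filter => /andP[-> hx] /=.
  exact: (allP h5s).
have hA2 : size [seq x <- t5 | x <= a] <= count (leq^~ a) W2.
  rewrite -size_filter; apply: size_subseq; rewrite subseq_filter hW2 andbT.
  exact: filter_all.
have hsp := surplus_prefix a c W1 W2.
have hz := congr1 size (sorted_gtn_split a hts5); rewrite size_cat in hz.
rewrite EW count_cat in cnt; rewrite EW.
move: big cnt hz hB1 hA2 hsp => /=; clear; lia.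
Qed.

(** The move exchanges [c] and [c.+1] in the first word, [c.+2] and [c.+1] in the second. The
    bracket lemma is applied with openers up to [a], closers between [a] and [c], and neutral
    letters above [c.+2]. *)
Lemma dual_weak_exchange :
  weak (dual c s) (dual c (v ++ [:: c.+2; c] ++ L ++ c.+1 :: W)).
Proof.
have [[h0 h1] h2'] := mem_triple c.
have Ev := map_transp_id _ _ hv; have EL := map_transp_id _ _ hL.
have Ew := map_transp_id _ _ hW.
have Ts : triple c s = [:: c; c.+2; c.+1].
  rewrite /s -[c.+1 :: W]cat1s !triple_cat hv hL hW cats0.
  by rewrite /triple /= !mem_triple.
have Tt : triple c (v ++ [:: c.+2; c] ++ L ++ c.+1 :: W) = [:: c.+2; c; c.+1].
  rewrite -[c.+1 :: W]cat1s !triple_cat hv hL hW cats0.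
  by rewrite /triple /= !mem_triple.
rewrite (dual_eq Ts) (dual_eq Tt) /s !map_cat /= !Ev // !EL // !Ew //.
rewrite /transp !(eqxx, triple_neq).
have us := in_class_uniq hs.
have uLW : uniq (L ++ W).
  apply: subseq_uniq us; rewrite /s; apply: subseq_trans (suffix_subseq v _).
  apply: subseq_trans (suffix_subseq _ _); apply: cat_subseq => //.
  exact: (suffix_subseq [:: c.+1]).
have hB' : sorted gtn [seq x <- W | a < x < c].
  have : knuth [seq x <- u | a < x < c] [seq x <- s | a < x < c].
    apply/knuth_sym/(in_class_filter _ _ hs) => x /=.
      move/andP=> [_ /ltnW h]; rewrite (leq_trans h) // (leq_trans _ hck) // ltnW //.
    move=> y z /andP[hxy hyz] /andP[hax _] /andP[_ hzc].
    by rewrite (ltn_trans hax hxy) (ltn_trans hyz hzc).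
  move/knuth_decreasing => /(_ hB) E; move: hB; rewrite E /s !filter_cat.
  case/cat_sorted2 => _ /cat_sorted2[_] /cat_sorted2[_] /=.
  by rewrite [c.+1 < c]ltnNge leqnSn andbF.
have hgood : all (fun x => (x < c) || (c.+2 < x)) (L ++ W).
  by apply/allP => x; rewrite mem_cat => /orP[/(notin_triple hL)|/(notin_triple hW)].
have hcw : c <= c.+2 by clear; lia.
have := weak_catl v (weak_exchange_brackets hac hcw (leqnn c) (ltnSn c) (ltnSn c.+1)
  (leqnn c.+2) uLW hgood exchange_closers hB' exchange_surplus).
by [].
Qed.

End Exchange.

(** * Ballot words *)

(* A word of column indices, [true] standing for the second column. *)
Inductive ballot : seq bool -> Prop :=
| ballot_nil : ballot [::]
| ballot_rcons w (b : bool) : ballot w -> (b -> count_mem true w < count_mem false w) ->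
    ballot (rcons w b).

Lemma ballot_inv w b : ballot (rcons w b) ->
  ballot w /\ (b -> count_mem true w < count_mem false w).
Proof.
move E : (rcons w b) => w' h; case: h E => [|v d hv hd]; first by case: w.
by move/rcons_inj => -[-> ->].
Qed.

Lemma ballot_count w : ballot w -> count_mem true w <= count_mem false w.
Proof.
elim=> // {}w b _ IH h; rewrite -cats1 !count_cat /= !addn0.
by case: b h => h; rewrite ?addn0 ?addn1 //; [exact: h|apply: leqW].
Qed.

Lemma ballot_prefix p q : ballot (p ++ q) -> ballot p.
Proof.
elim/last_ind: q => [|q b IH]; first by rewrite cats0.
by rewrite -rcons_cat => /ballot_inv[/IH].
Qed.

Lemma ballot_local p m m' q : count_mem true m = count_mem true m' ->
    count_mem false m = count_mem false m' ->
    (ballot (p ++ m) -> ballot (p ++ m')) ->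
  ballot (p ++ m ++ q) -> ballot (p ++ m' ++ q).
Proof.
move=> ht hf h; elim/last_ind: q => [|q b IH]; first by rewrite !cats0.
rewrite -!rcons_cat => /ballot_inv[/IH h1 h2]; apply: ballot_rcons => //.
by move=> /h2; rewrite !count_cat ht hf.
Qed.

(* On tableaux, [ascend_fft] and [ascend_tft] are dual moves at a triple whose
   middle value is read first.  [reach_back] inverts [ascend_fft]; there the
   middle value is read last, and the prefix is kept to a block so that the
   bracket argument of [dual_weak_exchange] applies. *)
Inductive ascend : seq bool -> seq bool -> Prop :=
| ascend_refl w : ascend w w
| ascend_trans w1 w2 w3 : ascend w1 w2 -> ascend w2 w3 -> ascend w1 w3
| ascend_fft p q : ascend (p ++ [:: false; false; true] ++ q) (p ++ [:: false; true; false] ++ q)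
| ascend_tft p q : ascend (p ++ [:: true; false; true] ++ q) (p ++ [:: false; true; true] ++ q).

Inductive reach : seq bool -> seq bool -> Prop :=
| reach_ascend w1 w2 : ascend w1 w2 -> reach w1 w2
| reach_trans w1 w2 w3 : reach w1 w2 -> reach w2 w3 -> reach w1 w3
| reach_back a b q : b <= a ->
    reach (nseq a false ++ nseq b true ++ [:: false; true; false] ++ q)
          (nseq a false ++ nseq b true ++ [:: false; false; true] ++ q).

Lemma ascend_ctx p q w w' : ascend w w' -> ascend (p ++ w ++ q) (p ++ w' ++ q).
Proof.
elim=> {w w'} [w|w1 w2 w3 _ h1 _ h2|p' q'|p' q'].
- exact: ascend_refl.
- exact: ascend_trans h1 h2.
- by have := ascend_fft (p ++ p') (q' ++ q); rewrite -!catA.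
- by have := ascend_tft (p ++ p') (q' ++ q); rewrite -!catA.
Qed.

Lemma ascend_catl p w w' : ascend w w' -> ascend (p ++ w) (p ++ w').
Proof. by move/(ascend_ctx p [::]); rewrite !cats0. Qed.

Lemma ascend_catr q w w' : ascend w w' -> ascend (w ++ q) (w' ++ q).
Proof. exact: (ascend_ctx [::] q). Qed.

Lemma reach_catr q w w' : reach w w' -> reach (w ++ q) (w' ++ q).
Proof.
elim=> {w w'} [w w' h|w1 w2 w3 _ h1 _ h2|a b q' hab].
- exact/reach_ascend/ascend_catr.
- exact: reach_trans h1 h2.
- by have := reach_back (q' ++ q) hab; rewrite -!catA.
Qed.

Lemma ascend_count w w' b : ascend w w' -> count_mem b w = count_mem b w'.
Proof.
elim=> {w w'} [w|w1 w2 w3 _ -> _ ->|p q|p q] //.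
all: by rewrite !count_cat; congr (_ + (_ + _)); case: b.
Qed.

Lemma reach_count w w' b : reach w w' -> count_mem b w = count_mem b w'.
Proof.
elim=> {w w'} [w w'|w1 w2 w3 _ -> _ ->|a d q _] //; first exact: ascend_count.
by rewrite !count_cat; congr (_ + (_ + (_ + _))); case: b.
Qed.

Lemma ascend_ballot w w' : ascend w w' -> ballot w -> ballot w'.
Proof.
have build p m : ballot p -> count_mem true p <= count_mem false p ->
   (forall i, i < size m -> nth false m i ->
      count_mem true p + count_mem true (take i m) < count_mem false p + count_mem false (take i m)) ->
   ballot (p ++ m).
  move=> hp _; elim/last_ind: m => [|m b IH] h; first by rewrite cats0.
  rewrite -rcons_cat; apply: ballot_rcons.
    apply: IH => i hi hb; have := h i; rewrite size_rcons nth_rcons hi ltnS (ltnW hi).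
    by move=> /(_ isT hb); rewrite -cats1 takel_cat // ltnW.
  move=> hb; have := h (size m); rewrite size_rcons nth_rcons ltnn eqxx ltnSn hb.
  by move=> /(_ isT isT); rewrite -cats1 take_size_cat // !count_cat.
elim=> {w w'} [w|w1 w2 w3 _ h1 _ h2 /h1/h2|p q|p q] //; apply: ballot_local => // h.
  have hp := ballot_prefix h; have hc := ballot_count hp.
  by apply: build => // -[|[|[|i]]] //= _ _; rewrite !addn0 addn1 ltnS.
have hp := ballot_prefix h; have hc := ballot_count hp.
have hlt : count_mem true p < count_mem false p.
  have : ballot (p ++ [:: true]) by apply: (@ballot_prefix _ [:: false; true]); rewrite -catA.
  by rewrite cats1 => /ballot_inv[_]; apply.
apply: build => // -[|[|[|i]]] //= _ _; first by rewrite !addn0 addn1 ltnS.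
by rewrite !addn1 ltnS.
Qed.

Lemma reach_ballot w w' : reach w w' -> ballot w -> ballot w'.
Proof.
elim=> {w w'} [w w'|w1 w2 w3 _ h1 _ h2 /h1/h2|a b q _] //; first exact: ascend_ballot.
rewrite !catA -![(_ ++ [:: _; _; _]) ++ q]catA; apply: ballot_local => // h.
have hp := ballot_prefix h; have hc := ballot_count hp.
rewrite -[[:: false; false; true]]/([:: false] ++ [:: false] ++ [:: true]) !catA !cats1.
move: (nseq a _ ++ _) hp hc => p hp hc.
apply: ballot_rcons; first by do 2 (apply: ballot_rcons; last by []).
rewrite -!cats1 !count_cat /= => _; by rewrite !addn0 !addn1 ltnS leqW.
Qed.

Definition zigzag q := flatten (nseq q [:: false; true]).

Lemma zigzagS q : zigzag q.+1 = zigzag q ++ [:: false; true].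
Proof. by elim: q => [//|q IH]; rewrite -[zigzag q.+2]/([:: false; true] ++ zigzag q.+1) {1}IH. Qed.

Lemma nseqSr T n (x : T) : nseq n.+1 x = nseq n x ++ [:: x].
Proof. by elim: n => [//|n IH]; rewrite -[nseq n.+2 x]/(x :: nseq n.+1 x) {1}IH. Qed.

Lemma ascend_zigzag_block q : ascend (zigzag q) (nseq q false ++ nseq q true).
Proof.
have slide b : ascend (nseq b true ++ [:: false; true]) ([:: false] ++ nseq b.+1 true).
  elim: b => [|b IH]; first exact: ascend_refl.
  apply: ascend_trans (ascend_catl [:: true] IH) _.
  exact: (ascend_tft [::] (nseq b true)).
elim: q => [|q IH]; first exact: ascend_refl.
rewrite zigzagS; apply: ascend_trans (ascend_catr _ IH) _.
rewrite nseqSr -!catA; exact: ascend_catl.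
Qed.

Lemma ascend_block_zigzag q : ascend (nseq q false ++ nseq q true) (zigzag q).
Proof.
have slide b : ascend (nseq b false ++ [:: false; true]) ([:: false; true] ++ nseq b false).
  elim: b => [|b IH]; first exact: ascend_refl.
  apply: ascend_trans (ascend_catl [:: false] IH) _.
  exact: (ascend_fft [::] (nseq b false)).
elim: q => [|q IH]; first exact: ascend_refl.
rewrite nseqSr -catA -[nseq q.+1 true]/([:: true] ++ nseq q true).
rewrite -[[:: false] ++ _]/([:: false; true] ++ nseq q true) catA.
apply: ascend_trans (ascend_catr _ (slide q)) _; rewrite -catA.
exact: (ascend_catl [:: false; true] IH).
Qed.

(** The alternating word is the way through: the block of [q] pairs is opened into [zigzag q], the
    extra [false] crosses it pair by pair, and the block is closed again. The surplus [false]
    letters in front stay untouched. *)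
Lemma ascend_rotate p q : q <= p ->
  ascend (nseq p.+1 false ++ nseq q true) (nseq p false ++ nseq q true ++ [:: false]).
Proof.
have zz b : ascend (false :: zigzag b) (zigzag b ++ [:: false]).
  elim: b => [|b IH]; first exact: ascend_refl.
  apply: ascend_trans (ascend_fft [::] (zigzag b)) _.
  exact: (ascend_catl [:: false; true] IH).
move/subnKC => <-; rewrite addnC -addnS !nseqD -!catA; apply: ascend_catl.
rewrite -[nseq q.+1 false]/([:: false] ++ nseq q false) -catA.
apply: ascend_trans (ascend_catl [:: false] (ascend_block_zigzag q)) _.
apply: ascend_trans (zz q) _; rewrite catA.
exact: ascend_catr (ascend_zigzag_block q).
Qed.

Lemma ascend_from_block w : ballot w ->
  ascend (nseq (count_mem false w) false ++ nseq (count_mem true w) true) w.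
Proof.
elim=> [|{}w [] hw IH _]; first exact: ascend_refl.
  rewrite -cats1 !count_cat /= !addn0 addn1 nseqSr catA.
  exact: ascend_catr.
rewrite -cats1 !count_cat /= !addn0 addn1.
apply: ascend_trans (ascend_rotate (ballot_count hw)) _.
by rewrite catA; exact: ascend_catr.
Qed.

(** Rotating a smaller block exposes the factor [false true false] right behind a block, the only
    place where [reach_back] applies. After that step, induction on [q] absorbs the two [false]
    letters one after the other. *)
Lemma reach_unrotate p q : q <= p ->
  reach (nseq p false ++ nseq q true ++ [:: false]) (nseq p.+1 false ++ nseq q true).
Proof.
elim: q p => [|q IH] p.
  by rewrite cats0 nseqSr => _; apply/reach_ascend/ascend_refl.
case: p => [//|p]; rewrite ltnS => hqp.
have h1 : reach (nseq p.+1 false ++ nseq q.+1 true ++ [:: false])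
    (nseq p false ++ nseq q true ++ [:: false; true; false]).
  apply: reach_ascend; rewrite [nseq q.+1 true]nseqSr -catA.
  have := ascend_catr [:: true; false] (ascend_rotate hqp).
  by rewrite -!catA.
apply: reach_trans h1 _.
have := reach_back [::] hqp; rewrite !cats0 => h2.
apply: reach_trans h2 _.
have h3 := reach_catr [:: false; true] (IH p hqp).
rewrite -!catA in h3; apply: reach_trans h3 _.
have h4 := reach_catr [:: true] (IH p.+1 (leqW hqp)).
rewrite -!catA in h4; rewrite [nseq q.+1 true]nseqSr.
exact: h4.
Qed.

Lemma reach_to_block w : ballot w ->
  reach w (nseq (count_mem false w) false ++ nseq (count_mem true w) true).
Proof.
elim=> [|{}w [] hw IH _]; first exact/reach_ascend/ascend_refl.
  rewrite -cats1 !count_cat /= !addn0 addn1 nseqSr catA.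
  exact: reach_catr.
rewrite -cats1 !count_cat /= !addn0 addn1.
apply: reach_trans (reach_catr [:: false] IH) _; rewrite -catA.
exact: reach_unrotate (ballot_count hw).
Qed.

Theorem ballot_reach w w' : ballot w -> ballot w' ->
    count_mem true w = count_mem true w' -> count_mem false w = count_mem false w' ->
  reach w w'.
Proof.
move=> hw hw' ht hf; apply: reach_trans (reach_to_block hw) _.
by rewrite ht hf; apply/reach_ascend/ascend_from_block.
Qed.

(** * Column words *)

Definition column (b : bool) (i : nat) (w : seq bool) : seq nat :=
  mask [seq b == d | d <- w] (iota i (size w)).

Definition column_word (w : seq bool) : seq nat :=
  rev (column false 1 w) ++ rev (column true 1 w).

Definition column_tableau (w : seq bool) : tableau :=
  two_columns (column false 1 w) (column true 1 w).

Lemma column_cat b i p q :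
  column b i (p ++ q) = column b i p ++ column b (i + size p) q.
Proof. by rewrite /column size_cat iotaD map_cat mask_cat // size_map size_iota. Qed.

Lemma column_subseq b i w : subseq (column b i w) (iota i (size w)).
Proof. exact: mask_subseq. Qed.

Lemma mem_column b i w x : x \in column b i w -> i <= x < i + size w.
Proof. by move/(mem_subseq (column_subseq b i w)); rewrite mem_iota. Qed.

Lemma column_sorted b i w : sorted ltn (column b i w).
Proof. exact: (subseq_sorted ltn_trans (column_subseq b i w)) (iota_ltn_sorted _ _). Qed.

Lemma size_column b i w : size (column b i w) = count_mem b w.
Proof.
rewrite size_mask ?size_map ?size_iota // count_map; apply: eq_count => d /=.
by rewrite eq_sym.
Qed.

Lemma column_perm i w :
  perm_eq (column false i w ++ column true i w) (iota i (size w)).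
Proof.
elim: w i => [//|d w IH] i; rewrite /column /=; case: d => /=; last by rewrite perm_cons IH.
apply/seq.permP => p; move/seq.permP/(_ p): (IH i.+1).
by rewrite /column !count_cat /= => <-; rewrite addnCA.
Qed.

Lemma column_word_perm w : perm_eq (column_word w) (iota 1 (size w)).
Proof.
apply: perm_trans (column_perm 1 w); apply: perm_cat; by rewrite perm_rev.
Qed.

Lemma column_word_uniq w : uniq (column_word w).
Proof. by rewrite (perm_uniq (column_word_perm w)) iota_uniq. Qed.

Lemma dom_rcons a b x : dom a b -> dom (rcons a x) b.
Proof. by elim: a b => [|y a IH] [|z b]; rewrite ?dom0 //= => /andP[-> /IH]. Qed.

Lemma dom_rcons2 a b x : dom a b -> size b < size a -> all (ltn^~ x) a ->
  dom a (rcons b x).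
Proof.
elim: a b => [//|y a IH] [|z b]; first by move=> _ _ /andP[/= -> _]; rewrite dom0.
by move=> /andP[h1 h2] hs /andP[_ h3] /=; rewrite h1 IH.
Qed.

Lemma ballot_dom w : ballot w -> dom (column false 1 w) (column true 1 w).
Proof.
elim=> // {}w b _ IH h; rewrite -cats1 !column_cat /column /= add1n.
case: b h => /= h; rewrite !cats0 cats1; last exact: dom_rcons.
apply: dom_rcons2 => //; first by rewrite !size_column h.
by apply/allP => x /mem_column /andP[_]; rewrite add1n.
Qed.

Lemma tabl_column_word w : ballot w -> tabl (column_word w) = column_tableau w.
Proof. by move=> h; apply: tabl_two_columns; rewrite ?column_sorted ?ballot_dom. Qed.

Lemma map_two_columns f a b :
  map (map f) (two_columns a b) = two_columns (map f a) (map f b).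
Proof. by elim: a b => [|x a IH] [|y b] //=; rewrite IH. Qed.

Lemma all_size_two_columns a b : all (fun r => size r <= 2) (two_columns a b).
Proof. by elim: a b => [|x a IH] [|y b] //=. Qed.

Lemma shape_two_columns a b a' b' : size a = size a' -> size b = size b' ->
  shape (two_columns a b) = shape (two_columns a' b').
Proof.
elim: a a' b b' => [|x a IH] [|x' a'] // b b' [ha]; case: b b' => [|y b] [|y' b'] // => [_|[hb]].
  by rewrite /= (IH a' [::] [::]).
by rewrite /= (IH a' b b').
Qed.

Lemma triple_reading_skip c a1 a2 b1 b2 : size a1 = size b1 ->
    triple c a1 = [::] -> triple c b1 = [::] ->
  triple c (reading (two_columns (a1 ++ a2) (b1 ++ b2))) =
  triple c (reading (two_columns a2 b2)).
Proof.
elim: a1 b1 => [|x a1 IH] [|y b1] //= [hs]; rewrite /triple /=.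
case hx : (c <= x <= _) => //; case hy : (c <= y <= _) => // h1 h2.
by rewrite reading_cons filter_cat /= hx hy cats0; exact: IH.
Qed.

Lemma triple_reading_col c a b : triple c b = [::] ->
  triple c (reading (two_columns a b)) = rev (triple c a).
Proof.
elim: a b => [//|x a IH] b hb.
have -> : triple c (x :: a) = triple c [:: x] ++ triple c a by rewrite -triple_cat.
rewrite rev_cat; case: b hb => [|y b] hb.
  rewrite [two_columns _ _]/= reading_cons triple_cat IH //; congr (_ ++ _).
  by rewrite /triple /=; case: ifP.
rewrite [two_columns _ _]/= reading_cons triple_cat IH; last first.
  by move: hb; rewrite /triple /=; case: ifP.
congr (_ ++ _); move: hb; rewrite /triple /=; case: ifP => // hy _.
by case: ifP.
Qed.

Lemma triple_small c s : all (ltn^~ c) s -> triple c s = [::].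
Proof.
move=> h; apply/eqP; rewrite -[_ == _]negbK -has_filter; apply/hasPn => x /(allP h) /=.
by rewrite ltnNge => /negbTE->.
Qed.

Lemma triple_large c s : all (ltn c.+2) s -> triple c s = [::].
Proof.
move=> h; apply/eqP; rewrite -[_ == _]negbK -has_filter; apply/hasPn => x /(allP h) /=.
by rewrite ltnNge => /negbTE->; rewrite andbF.
Qed.

Lemma triple_column b p q : 
  triple (size p).+1 (column b 1 p) = [::] /\
  triple (size p).+1 (column b (size p).+4 q) = [::].
Proof.
split; [apply: triple_small|apply: triple_large]; apply/allP => x /mem_column.
  by rewrite add1n => /andP[_].
by case/andP.
Qed.

(* The column word of the tableau meets these letters in the same order. *)
Lemma triple_reading c a1 a2 b1 b2 x : size b1 <= size a1 -> triple c a1 = [::] ->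
    triple c b1 = [::] -> triple c b2 = [::] -> a2 != [::] -> c <= x <= c.+2 ->
  triple c (reading (two_columns (a1 ++ a2) (b1 ++ x :: b2))) =
  rev (triple c a2) ++ [:: x].
Proof.
move=> hs ha hb hb2 h2 hx.
have [h1 h3] : triple c (take (size b1) a1) = [::] /\ triple c (drop (size b1) a1) = [::].
  move: ha; rewrite -{1}(cat_take_drop (size b1) a1) triple_cat.
  by case: (triple c (take _ _)); case: (triple c (drop _ _)).
rewrite -{1}(cat_take_drop (size b1) a1) -catA triple_reading_skip ?size_takel //.
set a3 := drop (size b1) a1 in h3 *.
have -> : rev (triple c a2) = rev (triple c (a3 ++ a2)) by rewrite triple_cat h3.
have : a3 ++ a2 != [::] by case: (a3) => //; case: (a2) h2.
case: (a3 ++ a2) => [//|y a] _; rewrite [two_columns _ _]/= reading_cons triple_cat triple_reading_col //.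
rewrite -[y :: a]cat1s triple_cat rev_cat -catA; congr (_ ++ _).
by rewrite /triple /= hx; case: ifP.
Qed.

(** * Inner translation *)

Lemma size_nth_shape (R : tableau) i : size (nth [::] R i) = nth 0 (shape R) i.
Proof. by elim: R i => [|r R IH] [|i] //=. Qed.

Lemma translation_cons R R' r T : inner_translation R R' (r :: T) =
  (nth [::] R' 0 ++ drop (size (nth [::] R 0)) r) ::
  inner_translation (behead R) (behead R') T.
Proof.
rewrite /inner_translation /mkseq /=; congr cons.
rewrite -[1]addn0 iotaDl -map_comp; apply: eq_map => i /=.
by rewrite !add1n !nth_behead.
Qed.

Lemma translation_nil T : inner_translation [::] [::] T = T.
Proof. by elim: T => [//|r T IH]; rewrite translation_cons IH /= drop0. Qed.

Lemma translation_trans R R' R'' T :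
  inner_translation R' R'' (inner_translation R R' T) = inner_translation R R'' T.
Proof.
rewrite /inner_translation; apply: (@eq_from_nth _ [::]) => [|i].
  by rewrite !size_mkseq.
rewrite !size_mkseq => hi; rewrite !nth_mkseq ?size_mkseq //.
by rewrite drop_cat ltnn subnn drop0.
Qed.

Lemma sorted_filter_split k r : sorted ltn r ->
  r = [seq x <- r | x <= k] ++ [seq x <- r | k < x].
Proof.
elim: r => [//|x r IH] hs /=.
case: (leqP x k) => hx; first by rewrite /= -IH // (path_sorted hs).
have hr y : y \in r -> k < y.
  by move/(allP (order_path_min ltn_trans hs)); exact: ltn_trans.
rewrite (eq_in_filter (a2 := pred0)) ?filter_pred0; last first.
  by move=> y /hr /=; rewrite ltnNge => /negbTE.
by rewrite (eq_in_filter (a2 := predT)) ?filter_predT // => y /hr ->.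
Qed.

(** A vertical comparison is between two inner entries, or between an inner one and an outer one
    separated by [k], or between two outer ones, where it is inherited from the old rows. *)
Lemma dom_glue k r r2 r' r2' o o2 : size r' = size r -> size r2' = size r2 ->
    all (leq^~ k) r' -> all (ltn k) o2 ->
    dom r' r2' -> dom (r ++ o) (r2 ++ o2) -> dom (r' ++ o) (r2' ++ o2).
Proof.
elim: r r' r2 r2' o2 => [|x r IH] [|x' r'] // [|y r2] [|y' r2'] o2 //= hs hs2.
  case: o2 => [//|z o2] /andP[hx hr] /andP[hz ho] _ /andP[_ hd].
  rewrite (leq_ltn_trans hx hz) /=.
  by apply: (IH r' [::] [::]) => //; [case: hs|rewrite dom0].
move=> /andP[hx hr] ho /andP[hxy hd] /andP[_ hd'].
by rewrite hxy; apply: (IH r' r2 r2') => //; [case: hs|case: hs2].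
Qed.

Lemma translation_tab k T R' : tab T -> tab R' ->
    shape R' = shape (inner_tableau k T) -> all (all (leq^~ k)) R' ->
  tab (inner_translation (inner_tableau k T) R' T).
Proof.
elim: T R' => [//|r T IH] R' hrT hR' hsh hk.
move: (hrT); rewrite tab_cons => /and4P[h0 hr hT hd].
move: hsh; rewrite inner_cons; case: eqP => [E|/eqP E].
  rewrite (inner_nil hrT E); case: R' hR' hk => // _ _ _.
  by rewrite translation_nil.
case: R' hR' hk => [//|r' R'] hR' /andP[hk hk'] [hsz hsh].
rewrite translation_cons /= tab_cons.
have Er := sorted_filter_split k hr.
have Ed : drop (size [seq x <- r | x <= k]) r = [seq x <- r | k < x].
  by rewrite {2}Er drop_size_cat.
move: (hR'); rewrite tab_cons => /and4P[h0' hr' hT' hd'].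
rewrite Ed IH //; apply/and4P; split=> //.
- by move: E; rewrite -!size_eq0 -hsz; case: (r').
- rewrite (sorted_pairwise ltn_trans) pairwise_cat -!(sorted_pairwise ltn_trans).
  rewrite hr' (sorted_filter ltn_trans _ hr) !andbT; apply/allrelP => x y /(allP hk) /= hx.
  by rewrite mem_filter => /andP[hy _]; exact: leq_ltn_trans hx hy.
case: T hT hd hrT IH hsh => [//|r2 T] hT hd hrT _ hsh; rewrite translation_cons.
move: (hT); rewrite tab_cons => /and4P[_ hr2 _ _].
have Er2 := sorted_filter_split k hr2.
rewrite Er [X in dom _ X]Er2 in hd.
move: hsh; rewrite inner_cons; case: eqP => [E2|_].
  rewrite (inner_nil hT E2); case: R' hR' hk' hT' hd' => // _ _ _ _ _.
  rewrite /= drop0 Er2 E2 /=; apply: (@dom_glue k _ [::] r' [::] _ _ hsz erefl hk); rewrite ?dom0 ?filter_all //.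
  by rewrite E2 in hd.
case: R' hR' hk' hT' hd' => [//|r2' R'] _ _ _ hd' [hsz2 _] /=.
have -> : drop (size [seq x <- r2 | x <= k]) r2 = [seq x <- r2 | k < x].
  by rewrite {2}Er2 drop_size_cat.
by apply: (dom_glue hsz hsz2 hk _ hd' hd); exact: filter_all.
Qed.

(** This is how a transposition of inner values becomes an inner translation. *)
Lemma translation_map k f T : tab T -> (forall x, k < x -> f x = x) ->
  inner_translation (inner_tableau k T) (map (map f) (inner_tableau k T)) T =
  map (map f) T.
Proof.
move=> + hf; elim: T => [//|r T IH] hrT.
move: (hrT); rewrite tab_cons => /and4P[_ hr hT _].
have Er := sorted_filter_split k hr.
have Eo : map f [seq x <- r | k < x] = [seq x <- r | k < x].
  rewrite -[RHS]map_id; apply/eq_in_map => x; rewrite mem_filter => /andP[hx _].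
  exact: hf.
rewrite translation_cons inner_cons; case: eqP => [E|_] /=.
  have hn := inner_nil hrT E; have := IH hT; rewrite hn /= translation_nil drop0 => {1}->.
  by congr cons; rewrite Er E /= Eo.
rewrite IH // [in RHS]Er map_cat Eo; congr ((_ ++ _) :: _).
by rewrite {2}Er drop_size_cat.
Qed.

Lemma translation_id k T : tab T ->
  inner_translation (inner_tableau k T) (inner_tableau k T) T = T.
Proof.
move=> hT; have mid (U : tableau) : map (map id) U = U.
  by rewrite (eq_map (g := id)) ?map_id // => r; exact: map_id.
by have := @translation_map k id T hT (fun x _ => erefl x); rewrite !mid.
Qed.

(** * Bridges to permutations *)

Lemma dom_nth r r2 : dom r r2 <->
  size r2 <= size r /\ (forall j, j < size r2 -> nth 0 r j < nth 0 r2 j).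
Proof.
elim: r r2 => [|x r IH] [|y r2].
- by split.
- by split=> // -[].
- by split.
split=> [/andP[hxy /IH[hs h]]|[hs h]].
  by split=> [|[|j] hj] //; exact: h.
rewrite /= (h 0) //=; apply/IH; split=> // j hj; exact: (h j.+1).
Qed.

Lemma is_sytP n T : is_syt n T <-> tab T /\ perm_eq (flatten T) (iota 1 n).
Proof.
split=> [[h0 hs hr hc hp]|[/and3P[h0 hr hd] hp]]; split=> //.
- rewrite /tab h0 hr; apply/(sortedP [::]) => i hi; apply/dom_nth; split=> [|j hj].
    move/(sortedP 0)/(_ i): hs; rewrite size_map => /(_ hi).
    by rewrite -!size_nth_shape.
  exact: hc.
- apply/(sortedP 0) => i; rewrite size_map => hi; rewrite -!size_nth_shape.
  by have /dom_nth[] := (sortedP [::] hd i hi).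
move=> i j hj; have hi : i.+1 < size T.
  by rewrite ltnNge; apply/negP => h; rewrite nth_default in hj.
by have /dom_nth[_] := (sortedP [::] hd i hi); apply.
Qed.

Lemma one_line_perm n (s : 'S_n) : perm_eq (one_line s) (iota 1 n).
Proof.
apply: uniq_perm; rewrite ?iota_uniq //.
  rewrite map_inj_uniq ?enum_uniq // => i j [/val_inj]; exact: perm_inj.
move=> x; rewrite mem_iota add1n ltnS; apply/mapP/andP => [[i _ ->]|[hx hxn]].
  by split=> //; exact: ltn_ord.
have h : x.-1 < n by case: (x) hx hxn.
exists (s^-1 (Ordinal h))%g; first by rewrite mem_enum.
by rewrite permKV /= prednK.
Qed.

Lemma nth_one_line n (s : 'S_n) (i : 'I_n) : nth 0 (one_line s) i = (s i).+1.
Proof. by rewrite (nth_map i) ?size_enum_ord // nth_ord_enum. Qed.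

Lemma size_one_line n (s : 'S_n) : size (one_line s) = n.
Proof. by rewrite size_map size_enum_ord. Qed.

Lemma one_line_surj n w : perm_eq w (iota 1 n) -> exists s : 'S_n, one_line s = w.
Proof.
move=> hp; have hs : size w = n by rewrite (perm_size hp) size_iota.
have hu : uniq w by rewrite (perm_uniq hp) iota_uniq.
have hlt (i : 'I_n) : (nth 0 w i).-1 < n.
  have : nth 0 w i \in w by rewrite mem_nth // hs.
  by rewrite (perm_mem hp) mem_iota add1n ltnS; case: (nth 0 w i).
have hpos (i : 'I_n) : 0 < nth 0 w i.
  have : nth 0 w i \in w by rewrite mem_nth // hs.
  by rewrite (perm_mem hp) mem_iota => /andP[].
have inj : injective (fun i : 'I_n => Ordinal (hlt i)).
  move=> i j [] h; apply/val_inj/eqP; rewrite -(nth_uniq 0 _ _ hu) ?hs ?ltn_ord //.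
  by rewrite -(prednK (hpos i)) -(prednK (hpos j)) h.
exists (perm inj); apply: (@eq_from_nth _ 0); rewrite size_one_line ?hs // => i hi.
by rewrite -[i]/(val (Ordinal hi)) nth_one_line permE /= prednK // (hpos (Ordinal hi)).
Qed.

(** Applying [tperm i j] to both positions matches the inversions of the two permutations, except
    for the new one at [(i, j)]: exchanging adjacent positions reverses no other pair of
    positions. *)
Lemma perm_length_swap n (u : 'S_n) (i j : 'I_n) : val j = i.+1 -> u i < u j ->
  perm_length (tperm i j * u)%g = (perm_length u).+1.
Proof.
move=> hj hu; rewrite /perm_length.
pose f (p : 'I_n * 'I_n) := (tperm i j p.1, tperm i j p.2).
have finj : injective f by move=> [a b] [c d] [/perm_inj-> /perm_inj->].
have hij : i != j by rewrite -val_eqE /= hj neq_ltn ltnSn.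
set A := [set p | _]; set B := [set p | _].
have -> : A = (i, j) |: [set f p | p in B].
  apply/setP => -[a b]; rewrite !inE /=.
  have -> : ((a, b) \in [set f p | p in B]) =
      (tperm i j a < tperm i j b) && (u (tperm i j b) < u (tperm i j a)).
    have E : (a, b) = f (tperm i j a, tperm i j b) by rewrite /f /= !tpermK.
    by rewrite E mem_imset // inE.
  rewrite !permM xpair_eqE; have hij' : (i < j) by rewrite hj.
  case hab : ((a == i) && (b == j)).
    by case/andP: hab => /eqP-> /eqP->; rewrite tpermL tpermR hij' hu.
  case hba : ((a == j) && (b == i)).
    case/andP: hba => /eqP-> /eqP->; rewrite tpermL tpermR.
    by rewrite [j < i]ltnNge [u j < u i]ltnNge (ltnW hij') (ltnW hu) /= andbF.
  rewrite /=; congr (_ && _); move: hab hba; rewrite -!val_eqE.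
  case: tpermP => [->|->|/eqP + /eqP +]; case: tpermP => [->|->|/eqP + /eqP +];
    rewrite -?val_eqE ?eqxx /= ?hj //; clear; lia.
rewrite cardsU1 card_imset //.
suff -> : ((i, j) \notin [set f p | p in B]) by rewrite add1n.
apply/imsetP => -[[a b]]; rewrite inE /= => /andP[hab hub] [Ea Eb].
have Ea' : a = j by rewrite -(tpermK i j a) -Ea tpermL.
have Eb' : b = i by rewrite -(tpermK i j b) -Eb tpermR.
by move: hab; rewrite Ea' Eb' hj ltnNge leqnSn.
Qed.

Lemma weak_step_swap n (s t : 'S_n) : weak_step s t ->
  weak (one_line s) (one_line t).
Proof.
case/existsP => i /existsP[j /and3P[/eqP hj /eqP Et /eqP hl]].
(* The length condition forces an ascent: at a descent the exchange would shorten the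
   permutation. *)
have hlt : s i < s j.
  rewrite ltnNge leq_eqVlt; apply/negP => /orP[/eqP/val_inj/perm_inj E|h].
    by move: hj; rewrite E => /eqP; rewrite -[_ == _]negbK neq_ltn ltnSn.
  have h' : t i < t j by rewrite Et !permM tpermL tpermR.
  have := perm_length_swap hj h'.
  have -> : (tperm i j * t = s)%g by rewrite Et mulgA tperm2 mul1g.
  by rewrite hl => /eqP; rewrite -[_ == _]negbK neq_ltn leqnSn.
have hi2 : i.+1 < n by rewrite -hj; exact: ltn_ord.
have split2 (w : seq nat) : size w = n ->
    w = take i w ++ [:: nth 0 w i; nth 0 w j] ++ drop i.+2 w.
  move=> hw; rewrite -{1}(cat_take_drop i w); congr (_ ++ _).
  rewrite (drop_nth 0) ?hw 1?ltnW // (drop_nth 0) ?hw // -hj.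
  by [].
rewrite (split2 _ (size_one_line s)) (split2 _ (size_one_line t)) !nth_one_line.
have -> : take i (one_line t) = take i (one_line s).
  apply: (@eq_from_nth _ 0) => [|m]; rewrite !size_take !size_one_line // ltn_ord => hm.
  pose om := Ordinal (ltn_trans hm (ltn_ord i)).
  have e1 : i != om by rewrite -val_eqE /= neq_ltn hm orbT.
  have e2 : j != om by rewrite -val_eqE /= hj neq_ltn (ltn_trans hm (ltnSn i)) orbT.
  by rewrite !nth_take // -[m]/(val om) !nth_one_line Et permM tpermD.
have -> : drop i.+2 (one_line t) = drop i.+2 (one_line s).
  apply: (@eq_from_nth _ 0) => [|m]; rewrite !size_drop !size_one_line // => hm.
  have hm' : i.+2 + m < n by rewrite -ltn_subRL.
  have e1 : i != Ordinal hm' by rewrite -val_eqE /= neq_ltn; apply/orP; left; clear; lia.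
  have e2 : j != Ordinal hm' by rewrite -val_eqE /= hj neq_ltn; apply/orP; left; clear; lia.
  by rewrite !nth_drop -[i.+2 + m]/(val (Ordinal hm')) !nth_one_line Et permM tpermD.
rewrite Et !permM tpermL tpermR; apply: weak_swap; by rewrite ltnS.
Qed.

Lemma swap_weak_step n (s t : 'S_n) u v a b : a < b ->
    one_line s = u ++ [:: a; b] ++ v -> one_line t = u ++ [:: b; a] ++ v ->
  weak_step s t.
Proof.
move=> hab Es Et.
have hsz : size u + (size v).+2 = n.
  by rewrite -(size_one_line s) Es !size_cat /= !addnS.
have hi : size u < n by rewrite -hsz addnS ltnS leq_addr.
have hj : (size u).+1 < n by rewrite -hsz !addnS !ltnS leq_addr.
pose i := Ordinal hi; pose j := Ordinal hj.
have n0 x y : nth 0 (u ++ [:: x; y] ++ v) (size u) = x by rewrite nth_cat ltnn subnn.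
have n1 x y : nth 0 (u ++ [:: x; y] ++ v) (size u).+1 = y.
  by rewrite nth_cat ltnNge leqnSn subSnn.
have si : (s i).+1 = a by rewrite -nth_one_line Es n0.
have sj : (s j).+1 = b by rewrite -nth_one_line Es n1.
have hlt : s i < s j by rewrite -ltnS si sj.
apply/existsP; exists i; apply/existsP; exists j; rewrite eqxx /=.
have E : t = (tperm i j * s)%g.
  apply/permP => m; rewrite permM; apply/val_inj/succn_inj; rewrite -!nth_one_line Et Es.
  case: tpermP => [->|->|hmi hmj].
  - by rewrite n0 n1.
  - by rewrite n0 n1.
  rewrite !nth_cat; case: ltnP => // hm.
  have hm1 : val m != size u by apply/eqP => h; apply/hmi/val_inj.
  have hm2 : val m != (size u).+1 by apply/eqP => h; apply/hmj/val_inj.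
  have [d Ed] : exists d, m - size u = d.+2.
    by exists (m - (size u).+2); move: hm hm1 hm2 => /=; clear; lia.
  by rewrite Ed.
by rewrite E eqxx /=; apply/eqP/perm_length_swap.
Qed.

Lemma perm_weak_le_weak n (s t : 'S_n) : perm_weak_le s t ->
  weak (one_line s) (one_line t).
Proof.
case/connectP => p; elim: p s => [|r p IH] s /=; first by move=> _ ->; exact: weak_refl.
case/andP=> /weak_step_swap h /IH{}IH /IH; exact: weak_trans.
Qed.

Lemma weak_syt_weak_le n s t : weak s t -> perm_eq s (iota 1 n) ->
  syt_weak_le n (tabl s) (tabl t).
Proof.
elim=> {s t} [s t hk|u v a b hab|s x t hsx IH1 _ IH2] hs.
- have [w Ew] := one_line_surj hs; apply: t_step; exists w, w.
  rewrite /knuth_class /insertion_tableau Ew; split=> //; last exact: connect0.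
  by rewrite -(knuth_tabl hk) // (perm_uniq hs) iota_uniq.
- have [w Ew] := one_line_surj hs.
  have ht : perm_eq (u ++ [:: b; a] ++ v) (iota 1 n).
    by apply: perm_trans hs; rewrite perm_sym; exact: weak_perm (weak_swap _ _ hab).
  have [w' Ew'] := one_line_surj ht; apply: t_step; exists w, w'.
  rewrite /knuth_class /insertion_tableau Ew Ew'; split=> //.
  by apply: connect1; exact: swap_weak_step hab Ew Ew'.
- apply: t_trans (IH1 hs) (IH2 _).
  by apply: perm_trans hs; rewrite perm_sym weak_perm.
Qed.

(** Consecutive links of a chain of tableaux end and begin at possibly different words of one
    tableau; these are joined by Knuth moves. *)
Lemma syt_weak_le_weak n S T : syt_weak_le n S T -> exists s t,
  [/\ perm_eq s (iota 1 n), perm_eq t (iota 1 n), tabl s = S, tabl t = T & weak s t].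
Proof.
elim=> {S T} [S T [s [t [hs ht h]]]|S Q T _ [s [x [ps px Es Ex h1]]] _ [y [t [py pt Ey Et h2]]]].
  by exists (one_line s), (one_line t); split=> //; rewrite ?one_line_perm //; exact: perm_weak_le_weak.
exists s, t; split=> //; apply: weak_trans h1 (weak_trans _ h2); apply: weak_knuth.
have ux : uniq x by rewrite (perm_uniq px) iota_uniq.
have uy : uniq y by rewrite (perm_uniq py) iota_uniq.
apply: knuth_trans (knuth_reading ux) _; rewrite Ex -Ey.
exact: knuth_sym (knuth_reading uy).
Qed.

(** * Transfer between inner tableaux *)

Lemma column_from b k (f : pred nat) :
  column b 1 [seq f x | x <- iota 1 k] = [seq x <- iota 1 k | b == f x].
Proof. by rewrite /column size_map size_iota filter_mask -map_comp. Qed.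

(** The first column has a smaller entry beside each smaller entry of the second column, and one
    more beside [x] itself. *)
Lemma dom_count a b x : sorted ltn a -> sorted ltn b -> dom a b -> x \in b ->
  count (ltn^~ x) b < count (ltn^~ x) a.
Proof.
elim: a b => [[|? ?] //|y a IH] [//|z b] ha hb /andP[hyz hd].
have hz := order_path_min ltn_trans hb.
rewrite inE => /orP[/eqP->|hx] /=.
  rewrite ltnn hyz /= (eq_in_count (a2 := pred0)) ?count_pred0 ?add0n ?addn_gt0 //.
  by move=> t /(allP hz) /= h; rewrite ltnNge ltnW.
have hzx : z < x := allP hz x hx.
rewrite hzx (ltn_trans hyz hzx) ltn_add2l.
exact: IH (path_sorted ha) (path_sorted hb) hd hx.
Qed.

Lemma syt_column_tableau k R : is_syt k R -> all (fun r => size r <= 2) R ->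
  exists w, [/\ size w = k, ballot w & R = column_tableau w].
Proof.
case/is_sytP => hT hp h2.
have [E hb hd] := two_columns_eq hT h2; have ha := tab_heads hT.
set a := map _ R in E hd ha; set b := flatten _ in E hb hd.
have hab : perm_eq (a ++ b) (iota 1 k).
  by apply: perm_trans hp; rewrite perm_sym perm_columns.
have hu : uniq (a ++ b) by rewrite (perm_uniq hab) iota_uniq.
have hm x : (x \in iota 1 k) = (x \in a) || (x \in b).
  by rewrite -(perm_mem hab) mem_cat.
have hn x : x \in b -> x \notin a.
  by move=> hx; move: hu; rewrite cat_uniq => /and3P[_ /hasPn/(_ x hx) h _]; exact: h.
exists [seq x \in b | x <- iota 1 k]; split; first by rewrite size_map size_iota.
- have pre j : j <= k -> ballot [seq x \in b | x <- iota 1 j].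
    elim: j => [|j IH] hj; first exact: ballot_nil.
    rewrite -[j.+1]addn1 iotaD map_cat /= cats1 add1n; apply: ballot_rcons (IH (ltnW hj)) _ => hx.
    have cnt (s : seq nat) d : uniq s -> {subset s <= iota 1 k} ->
        (forall x, x \in iota 1 k -> (d == (x \in b)) = (x \in s)) ->
        count_mem d [seq x \in b | x <- iota 1 j] = count (ltn^~ j.+1) s.
      move=> us hs hds; rewrite count_map -size_filter -[RHS]size_filter; apply/perm_size.
      apply: uniq_perm; rewrite ?filter_uniq ?iota_uniq // => x.
      rewrite !mem_filter mem_iota add1n /=.
      case hx1 : (x < j.+1) => /=; last by rewrite !andbF.
      case hx0 : (0 < x) => /=; last first.
        by rewrite andbF; apply/esym/negP => /hs; rewrite mem_iota hx0.
      rewrite andbT [_ == d]eq_sym hds // mem_iota hx0 add1n ltnS /=.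
      exact: leq_trans (ltnW hx1) hj.
    rewrite (cnt b true) ?(cnt a false).
    + exact: dom_count.
    + by move: hu; rewrite cat_uniq => /and3P[].
    + by move=> x hx'; rewrite hm hx'.
    + move=> x; rewrite hm => /orP[hxa|hxb].
        by rewrite hxa; apply/eqP/esym/negP => /hn; rewrite hxa.
      by rewrite hxb; apply/esym/negbTE/hn.
    + by move: hu; rewrite cat_uniq => /and3P[].
    + by move=> x hx'; rewrite hm hx' orbT.
    + by move=> x _; case: (x \in b).
  exact: pre.
rewrite /column_tableau !column_from E; congr two_columns.
  apply: (irr_sorted_eq ltn_trans ltnn) => //.
    by apply: (sorted_filter ltn_trans); exact: iota_ltn_sorted.
  move=> x; rewrite mem_filter hm; case hxb : (x \in b) => /=; first exact/negbTE/hn.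
  by rewrite orbF.
apply: (irr_sorted_eq ltn_trans ltnn) => //.
  by apply: (sorted_filter ltn_trans); exact: iota_ltn_sorted.
move=> x; rewrite mem_filter hm; case hxb : (x \in b) => /=; by rewrite ?orbT.
Qed.

Definition has_inner (n k : nat) (w : seq bool) (S : tableau) : Prop :=
  is_syt n S /\ inner_tableau k S = column_tableau w.

Definition transfers (n k : nat) (w w' : seq bool) : Prop :=
  let V := inner_translation (column_tableau w) (column_tableau w') in
  (forall S, has_inner n k w S -> has_inner n k w' (V S)) /\
  (forall S T, has_inner n k w S -> has_inner n k w T ->
     syt_weak_le n S T -> syt_weak_le n (V S) (V T)).

Lemma has_inner_class n k w s : ballot w -> perm_eq s (iota 1 n) ->
  has_inner n k w (tabl s) <-> in_class n k (column_word w) s.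
Proof.
move=> hw hp; have hu : uniq s by rewrite (perm_uniq hp) iota_uniq.
have huk : uniq [seq x <- s | x <= k] by exact: filter_uniq.
have huw := column_word_uniq w; have hE := tabl_column_word hw.
rewrite /has_inner inner_tabl // -hE; split=> [[_ h]|[_ h]]; split=> //.
- apply: knuth_trans (knuth_reading huk) _; rewrite h.
  exact: knuth_sym (knuth_reading huw).
- by apply/is_sytP; rewrite tabl_tab // (perm_trans (tabl_perm s)).
- exact: knuth_tabl.
Qed.

Lemma has_inner_reading n k w S : ballot w -> has_inner n k w S ->
  [/\ perm_eq (reading S) (iota 1 n), tabl (reading S) = S &
      in_class n k (column_word w) (reading S)].
Proof.
move=> hw hS; have /is_sytP[hT hp] := hS.1.
have h := tabl_reading hT.
have hr : perm_eq (reading S) (iota 1 n) by rewrite (perm_trans (reading_perm S)).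
by split=> //; apply/(has_inner_class _ hw hr); rewrite h.
Qed.

Lemma transpK f l : involutive (transp f l).
Proof.
move=> x; rewrite /transp; case: (x =P f) => [->|hf].
  by case: (l =P f) => [//|hl]; rewrite eqxx.
case: (x =P l) => [->|hl]; first by rewrite eqxx.
by case: (x =P f) => // _; case: (x =P l).
Qed.

Lemma transp_perm f l s : uniq s -> f \in s -> l \in s -> perm_eq (map (transp f l) s) s.
Proof.
move=> hu hf hl; apply: uniq_perm => // [|x].
  by rewrite map_inj_uniq //; exact: can_inj (transpK f l).
have h y : y \in s -> transp f l y \in s.
  by rewrite /transp; case: (y =P f) => // _; case: (y =P l).
apply/mapP/idP => [[y hy ->]|hx]; first exact: h.
by exists (transp f l x); rewrite ?transpK // h.
Qed.

Lemma reading_map f T : reading (map (map f) T) = map f (reading T).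
Proof. by rewrite /reading -map_rev map_flatten. Qed.

Lemma all_two_columns (p : pred nat) a b : all p a -> all p b ->
  all (all p) (two_columns a b).
Proof.
elim: a b => [//|x a IH] [|y b] /=; first by move=> /andP[-> ha] _; rewrite /= IH.
by move=> /andP[-> ha] /andP[-> hb] /=; exact: IH.
Qed.

(** Dual moves commute with Knuth equivalence, so their effect on a tableau can be computed on its
    reading word. There the move exchanges two inner values determined by [w], and the result is
    again the reading word of a tableau. *)
Lemma transfers_dual n k c w w' : ballot w -> ballot w' -> size w = k -> size w' = k ->
    k <= n -> 0 < c -> c.+2 <= k -> has_triple c (column_word w) ->
    middle_first c (column_word w) || middle_last c (column_word w) ->
    triple c (reading (column_tableau w)) = triple c (column_word w) ->
    (forall b, map (transp (nth 0 (triple c (column_word w)) 0)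
                           (nth 0 (triple c (column_word w)) 2)) (column b 1 w) =
               column b 1 w') ->
    (forall s t, in_class n k (column_word w) s -> in_class n k (column_word w) t ->
       weak s t -> weak (dual c s) (dual c t)) ->
  transfers n k w w'.
Proof.
move=> hw hw' hsz hsz' hkn hc0 hck htu hmid hread hcol hmono.
set u := column_word w in htu hmid hread hcol hmono.
set f := nth 0 _ 0 in hcol; set l := nth 0 _ 2 in hcol.
have [_ hf hl] := triple_end htu hmid; rewrite -/f -/l in hf hl.
have hk x : (transp f l x <= k) = (x <= k).
  have hfk : f <= k by case/andP: hf => _ h; exact: leq_trans h hck.
  have hlk : l <= k by case/andP: hl => _ h; exact: leq_trans h hck.
  by rewrite /transp; case: eqP => [->|_]; [rewrite hfk hlk|case: eqP => [->|]; rewrite ?hfk ?hlk].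
have htr s : in_class n k u s -> triple c [seq x <- s | x <= k] = triple c s.
  move=> _; rewrite /triple -filter_predI; apply: eq_filter => x /=.
  by apply: andb_idr => /andP[_ hx]; exact: leq_trans hx hck.
have hTw : map (map (transp f l)) (column_tableau w) = column_tableau w'.
  by rewrite map_two_columns !hcol.
have huw' : dual c u = column_word w'.
  by rewrite /dual -/f -/l map_cat !map_rev !hcol.
have key s : in_class n k u s ->
    in_class n k (column_word w') (dual c s) /\
    tabl (dual c s) = inner_translation (column_tableau w) (column_tableau w') (tabl s).
  move=> hs; have us := in_class_uniq hs.
  have [hts e1 e2] := in_class_triple hs hck htu.
  have hms : middle_first c s || middle_last c s by rewrite e1 e2.
  have hps := hs.1.
  have hdp : perm_eq (dual c s) s.
    have hsz3 := perm_size hts.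
    apply: transp_perm => //; [have := mem_nth 0 (_ : 0 < size (triple c s))|
      have := mem_nth 0 (_ : 2 < size (triple c s))];
    by rewrite hsz3 => /(_ isT); rewrite mem_filter => /andP[].
  have hclass : in_class n k (column_word w') (dual c s).
    split; first exact: perm_trans hdp hps.
    rewrite -huw'.
    have [ht' e3 e4] : [/\ has_triple c [seq x <- s | x <= k],
        middle_first c [seq x <- s | x <= k] = middle_first c s &
        middle_last c [seq x <- s | x <= k] = middle_last c s].
      by rewrite /has_triple /middle_first /middle_last (htr _ hs).
    have [_ _ h] := dual_knuth hs.2 (filter_uniq _ us) ht'.
    have {}h := h _; rewrite e3 e4 in h; have {}h := h hms.
    apply: knuth_trans _ h; rewrite /dual (htr _ hs) filter_map.
    have [_ hf' hl'] := triple_end hts hms.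
    rewrite (eq_filter (a2 := leq^~ k)); first exact: knuth_refl.
    move=> x /=; rewrite /transp.
    have hfk : nth 0 (triple c s) 0 <= k by case/andP: hf' => _ h'; exact: leq_trans h' hck.
    have hlk : nth 0 (triple c s) 2 <= k by case/andP: hl' => _ h'; exact: leq_trans h' hck.
    by case: eqP => [->|_]; [rewrite hfk hlk|case: eqP => [->|]; rewrite ?hfk ?hlk].
  split=> //.
  have hT := tabl_tab us.
  have hin : inner_tableau k (tabl s) = column_tableau w.
    by have /(has_inner_class k hw hps)[] := hs.
  (* The ends of the triple may differ between [s] and the reading word of its tableau; after this
     passage they are [f] and [l]. *)
  have hk1 := knuth_reading us.
  have [_ _ /(_ hms) hk2] := dual_knuth hk1 us hts.
  have ud : uniq (dual c s) by rewrite (perm_uniq hdp).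
  rewrite (knuth_tabl hk2 ud).
  have htre : triple c (reading (tabl s)) = triple c u.
    rewrite -hread -hin reading_inner /triple -filter_predI; apply: eq_filter => x /=.
    by apply/esym/andb_idr => /andP[_ hx]; exact: leq_trans hx hck.
  rewrite /dual htre -/f -/l -reading_map.
  rewrite -(translation_map (k := k)) //; last first.
    move=> x hx; rewrite /transp; case: eqP => [E|_].
      by move: hx; rewrite E ltnNge; case/andP: hf => _ h; rewrite (leq_trans h hck).
    case: eqP => // E.
    by move: hx; rewrite E ltnNge; case/andP: hl => _ h; rewrite (leq_trans h hck).
  rewrite hin hTw tabl_reading //.
  rewrite -hin; apply: translation_tab => //.
  - by rewrite -tabl_column_word // tabl_tab // column_word_uniq.
  - rewrite hin; apply: shape_two_columns; by rewrite -hcol size_map.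
  - by apply: all_two_columns; apply/allP => x /mem_column; rewrite hsz' add1n ltnS => /andP[].
split=> [S hS|S T hS hT hST].
  have [hp hE hcl] := has_inner_reading hw hS.
  have [h1 h2] := key _ hcl; rewrite -{}hE -{}h2.
  by apply/has_inner_class => //; case: h1.
have [s [t [ps pt Es Et hst]]] := syt_weak_le_weak hST; subst S T.
have cs := (has_inner_class k hw ps).1 hS; have ct := (has_inner_class k hw pt).1 hT.
have [h1 <-] := key _ cs; have [h2 <-] := key _ ct.
by apply: weak_syt_weak_le (hmono _ _ cs ct hst) _; case: h1.
Qed.

Lemma column_split b p m q : size m = 3 ->
  column b 1 (p ++ m ++ q) =
  column b 1 p ++ column b (size p).+1 m ++ column b (size p).+4 q.
Proof. by move=> hm; rewrite !column_cat hm add1n addn3. Qed.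

Lemma column_word_inc3 w : ~ has_inc 3 (column_word w).
Proof. by move/has_inc_two_decreasing => /(_ (column_sorted _ _ _) (column_sorted _ _ _)). Qed.

Lemma all_size_column_word w : ballot w -> all (fun r => size r <= 2) (tabl (column_word w)).
Proof. by move=> hw; rewrite tabl_column_word // all_size_two_columns. Qed.

Lemma map_column b i w c f l : c <= f <= c.+2 -> c <= l <= c.+2 ->
  triple c (column b i w) = [::] -> map (transp f l) (column b i w) = column b i w.
Proof. by move=> hf hl; exact: map_transp_id. Qed.

Lemma triple_column_word p m q : size m = 3 -> let c := (size p).+1 in
  triple c (column_word (p ++ m ++ q)) = rev (column false c m) ++ rev (column true c m).
Proof.
move=> hm c; rewrite /column_word triple_cat !column_split // !rev_cat !triple_cat.
have hT b : triple c (rev (column b c m)) = rev (column b c m).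
  rewrite /triple filter_rev; congr rev; apply/all_filterP/allP => x /mem_column.
  by rewrite hm addn3 ltnS.
have [h1 h2] := triple_column false p q; have [h3 h4] := triple_column true p q.
have rv s : triple c s = [::] -> triple c (rev s) = [::] by rewrite /triple filter_rev => ->.
by rewrite !hT (rv _ h1) (rv _ h2) (rv _ h3) (rv _ h4) !cats0.
Qed.

(** * Moves at three consecutive letters of a ballot word *)

Section Local.
Variables (n k : nat) (p q : seq bool).
Let c := (size p).+1.


Lemma transfers_local m m' f x l : size m = 3 -> size m' = 3 ->
    let w := p ++ m ++ q in
    ballot w -> ballot (p ++ m' ++ q) -> size w = k -> k <= n ->
    rev (column false c m) ++ rev (column true c m) = [:: f; x; l] ->
    perm_eq [:: f; x; l] [:: c; c.+1; c.+2] -> (f == c.+1) || (l == c.+1) ->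
    triple c (reading (column_tableau w)) = [:: f; x; l] ->
    (forall b, map (transp f l) (column b c m) = column b c m') ->
    (forall s t, in_class n k (column_word w) s -> in_class n k (column_word w) t ->
       weak s t -> weak (dual c s) (dual c t)) ->
  transfers n k w (p ++ m' ++ q).
Proof.
move=> hm hm' w hw hw' hk hkn hT hp hfl hread hmap.
have ET : triple c (column_word w) = [:: f; x; l] by rewrite triple_column_word.
have htu : has_triple c (column_word w) by rewrite /has_triple ET.
have hmid : middle_first c (column_word w) || middle_last c (column_word w).
  by rewrite /middle_first /middle_last ET.
have [_ hf hl] := triple_end htu hmid; rewrite ET /= in hf hl.
apply: transfers_dual => //.
- by rewrite -hk /w !size_cat hm hm'.
- by rewrite -hk /w !size_cat hm /c; clear; lia.
- by rewrite ET.
move=> b; rewrite ET /= /w !column_split // !map_cat hmap.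
have [h1 h2] := triple_column b p q.
by rewrite !(map_column hf hl).
Qed.

Lemma ballot_size : ballot p -> size (column true 1 p) <= size (column false 1 p).
Proof. by move=> hp; rewrite !size_column ballot_count. Qed.

Lemma transfers_fft : let w := p ++ [:: false; false; true] ++ q in
    ballot w -> size w = k -> k <= n ->
  transfers n k w (p ++ [:: false; true; false] ++ q).
Proof.
move=> w hw hk hkn.
have hp := ballot_prefix hw; have hpq := ballot_size hp.
have hc2 : c.+2 <= k by rewrite -hk /w !size_cat /= /c; clear; lia.
have ET : triple c (column_word w) = [:: c.+1; c; c.+2] by rewrite triple_column_word.
have hperm : perm_eq [:: c.+1; c; c.+2] [:: c; c.+1; c.+2].
  by apply/seq.permP => P /=; rewrite addnCA.
have [h1 h2] := triple_column false p q; have [h3 h4] := triple_column true p q.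
apply: (@transfers_local _ _ c.+1 c c.+2) => //.
- by apply: ascend_ballot hw; exact: ascend_fft.
- by rewrite eqxx.
- rewrite /column_tableau /w !column_split //.
  rewrite triple_reading //; last by rewrite mem_triple.
  rewrite triple_cat h2 cats0 /column /= /triple /= !mem_triple //.
- by case; rewrite /column -/c /= /transp !(eqxx, triple_neq).
- apply: dual_weak_first => //.
  + exact: column_word_uniq.
  + exact: all_size_column_word.
  + exact: column_word_inc3.
  + by rewrite /has_triple ET.
  + by rewrite /middle_first ET.
Qed.

Lemma transfers_tft : let w := p ++ [:: true; false; true] ++ q in
    ballot w -> size w = k -> k <= n ->
  transfers n k w (p ++ [:: false; true; true] ++ q).
Proof.
move=> w hw hk hkn.
have hp := ballot_prefix hw.
have hpq : size (column true 1 p) < size (column false 1 p).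
  rewrite !size_column; have : ballot (p ++ [:: true]).
    by apply: (@ballot_prefix _ ([:: false; true] ++ q)); rewrite -catA.
  by rewrite cats1 => /ballot_inv[_]; apply.
have hc2 : c.+2 <= k by rewrite -hk /w !size_cat /= /c; clear; lia.
have ET : triple c (column_word w) = [:: c.+1; c.+2; c] by rewrite triple_column_word.
have hperm : perm_eq [:: c.+1; c.+2; c] [:: c; c.+1; c.+2].
  by apply/seq.permP => P /=; rewrite addn0; clear; lia.
have [h1 h2] := triple_column false p q; have [h3 h4] := triple_column true p q.
apply: (@transfers_local _ _ c.+1 c.+2 c) => //.
- by apply: ascend_ballot hw; exact: ascend_tft.
- by rewrite eqxx.
- have E0 : column false c [:: true; false; true] = [:: c.+1] by [].
  have E1 : column true c [:: true; false; true] = [:: c; c.+2] by [].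
  rewrite /column_tableau /w !column_split // -/c E0 E1.
  move: (column false 1 p) (column true 1 p) h1 h3 hpq => A B h1 h3 hAB.
  (* The entry [c] of the second column stands beside the first-column entry singled out here, which
     exists by the ballot condition. The rows below contribute [c.+1] and [c.+2] before [c] is
     read. *)
  have EA : A = take (size B) A ++ nth 0 A (size B) :: drop (size B).+1 A.
    by rewrite -drop_nth // cat_take_drop.
  have [hA0 hA1 hA2] : [/\ triple c (take (size B) A) = [::],
      triple c [:: nth 0 A (size B)] = [::] & triple c (drop (size B).+1 A) = [::]].
    move: h1; rewrite {1}EA -[_ :: drop _ _]cat1s !triple_cat.
    by case: (triple c (take _ _)); case: (triple c [:: _]); case: (triple c (drop _ _)).
  rewrite {1}EA -catA triple_reading_skip ?size_takel 1?ltnW // cat_cons.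
  rewrite [two_columns _ _]/= reading_cons triple_cat.
  have := @triple_reading c (drop (size B).+1 A) ([:: c.+1] ++ column false (size p).+4 q)
    [::] (column true (size p).+4 q) c.+2 isT hA2 erefl h4 isT (mem_triple c).2.
  rewrite triple_cat h2 cats0 cat0s => ->.
  rewrite -[[:: nth 0 A (size B); c]]/([:: nth 0 A (size B)] ++ [:: c]) triple_cat hA1.
  by rewrite /triple /= !mem_triple.
- by case; rewrite /column -/c /= /transp !(eqxx, triple_neq).
- apply: dual_weak_first => //.
  + exact: column_word_uniq.
  + exact: all_size_column_word.
  + exact: column_word_inc3.
  + by rewrite /has_triple ET.
  + by rewrite /middle_first ET.
Qed.

End Local.

Lemma column_block a b : let p := nseq a false ++ nseq b true in
  column false 1 p = iota 1 a /\ column true 1 p = iota a.+1 b.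
Proof.
have h d e i m : column d i (nseq m e) = if d == e then iota i m else [::].
  by elim: m i => [|m IH] i; [case: ifP|rewrite /column /= -/(column d i.+1 _) IH; case: (d == e)].
by split; rewrite column_cat !h /= ?cats0 // size_nseq add1n.
Qed.

Lemma filter_none (T : eqType) (P : pred T) s : (forall x, x \in s -> ~~ P x) ->
  filter P s = [::].
Proof. by move=> h; apply/eqP; rewrite -[_ == _]negbK -has_filter; apply/hasPn. Qed.

(** Here [c] and [c.+2] lie in the first column and [c.+1] in the second, so the triple is read as
    [c.+2], [c], [c.+1]. The block prefix supplies the hypotheses on openers and closers: [1..a]
    fill the first column and [a.+1..a+b] the second. *)
Lemma transfers_back n k a b q : b <= a ->
    let w := nseq a false ++ nseq b true ++ [:: false; true; false] ++ q in
    ballot w -> size w = k -> k <= n ->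
  transfers n k w (nseq a false ++ nseq b true ++ [:: false; false; true] ++ q).
Proof.
move=> hab w; rewrite /w !catA -![(_ ++ [:: _; _; _]) ++ q]catA => hw hk hkn {w}.
set p := nseq a false ++ nseq b true in hw hk *.
have hp := ballot_prefix hw; have hpq := ballot_size hp.
set c := (size p).+1; set w := p ++ [:: false; true; false] ++ q in hw hk *.
have Ec : c = (a + b).+1 by rewrite /c /p size_cat !size_nseq.
have hc2 : c.+2 <= k.
  have hq p' : (size p').+3 <= size (p' ++ [:: false; true; false] ++ q).
    by rewrite !size_cat /=; clear; lia.
  by rewrite -hk; exact: hq.
have ET : triple c (column_word w) = [:: c.+2; c; c.+1] by rewrite triple_column_word.
have hperm : perm_eq [:: c.+2; c; c.+1] [:: c; c.+1; c.+2].
  by apply/seq.permP => P /=; case: (P c); case: (P c.+1); case: (P c.+2).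
have [h1 h2] := triple_column false p q; have [h3 h4] := triple_column true p q.
apply: (@transfers_local _ _ p q [:: false; true; false] _ c.+2 c c.+1) => //.
- apply: reach_ballot hw; have := reach_back q hab.
  by rewrite /w /p !catA.
- by rewrite eqxx orbT.
- rewrite /column_tableau /w !column_split //.
  rewrite triple_reading //; last by rewrite mem_triple.
  by rewrite triple_cat h2 cats0 /column /= /triple /= !mem_triple.
- by case; rewrite /column -/c /= /transp !(eqxx, triple_neq c).
have hmf : middle_first c (column_word w) = false by rewrite /middle_first ET /= triple_neq.
have [cF cT] := column_block a b; rewrite -/p in cF cT.
set A' := column false (size p).+4 q; set B' := column true (size p).+4 q.
have E0 : column false 1 w = iota 1 a ++ [:: c; c.+2] ++ A'.
  by rewrite /w column_split // cF.
have E1 : column true 1 w = iota a.+1 b ++ [:: c.+1] ++ B'.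
  by rewrite /w column_split // cT.
have hA' x : x \in A' -> c.+2 < x by case/mem_column/andP.
have hB' x : x \in B' -> c.+2 < x by case/mem_column/andP.
have hi1 x : x \in iota 1 a -> x <= a by rewrite mem_iota add1n ltnS => /andP[].
have hi2 x : x \in iota a.+1 b -> a < x < c by rewrite mem_iota Ec addSn.
have hac : a < c by rewrite Ec ltnS leq_addr.
have Efilter (P : pred nat) : (forall x, c <= x -> ~~ P x) ->
    filter P (column_word w) = rev (filter P (iota 1 a)) ++ rev (filter P (iota a.+1 b)).
  move=> hP; rewrite filter_cat !filter_rev E0 E1 !filter_cat.
  rewrite (filter_none (s := A')); last first.
    by move=> x /hA' h; apply: hP; apply: leq_trans (ltnW h); clear; lia.
  rewrite (filter_none (s := B')); last first.
    by move=> x /hB' h; apply: hP; apply: leq_trans (ltnW h); clear; lia.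
  have n0 := hP c (leqnn c).
  have n1 : ~~ P c.+1 by apply: hP.
  have n2 : ~~ P c.+2 by apply: hP; clear; lia.
  by rewrite /= (negbTE n0) (negbTE n1) (negbTE n2) !cats0.
apply: dual_weak; rewrite ?hmf //.
- exact: column_word_uniq.
- exact: all_size_column_word.
- by rewrite /has_triple ET.
- by rewrite /middle_last ET /= eqxx.
move=> v z hs [hv /triple_split[L [W [Ez hL hW]]]]; subst z.
apply: (dual_weak_exchange (n := n) (k := k) (a := a) (u := column_word w)) => //.
- exact: column_word_inc3.
- rewrite Efilter => [|x hx]; last by rewrite -ltnNge (leq_trans hac).
  rewrite (filter_none (s := iota a.+1 b)) ?cats0.
    by congr rev; apply/all_filterP/allP => x /hi1.
  by move=> x /hi2 /andP[h _]; rewrite -ltnNge.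
- rewrite Efilter => [|x hx]; last by rewrite negb_and -!leqNgt hx orbT.
  rewrite (filter_none (s := iota 1 a)) => [|x /hi1 h]; last by rewrite ltnNge h.
  rewrite cat0s rev_sorted; apply: (sorted_filter ltn_trans); exact: iota_ltn_sorted.
(* Every letter of the second column exceeds every letter [1..a], so a decreasing subword stays
   within one of the two columns; here [b <= a] gives the bound [a]. *)
- move=> l; rewrite Efilter => [|x hx]; last by rewrite -leqNgt.
  rewrite rev_cat !revK.
  have -> : [seq x <- iota 1 a | x < c] = iota 1 a.
    by apply/all_filterP/allP => x /hi1 h; exact: leq_ltn_trans h hac.
  have -> : [seq x <- iota a.+1 b | x < c] = iota a.+1 b.
    by apply/all_filterP/allP => x /hi2 /andP[].
  case=> t [/subseq_catP[t1 [t2 [-> s1 s2]]] hs12 <-].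
  have z1 := size_subseq s1; have z2 := size_subseq s2; rewrite !size_iota in z1 z2.
  case: t1 s1 hs12 z1 => [|x t1] s1 hs12 z1; first exact: z2.
  case: t2 s2 hs12 z2 => [|y t2] s2 hs12 z2; first by rewrite cats0 (leq_trans z1).
  have hx : a < x by case/andP: (hi2 x (mem_subseq s1 (mem_head _ _))).
  have hy : y <= a := hi1 y (mem_subseq s2 (mem_head _ _)).
  have := order_path_min ltn_trans hs12; rewrite all_cat => /andP[_ /andP[/= hxy _]].
  by have := leq_trans (ltn_trans hx hxy) hy; rewrite ltnn.
(* The witness of length [a.+2] is the first column of the inner tableau on the entries at most
   [c.+2]. *)
- exists (iota 1 a ++ [:: c; c.+2]); split.
  + rewrite -filter_rev subseq_filter; apply/andP; split.
      rewrite all_cat /= leqnn !andbT; apply/andP; split; last by clear; lia.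
      apply/allP => x /hi1 h; apply: leq_trans h _; apply: leq_trans (ltnW hac) _.
      by clear; lia.
    rewrite /column_word rev_cat !revK E0; apply: subseq_trans (suffix_subseq _ _).
    by rewrite catA; exact: prefix_subseq.
  + rewrite (sorted_pairwise ltn_trans) pairwise_cat -!(sorted_pairwise ltn_trans).
    rewrite iota_ltn_sorted /= !andbT; apply/andP; split; last by clear; lia.
    apply/allrelP => x y /hi1 h; rewrite !inE => /orP[]/eqP->.
      exact: leq_ltn_trans h hac.
    by apply: ltn_trans (leq_ltn_trans h hac) _; clear; lia.
  by rewrite size_cat size_iota addn2.
Qed.

Lemma transfers_trans n k w1 w2 w3 : transfers n k w1 w2 -> transfers n k w2 w3 ->
  transfers n k w1 w3.
Proof.
move=> [h1 h2] [h3 h4]; split=> [S /h1/h3|S T hS hT hST].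
  by rewrite translation_trans.
have := h4 _ _ (h1 _ hS) (h1 _ hT) (h2 _ _ hS hT hST).
by rewrite !translation_trans.
Qed.

Lemma transfers_refl n k w : transfers n k w w.
Proof.
have id S : has_inner n k w S ->
    inner_translation (column_tableau w) (column_tableau w) S = S.
  by case=> /is_sytP[hT _] <-; exact: translation_id.
by split=> [S hS|S T hS hT]; rewrite !id.
Qed.

Lemma reach_size w w' : reach w w' -> size w' = size w.
Proof.
have h (v : seq bool) : size v = count_mem true v + count_mem false v.
  rewrite -(count_predC (pred1 true)); congr (_ + _); apply: eq_count => x /=.
  by case: x.
by move=> hr; rewrite !h -!(reach_count _ hr).
Qed.

Theorem reach_transfers n k w w' : reach w w' -> ballot w -> size w = k -> k <= n ->
  transfers n k w w'.
Proof.
move=> hr hw hk hkn; elim: hr hw hk => {w w'} [w w' ha|w1 w2 w3 h1 IH1 _ IH2|a b q hab] hw hk.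
- elim: ha hw hk => {w w'} [w|w1 w2 w3 h1 IH1 _ IH2|p q|p q] hw hk.
  + exact: transfers_refl.
  + apply: transfers_trans (IH1 hw hk) (IH2 (ascend_ballot h1 hw) _).
    by rewrite (reach_size (reach_ascend h1)).
  + exact: transfers_fft.
  + exact: transfers_tft.
- apply: transfers_trans (IH1 hw hk) (IH2 (reach_ballot h1 hw) _).
  by rewrite (reach_size h1).
- exact: transfers_back.
Qed.

Theorem corollary4p4 (n k : nat) (hk : 1 <= k < n)
    (R R' : tableau) (hR : is_syt k R) (hcols : ncols R = 2)
    (hR' : is_syt k R') (hshape : shape R' = shape R)
    (S T : tableau)
    (hS : syt_with_inner n k R S) (hT : syt_with_inner n k R T)
    (hcov : weak_covering n (syt_with_inner n k R) S T) :
  weak_covering n (syt_with_inner n k R')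
    (inner_translation R R' S) (inner_translation R R' T).
Proof.
have hkn : k <= n by case/andP: hk => _ /ltnW.
have h2 : all (fun r => size r <= 2) R.
  by apply/allP => r hr; rewrite -hcols /ncols (leq_bigmax_seq (F := size)).
have h2' : all (fun r => size r <= 2) R'.
  by move: h2; rewrite -(all_map size (leq^~ 2)) -/(shape R) -hshape all_map.
have [w [hsz hw ER]] := syt_column_tableau hR h2.
have [w' [hsz' hw' ER']] := syt_column_tableau hR' h2'.
(* Equal shapes give equally many letters [false]; the common length [k] then gives equally many
   letters [true], as [ballot_reach] demands. *)
have nrows (v : seq bool) : size (column_tableau v) = count_mem false v.
  rewrite -(size_column _ 1) /column_tableau.
  by elim: (column false 1 v) (column true 1 v) => [|x a IH] [|y b] //=; rewrite IH.
have cF : count_mem false w = count_mem false w'.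
  by rewrite -!nrows -ER -ER' -!(size_map size) -/(shape R) -/(shape R') hshape.
have cT : count_mem true w = count_mem true w'.
  have h (v : seq bool) : size v = count_mem true v + count_mem false v.
    rewrite -(count_predC (pred1 true)); congr (_ + _); apply: eq_count => x /=.
    by case: x.
  by apply: (@addIn (count_mem false w)); rewrite -h hsz -hsz' h cF.
have [hV leV] := reach_transfers (ballot_reach hw hw' cT cF) hw hsz hkn.
have [hV' leV'] := reach_transfers (ballot_reach hw' hw (esym cT) (esym cF)) hw' hsz' hkn.
rewrite -!ER -!ER' in hV leV hV' leV'.
have K U : syt_with_inner n k R U ->
    inner_translation R' R (inner_translation R R' U) = U.
  case=> /is_sytP[hU _] <-; rewrite translation_trans; exact: translation_id.
have K' U : syt_with_inner n k R' U ->
    inner_translation R R' (inner_translation R' R U) = U.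
  case=> /is_sytP[hU _] <-; rewrite translation_trans; exact: translation_id.
have iV U : syt_with_inner n k R U ->
    syt_with_inner n k R' (inner_translation R R' U).
  by move=> hU; have := hV U; rewrite /has_inner -ER -ER'; apply.
have iV' U : syt_with_inner n k R' U ->
    syt_with_inner n k R (inner_translation R' R U).
  by move=> hU; have := hV' U; rewrite /has_inner -ER -ER'; apply.
(* The two translations are now mutually inverse and monotone. A tableau strictly between the images
   would translate back to one strictly between [S] and [T]. *)
case: hcov => _ _ hST hne hno; split.
- exact: iV.
- exact: iV.
- by apply: leV; rewrite /has_inner -?ER.
- by move=> E; apply: hne; rewrite -(K S hS) E K.
case=> Q [hQ hQS hQT hSQ hQT']; apply: hno.
exists (inner_translation R' R Q); split.
- exact: iV'.
- by move=> E; apply: hQS; rewrite -E K'.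
- by move=> E; apply: hQT; rewrite -E K'.
- rewrite -(K S hS); apply: leV'; rewrite /has_inner -?ER' //; exact: iV.
- rewrite -(K T hT); apply: leV'; rewrite /has_inner -?ER' //; exact: iV.
Qed.
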